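(* Let $T>0$, $k,l\in\mathbb{N}$, $d=k+l$, $\alpha\in(\frac13,\frac12)$ and $p\in(1,+\infty)$ with $\alpha>1/p$. Let $\mathbf{X}\in W^\alpha_p([0,T];G^2(\mathbb{R}^k))$ and $\mathbf{Y}\in W^\alpha_p([0,T];G^2(\mathbb{R}^l))$. Then the admissible set $$\mathcal{A}(\mathbf{X},\mathbf{Y})=\{\mathbf{Z}\in W^\alpha_p([0,T];G^2(\mathbb{R}^d)):\pi_{d,k}(\mathbf{Z})=\mathbf{X}\text{ and }\pi_{d,l}(\mathbf{Z})=\mathbf{Y}\}$$ is non-empty. Moreover, let $F:\mathcal{A}(\mathbf{X},\mathbf{Y})\to\mathbb{R}\cup\{+\infty\}$ be a proper functional that admits an extension $\overline{F}$ defined on the Banach space $W^\alpha_p([0,T];\mathbb{R}^d\oplus(\mathbb{R}^d)^{\otimes2})$ which is coercive, convex, lower semi-continuous and equal to $+\infty$ outside $\mathcal{A}(\mathbf{X},\mathbf{Y})$. Then there exists at least one $\mathbf{Z}^*\in\mathcal{A}(\mathbf{X},\mathbf{Y})$ with $$F(\mathbf{Z}^* )=\min_{\mathbf{Z}\in\mathcal{A}(\mathbf{X},\mathbf{Y})}F(\mathbf{Z}).$$ If in addition $\overline{F}$ is strictly convex, then the minimizer $\mathbf{Z}^*$ is unique.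
   Context: $G^2(\mathbb{R}^d)=\exp(\mathbb{R}^d\oplus[\mathbb{R}^d,\mathbb{R}^d])\subset\mathbb{R}\oplus\mathbb{R}^d\oplus(\mathbb{R}^d)^{\otimes2}$, with $[a,b]=a\otimes b-b\otimes a$, is the step-2 free nilpotent group with truncated tensor product $\otimes$. It carries the Carnot–Carathéodory norm $\|g\|$ (infimum of the lengths of bounded variation paths in $\mathbb{R}^d$ whose step-2 signature is $g$) and metric $d_{cc}(g,h)=\|g^{-1}\otimes h\|$. $W^\alpha_p([0,T];G^2(\mathbb{R}^d))$ is the set of continuous paths with $\iint_{[0,T]^2}\frac{d_{cc}(\mathbf{X}_s,\mathbf{X}_t)^p}{|t-s|^{\alpha p+1}}\,ds\,dt<\infty$. Write $\mathbb{R}^d=\mathbb{R}^k\oplus\mathbb{R}^l$. $\pi_{d,k}:G^2(\mathbb{R}^d)\to G^2(\mathbb{R}^k)$ and $\pi_{d,l}:G^2(\mathbb{R}^d)\to G^2(\mathbb{R}^l)$ are the group homomorphisms extending the canonical linear projections $\mathbb{R}^d\to\mathbb{R}^k$ and $\mathbb{R}^d\to\mathbb{R}^l$. $W^\alpha_p([0,T];\mathbb{R}^d\oplus(\mathbb{R}^d)^{\otimes2})$ is the usual fractional Sobolev Banach space (norm: $L^p$-norm plus Sobolev seminorm). $\mathcal{A}(\mathbf{X},\mathbf{Y})$ is regarded as a subset of it by embedding $G^2(\mathbb{R}^d)$ in the affine space $1+\mathbb{R}^d\oplus(\mathbb{R}^d)^{\otimes2}$ and dropping the constant component $1$. Proper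 means that $F$ is finite at at least one point; coercive means that all sublevel sets are norm-bounded; strict convexity of an extended-valued functional refers to the points where it is finite. *)

(* Defs.v *)
From HB Require Import structures.
From mathcomp Require Import all_boot all_order all_algebra.
From mathcomp Require Import all_classical all_reals all_analysis.
From mathcomp Require Import ring.

Set Implicit Arguments.
Unset Strict Implicit.
Unset Printing Implicit Defensive.

Import Order.TTheory GRing.Theory Num.Theory.
Import numFieldNormedType.Exports.

Local Open Scope classical_set_scope.
Local Open Scope ring_scope.

(* R (+) R^d (+) (R^d)^{(x)2}; a 2-tensor is the matrix of its coordinates,
   so that the tensor product of the row vectors a and b is a^T *m b. *)
Definition tens2 (R : realType) (d : nat) : Type :=
  (R * 'rV[R]_d * 'M[R]_d)%type.

Definition tens2plus (R : realType) (d : nat) : Type :=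
  ('rV[R]_d * 'M[R]_d)%type.

Section Group.
Context {R : realType}.

Definition otimes d (a b : 'rV[R]_d) : 'M[R]_d := a^T *m b.

Definition lie_bracket d (a b : 'rV[R]_d) : 'M[R]_d := otimes a b - otimes b a.

Definition tone d : tens2 R d := (1, 0, 0).

Definition tmul d (g h : tens2 R d) : tens2 R d :=
  (g.1.1 * h.1.1,
   g.1.1 *: h.1.2 + h.1.1 *: g.1.2,
   g.1.1 *: h.2 + otimes g.1.2 h.1.2 + h.1.1 *: g.2).

(* 1 + x + x (x) x / 2, for x without scalar component. *)
Definition texp d (x : tens2plus R d) : tens2 R d :=
  (1, x.1, x.2 + 2^-1 *: otimes x.1 x.1).

(* Inverse of an element with scalar component 1: 1 - x + x (x) x
   for g = 1 + x. *)
Definition tinv d (g : tens2 R d) : tens2 R d :=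
  (1, - g.1.2, - g.2 + otimes g.1.2 g.1.2).

Definition lie_brackets d : set 'M[R]_d :=
  [set A | exists (n : nat) (c : 'I_n -> R) (a b : 'I_n -> 'rV[R]_d),
     A = \sum_(i < n) c i *: lie_bracket (a i) (b i)].

Definition G2 d : set (tens2 R d) :=
  [set g | exists (a : 'rV[R]_d) (A : 'M[R]_d),
     lie_brackets A /\ g = texp (a, A)].

(* The algebra maps induced by the projections of R^(k + l) onto its first k
   and last l coordinates; projl_mul, projl_exp, G2_projl (and the analogues
   for projr) show that they restrict to group homomorphisms between the G^2
   groups extending the linear projections. *)
Definition projl k l (g : tens2 R (k + l)) : tens2 R k :=
  (g.1.1, lsubmx g.1.2, ulsubmx g.2).

Definition projr k l (g : tens2 R (k + l)) : tens2 R l :=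
  (g.1.1, rsubmx g.1.2, drsubmx g.2).

Lemma otimes_ul k l (a b : 'rV[R]_(k + l)) :
  ulsubmx (otimes a b) = otimes (lsubmx a) (lsubmx b).
Proof. by apply/matrixP => i j; rewrite !mxE !big_ord1 !mxE. Qed.

Lemma otimes_dr k l (a b : 'rV[R]_(k + l)) :
  drsubmx (otimes a b) = otimes (rsubmx a) (rsubmx b).
Proof. by apply/matrixP => i j; rewrite !mxE !big_ord1 !mxE. Qed.

Lemma projl_mul k l (g h : tens2 R (k + l)) :
  projl (tmul g h) = tmul (projl g) (projl h).
Proof.
rewrite /projl /tmul /= -otimes_ul; congr (_, _, _).
  by apply/rowP => i; rewrite !mxE.
by apply/matrixP => i j; rewrite !mxE.
Qed.

Lemma projr_mul k l (g h : tens2 R (k + l)) :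
  projr (tmul g h) = tmul (projr g) (projr h).
Proof.
rewrite /projr /tmul /= -otimes_dr; congr (_, _, _).
  by apply/rowP => i; rewrite !mxE.
by apply/matrixP => i j; rewrite !mxE.
Qed.

Lemma projl_exp k l (a : 'rV[R]_(k + l)) (A : 'M[R]_(k + l)) :
  projl (texp (a, A)) = texp (lsubmx a, ulsubmx A).
Proof.
rewrite /projl /texp /= -otimes_ul; congr (_, _, _).
by apply/matrixP => i j; rewrite !mxE.
Qed.

Lemma projr_exp k l (a : 'rV[R]_(k + l)) (A : 'M[R]_(k + l)) :
  projr (texp (a, A)) = texp (rsubmx a, drsubmx A).
Proof.
rewrite /projr /texp /= -otimes_dr; congr (_, _, _).
by apply/matrixP => i j; rewrite !mxE.
Qed.

Lemma G2_projl k l (g : tens2 R (k + l)) : G2 g -> G2 (projl g).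
Proof.
move=> [a [_ [[n [c [u [v ->]]]] ->]]]; rewrite projl_exp.
exists (lsubmx a); eexists; split; last reflexivity.
exists n, c, (fun i => lsubmx (u i)), (fun i => lsubmx (v i)).
apply/matrixP => i j; rewrite !mxE !summxE; apply: eq_bigr => q _.
by rewrite /lie_bracket -!otimes_ul !mxE.
Qed.

Lemma G2_projr k l (g : tens2 R (k + l)) : G2 g -> G2 (projr g).
Proof.
move=> [a [_ [[n [c [u [v ->]]]] ->]]]; rewrite projr_exp.
exists (rsubmx a); eexists; split; last reflexivity.
exists n, c, (fun i => rsubmx (u i)), (fun i => rsubmx (v i)).
apply/matrixP => i j; rewrite !mxE !summxE; apply: eq_bigr => q _.
by rewrite /lie_bracket -!otimes_dr !mxE.
Qed.

Lemma G2_tmulV d (g : tens2 R d) : G2 g ->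
  tmul g (tinv g) = tone d /\ tmul (tinv g) g = tone d.
Proof.
move=> [a [A [_ ->]]]; split; rewrite /tmul /tinv /tone /=;
  congr (_, _, _); rewrite ?mulr1 //;
  try (by apply/rowP => i; rewrite !mxE; ring);
  by apply/matrixP => i j; rewrite !mxE !big_ord1 !mxE; ring.
Qed.

Definition enorm d (v : 'rV[R]_d) : R := Num.sqrt (\sum_i v 0 i ^+ 2).

Definition subdiv (a b : R) (s : seq R) (n : nat) : R := nth b (a :: s) n.

(* Vector-valued counterpart of total_variation, for the Euclidean norm. *)
Definition path_length d (a b : R) (x : R -> 'rV[R]_d) : \bar R :=
  ereal_sup [set (\sum_(0 <= n < size s)
      enorm (x (subdiv a b s n.+1) - x (subdiv a b s n)))%:E
    | s in itv_partition a b].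

(* I is the Riemann-Stieltjes integral of f against g over [a, b], as the limit
   of tagged sums when the mesh tends to 0. *)
Definition is_RSint (f g : R -> R) (a b I : R) : Prop :=
  forall e : R, 0 < e -> exists2 delta : R, 0 < delta &
    forall (s : seq R) (xi : nat -> R), itv_partition a b s ->
      (forall n, (n < size s)%N ->
         subdiv a b s n <= xi n <= subdiv a b s n.+1 /\
         subdiv a b s n.+1 - subdiv a b s n < delta) ->
      `| \sum_(0 <= n < size s)
           f (xi n) * (g (subdiv a b s n.+1) - g (subdiv a b s n)) - I | < e.

(* g = 1 + int_0^1 dx + int int_{0 < r < t < 1} dx_r (x) dx_t; the inner
   integral over r is x t - x 0. *)
Definition is_signature2 d (x : R -> 'rV[R]_d) (g : tens2 R d) : Prop :=
  [/\ g.1.1 = 1, g.1.2 = x 1 - x 0 &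
      forall i j, is_RSint (fun t => x t 0 i - x 0 0 i) (fun t => x t 0 j)
                           0 1 (g.2 i j)].

Definition bv_path d (x : R -> 'rV[R]_d) : Prop :=
  {within `[0, 1], continuous x} /\ (path_length 0 1 x < +oo)%E.

(* Extended-real valued, so that an empty infimum would be +oo and not a
   spurious real number. *)
Definition ccnorm d (g : tens2 R d) : \bar R :=
  ereal_inf [set path_length 0 1 x
            | x in [set x : R -> 'rV[R]_d | bv_path x /\ is_signature2 x g]].

Definition dcc d (g h : tens2 R d) : \bar R := ccnorm (tmul (tinv g) h).

(* Paths on [0, T] are functions on R of which only the restriction to [0, T]
   matters; equality of paths is equality on [0, T]. *)

Local Notation leb := (@lebesgue_measure R).

Definition sob_weight (alpha p : R) (u : R * R) : R :=
  (`|u.2 - u.1| `^ (alpha * p + 1))^-1.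

Definition WG2 (T alpha p : R) d : set (R -> tens2 R d) :=
  [set X : R -> tens2 R d |
    [/\ forall t, t \in `[0, T] -> G2 (X t),
        forall s, s \in `[0, T] ->
          (fun t => dcc (X s) (X t)) @ within `[0, T] (nbhs s) --> 0%E &
        (\int[leb \x leb]_(u in `[0%R, T] `*` `[0%R, T])
           (dcc (X u.1) (X u.2) `^ p * (sob_weight alpha p u)%:E) < +oo)%E]].

Definition enorm2 d (v : tens2plus R d) : R :=
  Num.sqrt (\sum_i v.1 0 i ^+ 2 + \sum_i \sum_j v.2 i j ^+ 2).

Definition sob_norm (T alpha p : R) d (f : R -> tens2plus R d) : \bar R :=
  ((\int[leb]_(t in `[0%R, T]) (enorm2 (f t) `^ p)%:E) `^ p^-1 +
   (\int[leb \x leb]_(u in `[0%R, T] `*` `[0%R, T])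
      (enorm2 (f u.2 - f u.1) `^ p * sob_weight alpha p u)%:E) `^ p^-1)%E.

(* W^alpha_p([0, T]; R^d (+) (R^d)^{(x)2}), through representatives: the
   elements of the Banach space are the classes for a.e. equality on [0, T]. *)
Definition Wtens2 (T alpha p : R) d : set (R -> tens2plus R d) :=
  [set f : R -> tens2plus R d |
    [/\ forall i, measurable_fun `[0, T] (fun t => (f t).1 0 i),
        forall i j, measurable_fun `[0, T] (fun t => (f t).2 i j) &
        (sob_norm T alpha p f < +oo)%E]].

Definition aeeq (T : R) d (f g : R -> tens2plus R d) : Prop :=
  {ae leb, forall t, t \in `[0, T] -> f t = g t}.

Definition drop_scalar d (Z : R -> tens2 R d) : R -> tens2plus R d :=
  fun t => ((Z t).1.2, (Z t).2).

Definition admissible (T alpha p : R) k l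
    (X : R -> tens2 R k) (Y : R -> tens2 R l) : set (R -> tens2 R (k + l)) :=
  [set Z : R -> tens2 R (k + l) | [/\ WG2 T alpha p Z,
               {in `[0, T], forall t, projl (Z t) = X t} &
               {in `[0, T], forall t, projr (Z t) = Y t}]].

Definition proper_on (V : Type) (A : set V) (F : V -> \bar R) : Prop :=
  (forall Z, A Z -> F Z != -oo%E) /\ exists2 Z, A Z & F Z \is a fin_num.

Definition minimizer_on (V : Type) (A : set V) (F : V -> \bar R) (Z : V) : Prop :=
  A Z /\ forall Z', A Z' -> (F Z <= F Z')%E.

Section SobolevFunctionals.
Variables (T alpha p : R) (d : nat).
Local Notation W := (@Wtens2 T alpha p d).
Local Notation normW := (@sob_norm T alpha p d).
Implicit Type Phi : (R -> tens2plus R d) -> \bar R.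

(* A function from the Banach space of classes to R u {+oo}. *)
Definition functional_on_W Phi : Prop :=
  (forall f, W f -> Phi f != -oo%E) /\
  (forall f g, W f -> W g -> aeeq T f g -> Phi f = Phi g).

Definition combination (c : R) (f g : R -> tens2plus R d) :
  R -> tens2plus R d := fun t => c *: f t + (1 - c) *: g t.

Definition W_coercive Phi : Prop :=
  forall c : R, exists M : R,
    forall f, W f -> (Phi f <= c%:E)%E -> (normW f <= M%:E)%E.

Definition W_convex Phi : Prop :=
  forall f g (c : R), W f -> W g -> 0 < c < 1 ->
    (Phi (combination c f g) <= c%:E * Phi f + (1 - c)%:E * Phi g)%E.

Definition W_strictly_convex Phi : Prop :=
  forall f g (c : R), W f -> W g -> ~ aeeq T f g -> 0 < c < 1 ->
    Phi f \is a fin_num -> Phi g \is a fin_num ->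
    (Phi (combination c f g) < c%:E * Phi f + (1 - c)%:E * Phi g)%E.

Definition W_lower_semicontinuous Phi : Prop :=
  forall f (a : R), W f -> (a%:E < Phi f)%E ->
    exists2 delta : R, 0 < delta &
      forall g, W g -> (normW (fun t => (g t - f t)%R) < delta%:E)%E ->
        (a%:E < Phi g)%E.

Definition extends_by_infty (A : set (R -> tens2 R d))
    (F : (R -> tens2 R d) -> \bar R) Phi : Prop :=
  (forall Z, A Z -> Phi (drop_scalar Z) = F Z) /\
  (forall f, W f -> (forall Z, A Z -> ~ aeeq T f (drop_scalar Z)) ->
     Phi f = +oo%E).

End SobolevFunctionals.
End Group.

(* Main.v *)
Require Import Defs.
From HB Require Import structures.
From mathcomp Require Import all_boot all_order all_algebra.
From mathcomp Require Import all_classical all_reals all_analysis.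
From mathcomp Require Import measurable_realfun.
From mathcomp Require Import ring lra zify.

(** The Carnot-Caratheodory norm of an element of the group is comparable to the
    sum of the coordinates of its first level and of the square roots of those of
    its second level (ccnorm_ge_level1, ccnorm_ge_level2, ccnorm_le_boxnorm). A
    path is therefore Sobolev of order alpha and exponent p when the coordinates
    of its first level are so and, with exponent p / 2, the areas
    B t - B s - x s * (y t - y s) are, where x and y are two coordinates of the
    first level and B is the corresponding coordinate of the second
    (WG2_coord_sobolev, coord_sobolev_WG2).

    To extend X and Y jointly only the mixed coordinates of the second level have
    to be found, that is, a function B with such areas for each pair of scalar
    functions x and y (area_exists). The integral of x against y need not exist
    when alpha < 1 / 2, but the paraproduct does as well: it sums the terms
    P_m x * (P_(m+1) y - P_m y) over m, where P_m is the local mean at scale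
    T / 2 ^ m. For s and t at a distance of about T / 2 ^ j its area is at most
    the square of x t - x s plus a sum over m of the squared local oscillations of
    x and y at scale m, with coefficients that decay like 2 ^ (m - j) for m < j
    (area_defect_le). Jensen's inequality and a Schur test in j and m, which use
    0 < alpha < 1 / 2, bound the energies of these areas uniformly in the number of
    terms (dyadic_energy_le). Since alpha > 1 / p the terms decay geometrically in
    the uniform norm, so the sums converge, and Fatou's lemma carries the bound to
    the limit (area_incr_energy).

    Minimization is the direct method, carried out in the strong topology. As
    p > 2, the energy Wenergy, a power of an equivalent norm, satisfies Clarkson's
    inequality. Hence in a decreasing sequence of bounded sets closed under
    midpoints the elements of nearly minimal energy converge strongly
    (nested_convex_sets). Continuous representatives are used throughout, and
    completeness comes from the Sobolev embedding and Fatou's lemma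
    (Wenergy_complete). The sublevel sets of the functional along a minimizing
    sequence are such sets, by convexity and coercivity, and lower semicontinuity
    bounds the functional at the limit by the infimum. The functional is infinite
    outside of the admissible set, so the limit is admissible (minimizer_exists).
    Two distinct minimizers would have a midpoint of smaller value under strict
    convexity (minimizer_unique). *)

Set Implicit Arguments.
Unset Strict Implicit.
Unset Printing Implicit Defensive.

Import Order.TTheory GRing.Theory Num.Theory.
Import numFieldNormedType.Exports.

Local Open Scope classical_set_scope.
Local Open Scope ring_scope.

(** * The Carnot-Caratheodory norm is equivalent to a homogeneous norm *)

Section CCLower.
Context {R : realType}.
Implicit Types (d : nat).

Definition l1norm d (v : 'rV[R]_d) : R := \sum_i `|v 0 i|.

Lemma l1norm_ge0 d (v : 'rV[R]_d) : 0 <= l1norm v.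
Proof. exact: sumr_ge0. Qed.

Lemma ler_coord_l1norm d (v : 'rV[R]_d) i : `|v 0 i| <= l1norm v.
Proof. by rewrite /l1norm (bigD1 i)//= lerDl sumr_ge0. Qed.

Lemma l1normD d (u v : 'rV[R]_d) : l1norm (u + v) <= l1norm u + l1norm v.
Proof. by rewrite /l1norm -big_split ler_sum// => i _; rewrite mxE ler_normD. Qed.

Lemma sum_sqr_le (I : Type) (s : seq I) (F : I -> R) :
  \sum_(i <- s) F i ^+ 2 <= (\sum_(i <- s) `|F i|) ^+ 2.
Proof.
elim: s => [|i s IH]; first by rewrite !big_nil expr0n.
rewrite !big_cons sqrrD -normrX (ger0_norm (sqr_ge0 _)) -addrA lerD2l.
apply: (le_trans IH); rewrite lerDr mulrn_wge0// mulr_ge0//.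
exact: sumr_ge0.
Qed.

Lemma enorm_le_l1norm d (v : 'rV[R]_d) : enorm v <= l1norm v.
Proof.
rewrite /enorm -[leRHS](ger0_norm (l1norm_ge0 v)) -sqrtr_sqr ler_wsqrtr//.
exact: sum_sqr_le.
Qed.

Lemma ler_coord_enorm d (v : 'rV[R]_d) i : `|v 0 i| <= enorm v.
Proof.
rewrite /enorm -sqrtr_sqr ler_wsqrtr//.
by rewrite (bigD1 i)//= lerDl sumr_ge0// => j _; exact: sqr_ge0.
Qed.

Lemma enorm0 d : enorm (0 : 'rV[R]_d) = 0.
Proof. by rewrite /enorm big1 ?sqrtr0// => i _; rewrite mxE expr0n. Qed.

Lemma enorm_ge0 d (v : 'rV[R]_d) : 0 <= enorm v.
Proof. exact: sqrtr_ge0. Qed.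

Lemma path_length_partition d (x : R -> 'rV[R]_d) s :
  itv_partition 0 1 s ->
  ((\sum_(0 <= n < size s)
      enorm (x (subdiv 0 1 s n.+1) - x (subdiv 0 1 s n)))%:E
   <= path_length 0 1 x)%E.
Proof. by move=> ps; apply: ereal_sup_ubound; exists s. Qed.

Lemma path_length_increment d (x : R -> 'rV[R]_d) t : 0 <= t <= 1 ->
  ((enorm (x t - x 0))%:E <= path_length 0 1 x)%E.
Proof.
have p1 : itv_partition (0:R) 1 [:: 1] by apply: itv_partition1.
move=> /andP[]; rewrite le_eqVlt => /orP[/eqP<- _|t0].
  rewrite subrr enorm0; apply: le_trans (path_length_partition x p1).
  by rewrite lee_fin sumr_ge0// => *; exact: enorm_ge0.
rewrite le_eqVlt => /orP[/eqP->|t1].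
  apply: le_trans (path_length_partition x p1).
  by rewrite big_nat1.
have p2 : itv_partition (0:R) 1 [:: t; 1] by split => //=; rewrite t0 t1.
apply: le_trans (path_length_partition x p2).
by rewrite lee_fin big_nat_recl//= lerDl big_nat1 enorm_ge0.
Qed.

Definition uniform_subdivision (N : nat) : seq R :=
  mkseq (fun i => i.+1%:R / N%:R) N.

Lemma subdiv_uniform N n : (n <= N)%N -> (0 < N)%N ->
  subdiv 0 1 (uniform_subdivision N) n = n%:R / N%:R.
Proof.
rewrite /subdiv; case: n => [|n] nN N0 /=; first by rewrite mul0r.
by rewrite nth_mkseq.
Qed.

Lemma uniform_subdivisionP N : (0 < N)%N ->
  itv_partition 0 1 (uniform_subdivision N).
Proof.
move=> N0; split.
  apply/(pathP 1) => i; rewrite size_mkseq => iN.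
  rewrite -/(subdiv 0 1 (uniform_subdivision N) i) subdiv_uniform ?(ltnW iN)//.
  by rewrite nth_mkseq// ltr_pM2r ?ltr_nat// invr_gt0 ltr0n.
rewrite (last_nth 1) size_mkseq -/(subdiv 0 1 (uniform_subdivision N) N).
by rewrite subdiv_uniform// divff// pnatr_eq0 -lt0n.
Qed.

Lemma signature_level1_le d (x : R -> 'rV[R]_d) g (i : 'I_d) :
  is_signature2 x g -> (`|g.1.2 0 i|%:E <= path_length 0 1 x)%E.
Proof.
move=> [_ -> _]; apply: le_trans (path_length_increment x (t := 1) _); last first.
  by rewrite ler01 lexx.
by rewrite lee_fin ler_coord_enorm.
Qed.

(** Every Riemann-Stieltjes sum of the iterated integral is at most the square
    of the length, since the integrand is itself an increment of the path. *)
Lemma signature_level2_le d (x : R -> 'rV[R]_d) g (i j : 'I_d) (L : R) :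
  path_length 0 1 x = L%:E -> is_signature2 x g -> `|g.2 i j| <= L ^+ 2.
Proof.
move=> xL [_ _ /(_ i j) RS]; apply/ler_addgt0Pr => e e0.
have [delta delta0 {}RS] := RS _ e0.
pose N := (Num.truncn delta^-1).+1.
have N0 : (0 < N)%N by [].
have Nd : (N%:R)^-1 < delta.
  by rewrite -[ltRHS]invrK ltf_pV2 ?posrE ?invr_gt0 ?ltr0n// truncnS_gt.
have ps := uniform_subdivisionP N0.
set s := uniform_subdivision N in ps.
have ss : size s = N by rewrite size_mkseq.
have {}RS := RS s (subdiv 0 1 s) ps.
have L0 : 0 <= L.
  rewrite -lee_fin -xL; apply: le_trans (path_length_increment x (t := 0) _).
    by rewrite lee_fin enorm_ge0.
  by rewrite lexx ler01.
have sE n : (n <= N)%N -> subdiv 0 1 s n = n%:R / N%:R.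
  by move=> nN; rewrite subdiv_uniform.
have {}RS := RS _.
set A := \sum_(0 <= n < size s) _ in RS.
have AL : `|A| <= L ^+ 2.
  rewrite expr2 /A (le_trans (ler_norm_sum _ _ _))//.
  apply: (@le_trans _ _ (\sum_(0 <= n < size s)
      L * enorm (x (subdiv 0 1 s n.+1) - x (subdiv 0 1 s n)))).
    rewrite big_seq [leRHS]big_seq; apply: ler_sum => n.
    rewrite mem_index_iota ss => /andP[_ nN].
    rewrite normrM ler_pM//; last first.
      by apply: le_trans (ler_coord_enorm _ j); rewrite !mxE.
    rewrite -lee_fin -xL; apply: le_trans (path_length_increment x _).
      by rewrite lee_fin; apply: le_trans (ler_coord_enorm _ i); rewrite !mxE.
    rewrite sE ?(ltnW nN)// divr_ge0//= ler_pdivrMr ?ltr0n// mul1r ler_nat.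
    exact: ltnW.
  rewrite -mulr_sumr ler_wpM2l// -lee_fin -xL; exact: path_length_partition.
have {}RS : `|A - g.2 i j| < e.
  apply: RS => n; rewrite ss => nN; rewrite lexx/= !sE ?(ltnW nN)//.
  rewrite -mulrBl -natrB// subSnn mul1r; split=> //.
  by rewrite ler_pM2r ?invr_gt0 ?ltr0n// ler_nat.
rewrite -[g.2 i j](subrK A) (le_trans (ler_normD _ _))// addrC lerD//.
by rewrite distrC ltW.
Qed.

Lemma ccnorm_ge_level1 d (g : tens2 R d) i : (`|g.1.2 0 i|%:E <= ccnorm g)%E.
Proof.
by apply: le_ereal_inf_tmp => _ [x [_ sx] <-]; exact: signature_level1_le.
Qed.

Lemma ccnorm_ge_level2 d (g : tens2 R d) i j :
  ((Num.sqrt `|g.2 i j|)%:E <= ccnorm g)%E.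
Proof.
apply: le_ereal_inf_tmp => _ [x [[_ xL] sx] <-].
have x0 : (0 <= path_length 0 1 x)%E.
  apply: le_trans (path_length_increment x (t := 0) _).
    by rewrite lee_fin enorm_ge0.
  by rewrite lexx ler01.
have xE : path_length 0 1 x = (fine (path_length 0 1 x))%:E.
  by rewrite fineK// ge0_fin_numE.
rewrite xE lee_fin -[leRHS](@ger0_norm _ _ (fine_ge0 x0)) -[leRHS]sqrtr_sqr ler_wsqrtr//.
exact: signature_level2_le sx.
Qed.

Lemma ccnorm_ge0 d (g : tens2 R d) : (0 <= ccnorm g)%E.
Proof.
apply: le_ereal_inf_tmp => _ [x _ <-].
apply: le_trans (path_length_increment x (t := 0) _).
  by rewrite lee_fin enorm_ge0.
by rewrite lexx ler01.
Qed.

End CCLower.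

Section CCUpper.
Context {R : realType}.
Implicit Types (d : nat).

(** A path of speed at most one, with a lift S which agrees with its iterated
    integral up to an error quadratic in time. Unlike the signature itself, this
    notion is stable under concatenation by elementary estimates. *)
Definition reach d (tau : R) (g : tens2 R d) : Prop :=
  [/\ 0 <= tau, g.1.1 = 1 &
  exists (x : R -> 'rV[R]_d) (S : R -> 'M[R]_d) (C : R),
  [/\ x 0 = 0 /\ S 0 = 0, x tau = g.1.2 /\ S tau = g.2, 0 <= C,
      forall a b, 0 <= a -> a <= b -> b <= tau -> l1norm (x b - x a) <= b - a &
      forall i j a b, 0 <= a -> a <= b -> b <= tau ->
        `|S b i j - S a i j - x a 0 i * (x b 0 j - x a 0 j)| <= C * (b - a) ^+ 2]].

(** The concatenated lift is prescribed by the law of the group. *)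
Lemma reach_tmul d s t (g h : tens2 R d) :
  reach s g -> reach t h -> reach (s + t) (tmul g h).
Proof.
move=> [s0 g1 [x [S [C [[x0 S0] [xs Ss] C0 xL SC]]]]].
move=> [t0 h1 [y [U [D [[y0 U0] [yt Ut] D0 yL UD]]]]].
split; [exact: addr_ge0 | by rewrite /= g1 h1 mulr1 |].
pose z r := if r <= s then x r else x s + y (r - s).
pose V r := if r <= s then S r else S s + otimes (x s) (y (r - s)) + U (r - s).
have zr r : s <= r -> z r = x s + y (r - s).
  rewrite /z; case: (leP r s) => // rs sr; have /eqP<- : r == s by rewrite eq_le rs sr.
  by rewrite subrr y0 addr0.
have Vr r : s <= r -> V r = S s + otimes (x s) (y (r - s)) + U (r - s).
  rewrite /V; case: (leP r s) => // rs sr; have /eqP<- : r == s by rewrite eq_le rs sr.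
  by rewrite subrr y0 U0 /otimes mulmx0 !addr0.
have zl r : r <= s -> z r = x r by rewrite /z => ->.
have Vl r : r <= s -> V r = S r by rewrite /V => ->.
have zL1 a b : s <= a -> a <= b -> b <= s + t -> l1norm (z b - z a) <= b - a.
  move=> sa ab bt; rewrite !zr// ?(le_trans sa)//.
  have -> : x s + y (b - s) - (x s + y (a - s)) = y (b - s) - y (a - s).
    by apply/rowP => i; rewrite !mxE; ring.
  have -> : b - a = (b - s) - (a - s) by ring.
  by apply: yL; lra.
have VC1 i j a b : s <= a -> a <= b -> b <= s + t ->
    `|V b i j - V a i j - z a 0 i * (z b 0 j - z a 0 j)| <= D * (b - a) ^+ 2.
  move=> sa ab bt; rewrite !zr ?Vr// ?(le_trans sa)//.
  have := UD i j (a - s) (b - s).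
  have -> : b - s - (a - s) = b - a by ring.
  move=> /(_ ltac:(lra) ltac:(lra) ltac:(lra)); congr (_ <= _); congr (`| _ |).
  by rewrite !mxE !big_ord1 !mxE; ring.
exists z, V, (C + D + 1); split.
- by rewrite zl// Vl.
- rewrite zr ?Vr ?lerDl//= addrAC subrr add0r g1 h1 !scale1r yt Ut xs Ss.
  by split; apply/matrixP => i j; rewrite !mxE ?big_ord1 ?mxE; ring.
- lra.
- move=> a b a0 ab bt; have [bs|sb] := leP b s.
    by rewrite !zl// ?(le_trans ab)//; exact: xL.
  have [sa|/ltW as_] := leP s a; first exact: zL1.
  have -> : z b - z a = (z b - z s) + (z s - z a) by rewrite addrA subrK.
  have -> : b - a = (b - s) + (s - a) by ring.
  apply: (le_trans (l1normD _ _)); apply: lerD; first by apply: zL1 => //; exact: ltW.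
  by rewrite !zl//; exact: xL.
- move=> i j a b a0 ab bt.
  have sq : 0 <= (b - a) ^+ 2 by exact: sqr_ge0.
  have [bs|sb] := leP b s.
    rewrite !zl ?Vl// ?(le_trans ab)//; apply: le_trans (SC _ _ _ _ _ _ _) _ => //.
    by rewrite ler_wpM2r//; lra.
  have [sa|/ltW as_] := leP s a.
    by apply: le_trans (VC1 _ _ _ _ _ _ _) _ => //; rewrite ler_wpM2r//; lra.
  have E1 := VC1 i j s b (lexx _) (ltW sb) bt.
  have E2 := SC i j a s a0 as_ (lexx _).
  have E3 : `|(z s 0 i - z a 0 i) * (z b 0 j - z s 0 j)| <= (s - a) * (b - s).
    rewrite normrM; apply: ler_pM => //.
      have := xL _ _ a0 as_ (lexx _); rewrite !zl//; apply: le_trans.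
      by have := ler_coord_l1norm (x s - x a) i; rewrite !mxE.
    have := zL1 _ _ (lexx _) (ltW sb) bt; apply: le_trans.
    by have := ler_coord_l1norm (z b - z s) j; rewrite !mxE.
  move: E2; rewrite -!zl// -!Vl// => E2.
  have -> : V b i j - V a i j - z a 0 i * (z b 0 j - z a 0 j) =
    (V b i j - V s i j - z s 0 i * (z b 0 j - z s 0 j)) +
    (V s i j - V a i j - z a 0 i * (z s 0 j - z a 0 j)) +
    (z s 0 i - z a 0 i) * (z b 0 j - z s 0 j) by ring.
  apply: (le_trans (ler_normD _ _)); apply: (le_trans (lerD (ler_normD _ _) E3)).
  apply: (le_trans (lerD (lerD E1 E2) (lexx _))).
  have -> : b - a = (b - s) + (s - a) by ring.
  have : 0 <= s - a by lra.
  have : 0 <= b - s by lra.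
  move: (s - a) (b - s) => q p p0 q0.
  have pq := mulr_ge0 p0 q0.
  have -> : (C + D + 1) * (p + q) ^+ 2 = D * p ^+ 2 + C * q ^+ 2 + q * p +
      (D * (2 * (p * q) + q ^+ 2) + C * (2 * (p * q) + p ^+ 2) +
       (p ^+ 2 + q ^+ 2 + p * q)) by ring.
  rewrite lerDl; have p2 := sqr_ge0 p; have q2 := sqr_ge0 q.
  by rewrite !addr_ge0// mulr_ge0// addr_ge0// mulr_ge0.
Qed.

Lemma reach_tone d (tau : R) : 0 <= tau -> reach tau (tone d : tens2 R d).
Proof.
move=> tau0; split => //; exists (fun=> 0), (fun=> 0), 0; split => //.
  move=> a b a0 ab b0; rewrite subrr /l1norm big1 ?subr_ge0// => i _.
  by rewrite mxE normr0.
by move=> i j a b _ _ _; rewrite !mxE subrr mulr0 subr0 normr0 mul0r.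
Qed.

Lemma reach_le d (s t : R) (g : tens2 R d) : reach s g -> s <= t -> reach t g.
Proof.
move=> rg st; have g1 : g.1.1 = 1 by case: rg.
have := reach_tmul rg (@reach_tone d (t - s) _); rewrite subr_ge0 => /(_ st).
rewrite addrC subrK; congr (reach _ _); case: g g1 {rg} => -[g0 a] A /= ->.
by rewrite /tmul /= mulr1 !scale1r /otimes mulmx0 !add0r.
Qed.

Lemma reach_texp d (v : 'rV[R]_d) : reach (l1norm v) (texp (v, 0)).
Proof.
have v0 := l1norm_ge0 v.
pose u := (l1norm v)^-1 *: v.
have lu : l1norm v *: u = v.
  rewrite /u; have [vE|vn0] := eqVneq (l1norm v) 0; last first.
    by rewrite scalerA divff// scale1r.
  rewrite vE scale0r; apply/rowP => i; rewrite mxE; apply/esym/eqP.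
  by rewrite -normr_le0 -vE ler_coord_l1norm.
split => //; exists (fun t => t *: u), (fun t => (t ^+ 2 / 2) *: otimes u u), 1.
have u1 : l1norm u <= 1.
  rewrite /u {1}/l1norm; under eq_bigr do rewrite mxE normrM.
  rewrite -mulr_sumr ger0_norm ?invr_ge0// -/(l1norm v).
  by have [->|vn0] := eqVneq (l1norm v) 0; rewrite ?mulr0// mulVf.
clearbody u; have uc i : `|u 0 i| <= 1 by apply: le_trans u1; exact: ler_coord_l1norm.
split => //.
- by rewrite expr0n mul0r !scale0r.
- split => //=; rewrite add0r -{2 3}lu.
  by apply/matrixP => i j; rewrite !mxE !big_ord1 !mxE; ring.
- move=> a b a0 ab bv; rewrite -scalerBl /l1norm.
  under eq_bigr do rewrite mxE normrM.
  by rewrite -mulr_sumr ger0_norm ?subr_ge0// ler_piMr// subr_ge0.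
- move=> i j a b a0 ab bv; rewrite !mxE big_ord1 !mxE.
  have -> : b ^+ 2 / 2 * (u 0 i * u 0 j) - a ^+ 2 / 2 * (u 0 i * u 0 j) -
      a * u 0 i * (b * u 0 j - a * u 0 j) = (b - a) ^+ 2 * (u 0 i * u 0 j / 2).
    by field.
  rewrite normrM (ger0_norm (sqr_ge0 _)) mulrC ler_wpM2r ?sqr_ge0//.
  rewrite normrM normfV (ger0_norm (ler0n _ 2)) ler_pdivrMr// mul1r normrM.
  have := ler_pM (normr_ge0 _) (normr_ge0 _) (uc i) (uc j); lra.
Qed.

Lemma mx_norm_le_l1norm d (v : 'rV[R]_d) : `|v| <= l1norm v.
Proof.
have [v0|v0] := eqVneq (mx_norm v) 0.
  by rewrite [leLHS]v0 l1norm_ge0.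
have [[i j] /= vE] := mx_norm_neq0 v0.
by rewrite [leLHS]vE (ord1 i) ler_coord_l1norm.
Qed.

Lemma l1normN d (v : 'rV[R]_d) : l1norm (- v) = l1norm v.
Proof. by apply: eq_bigr => i _; rewrite mxE normrN. Qed.

(** Reparametrising over [0, 1] turns the speed-one path into one of length at
    most tau; its lift is the iterated integral because the error in each
    Riemann-Stieltjes term is quadratic in the mesh. *)
Lemma ccnorm_reach d tau (g : tens2 R d) : reach tau g -> (ccnorm g <= tau%:E)%E.
Proof.
move=> [tau0 g1 [x [S [C [[x0 S0] [xt St] C0 xL SC]]]]].
pose y t := x (tau * t).
have tin t : 0 <= t -> t <= 1 -> 0 <= tau * t /\ tau * t <= tau.
  by move=> t0 t1; split; [exact: mulr_ge0|exact: ler_piMr].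
have yL a b : 0 <= a -> a <= b -> b <= 1 -> l1norm (y b - y a) <= tau * (b - a).
  move=> a0 ab b1; rewrite mulrBr; apply: xL.
  - by have [] := tin a a0 (le_trans ab b1).
  - by rewrite ler_wpM2l.
  - by have [] := tin b (le_trans a0 ab) b1.
have part (s : seq R) n : itv_partition 0 1 s -> (n < size s)%N ->
    [/\ 0 <= subdiv 0 1 s n, subdiv 0 1 s n <= subdiv 0 1 s n.+1 &
        subdiv 0 1 s n.+1 <= 1].
  move=> ps ns; split.
  - by apply: (itv_partition_nth_ge _ ps); rewrite ltnS ltnW.
  - by case: ps => /(pathP 1) /(_ n ns) /ltW.
  - by apply: (itv_partition_nth_le _ ps); rewrite ltnS.
have tel (s : seq R) : itv_partition 0 1 s ->
    \sum_(0 <= n < size s) (subdiv 0 1 s n.+1 - subdiv 0 1 s n) = 1.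
  move=> ps; rewrite telescope_sumr// /subdiv (itv_partition_nth_size _ ps)/=.
  by rewrite subr0.
have len : (path_length 0 1 y <= tau%:E)%E.
  apply: ge_ereal_sup => _ [s ps <-]; rewrite lee_fin.
  have -> : tau = \sum_(0 <= n < size s)
      tau * (subdiv 0 1 s n.+1 - subdiv 0 1 s n) by rewrite -mulr_sumr tel// mulr1.
  rewrite big_seq [leRHS]big_seq.
  apply: ler_sum => n; rewrite mem_index_iota => /andP[_ ns].
  have [a0 ab b1] := part _ _ ps ns.
  by apply: le_trans (enorm_le_l1norm _) _; exact: yL.
apply: ge_ereal_inf; exists (path_length 0 1 y) => //; exists y => //; split.
  split; last exact: le_lt_trans len (ltry _).
  apply/subspace_continuousP => a aI; apply/cvgrPdist_le => e e0.
  have t1 : 0 < tau + 1 by rewrite ltr_wpDl.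
  near=> b.
  have bI : b \in `[0, 1] by near: b; exact: withinT.
  have ab : `|a - b| < e / (tau + 1).
    near: b; apply: cvg_within; apply/nbhs_ballP; exists (e / (tau + 1)) => //=.
    exact: divr_gt0.
  apply: (le_trans (mx_norm_le_l1norm _)).
  move: aI bI; rewrite /= !in_itv/= => /andP[a0 a1] /andP[b0 b1].
  have L : l1norm (y a - y b) <= tau * `|a - b|.
    have [ba|/ltW ab'] := leP b a.
      by apply: (le_trans (yL _ _ b0 ba a1)); rewrite ger0_norm ?subr_ge0.
    by rewrite -opprB l1normN distrC ger0_norm ?subr_ge0// yL.
  apply: (le_trans L); apply: (@le_trans _ _ ((tau + 1) * `|a - b|)).
    by rewrite ler_wpM2r// lerDl.
  by rewrite mulrC -ler_pdivlMr// ltW.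
split => //.
  by rewrite /y mulr1 mulr0 x0 subr0.
move=> i j e e0.
have K0 : 0 < (C + 1) * tau ^+ 2 + 1.
  by rewrite ltr_wpDl// mulr_ge0 ?sqr_ge0// addr_ge0.
exists (e / ((C + 1) * tau ^+ 2 + 1)); first exact: divr_gt0.
move=> s xi ps xis; rewrite -St.
have -> : S tau i j = \sum_(0 <= n < size s)
    (S (tau * subdiv 0 1 s n.+1) i j - S (tau * subdiv 0 1 s n) i j).
  rewrite (@telescope_sumr _ 0 (size s)
    (fun n => S (tau * subdiv 0 1 s n) i j))// {1}/subdiv.
  by rewrite (itv_partition_nth_size _ ps) mulr1 mulr0 S0 [X in _ - X]mxE subr0.
rewrite -sumrB; apply: (le_lt_trans (ler_norm_sum _ _ _)).
set d' := e / _ in xis.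
have d0 : 0 < d' by exact: divr_gt0.
apply: (@le_lt_trans _ _ (\sum_(0 <= n < size s)
  (((C + 1) * tau ^+ 2 * d') * (subdiv 0 1 s n.+1 - subdiv 0 1 s n)))); last first.
  rewrite -mulr_sumr tel// mulr1 /d' mulrA ltr_pdivrMr// mulrC ltr_pM2l//.
  by rewrite ltrDl.
rewrite big_seq [leRHS]big_seq; apply: ler_sum => n.
rewrite mem_index_iota => /andP[_ ns].
have [a0 ab b1] := part _ _ ps ns; have [/andP[ax xb] bad] := xis _ ns.
move: (subdiv 0 1 s n) (subdiv 0 1 s n.+1) (xi n) a0 ab b1 ax xb bad.
move=> a b c a0 ab b1 ac cb bad.
have ch : 0 <= b - a by rewrite subr_ge0.
have E1 : `|(y c 0 i - y a 0 i) * (y b 0 j - y a 0 j)| <= (tau * (b - a)) ^+ 2.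
  rewrite normrM expr2; apply: ler_pM => //.
    have := ler_coord_l1norm (y c - y a) i; rewrite !mxE => /le_trans; apply.
    apply: le_trans (yL _ _ a0 ac (le_trans cb b1)) _.
    by rewrite ler_wpM2l// lerD2r.
  have := ler_coord_l1norm (y b - y a) j; rewrite !mxE => /le_trans; apply.
  exact: yL.
have E2 : `|S (tau * b) i j - S (tau * a) i j - y a 0 i * (y b 0 j - y a 0 j)| <=
    C * (tau * (b - a)) ^+ 2.
  rewrite (mulrBr tau); apply: SC.
  - by have [] := tin a a0 (le_trans ab b1).
  - by rewrite ler_wpM2l.
  - by have [] := tin b (le_trans a0 ab) b1.
have -> : (y c 0 i - y 0 0 i) * (y b 0 j - y a 0 j) -
    (S (tau * b) i j - S (tau * a) i j) =
  (y c 0 i - y a 0 i) * (y b 0 j - y a 0 j) -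
  (S (tau * b) i j - S (tau * a) i j - y a 0 i * (y b 0 j - y a 0 j)).
  have -> : y 0 0 i = 0 by rewrite /y mulr0 x0 mxE.
  by ring.
apply: (le_trans (ler_normB _ _)); apply: (le_trans (lerD E1 E2)).
have -> : (tau * (b - a)) ^+ 2 + C * (tau * (b - a)) ^+ 2 =
  (C + 1) * tau ^+ 2 * (b - a) * (b - a) by ring.
rewrite ler_wpM2r// ler_wpM2l//; last exact: ltW.
by rewrite mulr_ge0 ?sqr_ge0// addr_ge0.
Unshelve. all: by end_near. Qed.

Lemma texp_commutator d (u v : 'rV[R]_d) :
  tmul (tmul (tmul (texp (u, 0)) (texp (v, 0))) (texp (- u, 0))) (texp (- v, 0)) =
  (1, 0, lie_bracket u v).
Proof.
rewrite /tmul /texp /=; congr (_, _, _); first by rewrite !mulr1.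
  by apply/rowP => i; rewrite !mxE; ring.
by apply/matrixP => i j; rewrite !mxE !big_ord1 !mxE; field.
Qed.

(** A loop along the four sides of a commutator, each of length the square root
    of the area to be produced. *)
Lemma reach_bracket d (i j : 'I_d) (c : R) :
  reach (4 * Num.sqrt `|c|)
    (1, 0, c *: lie_bracket (delta_mx 0 i : 'rV[R]_d) (delta_mx 0 j)).
Proof.
pose r := Num.sqrt `|c|; pose s := Num.sg c * r.
have -> : c *: lie_bracket (delta_mx 0 i : 'rV[R]_d) (delta_mx 0 j) =
    lie_bracket (r *: delta_mx 0 i : 'rV[R]_d) (s *: delta_mx 0 j).
  have -> : c = s * r.
    by rewrite /s -mulrA -expr2 sqr_sqrtr// -numEsg.
  by apply/matrixP => a b; rewrite !mxE !big_ord1 !mxE; ring.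
have ld (x : R) k : l1norm (x *: delta_mx 0 k : 'rV[R]_d) = `|x|.
  rewrite /l1norm (bigD1 k)//= big1 ?addr0.
    by rewrite !mxE !eqxx mulr1.
  by move=> m mk; rewrite !mxE eqxx (negbTE mk) mulr0 normr0.
have r0 : 0 <= r by exact: sqrtr_ge0.
have sr : `|s| <= r.
  rewrite normrM (ger0_norm r0) normr_sg ler_piMl//.
  by case: (c != 0).
rewrite -texp_commutator; apply: reach_le.
  by do 3?[apply: reach_tmul]; exact: reach_texp.
by rewrite /= !l1normN !ld (ger0_norm r0) -/r; clearbody s r; lra.
Qed.

Lemma tmul_central d (A B : 'M[R]_d) : tmul (1, 0, A) (1, 0, B) = (1, 0, A + B).
Proof.
rewrite /tmul /= mulr1 !scale1r /otimes mulmx0 !addr0.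
by rewrite addrC.
Qed.

Lemma reach_sum_bracket d (s : seq ('I_d * 'I_d)) (c : 'I_d -> 'I_d -> R) :
  reach (\sum_(ij <- s) 4 * Num.sqrt `|c ij.1 ij.2|)
    (1, 0, \sum_(ij <- s) c ij.1 ij.2 *:
       lie_bracket (delta_mx 0 ij.1 : 'rV[R]_d) (delta_mx 0 ij.2)).
Proof.
elim: s => [|ij s IH]; first by rewrite !big_nil; exact: reach_tone.
rewrite !big_cons -tmul_central; apply: reach_tmul => //; exact: reach_bracket.
Qed.

Lemma antisym_sum_bracket d (A : 'M[R]_d) : A^T = - A ->
  \sum_(ij : 'I_d * 'I_d) (A ij.1 ij.2 / 2) *:
       lie_bracket (delta_mx 0 ij.1 : 'rV[R]_d) (delta_mx 0 ij.2) = A.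
Proof.
move=> AT; have {}AT i j : A j i = - A i j.
  by have /matrixP /(_ i j) := AT; rewrite !mxE.
apply/matrixP => i j; rewrite summxE.
have bE (k m : 'I_d) : lie_bracket (delta_mx 0 k : 'rV[R]_d) (delta_mx 0 m) i j =
    ((i == k) && (j == m))%:R - ((i == m) && (j == k))%:R.
  by rewrite !mxE !big_ord1 !mxE /= -!natrM !mulnb.
under eq_bigr do rewrite mxE bE mulrBr.
rewrite sumrB (bigD1 (i, j))//= !eqxx mulr1 big1 ?addr0; last first.
  move=> [a b] /=; rewrite xpair_eqE eq_sym [b == _]eq_sym => /negbTE ->.
  by rewrite mulr0.
rewrite (bigD1 (j, i))//= !eqxx mulr1 big1 ?addr0; last first.
  move=> [a b] /=; rewrite xpair_eqE eq_sym [b == _]eq_sym andbC => /negbTE ->.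
  by rewrite mulr0.
by rewrite (AT i j); field.
Qed.

(** Brackets span the antisymmetric matrices, so the group is cut out of the
    truncated tensor algebra by the symmetric part of the second level. *)
Lemma G2P d (g : tens2 R d) : G2 g <->
  g.1.1 = 1 /\ forall i j, g.2 i j + g.2 j i = g.1.2 0 i * g.1.2 0 j.
Proof.
split=> [[a [_ [[n [c [u [v ->]]]] ->]]]|].
  split => //= i j; rewrite !mxE !summxE !big_ord1 !mxE.
  rewrite addrACA -big_split big1 ?add0r; first by field.
  by move=> k _; rewrite !mxE !big_ord1 !mxE /=; ring.
case: g => -[g0 a] G /= [-> H].
exists a, (G - 2^-1 *: otimes a a); split; last by rewrite /texp/= subrK.
set A := G - _; have AT : A^T = - A.
  apply/matrixP => i j; rewrite !mxE !big_ord1 !mxE.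
  by have := H i j; move: (a 0 i) (a 0 j) (G i j) (G j i) => p q r s; lra.
exists #|{: 'I_d * 'I_d}|, (fun k => A (enum_val k).1 (enum_val k).2 / 2),
  (fun k => delta_mx 0 (enum_val k).1), (fun k => delta_mx 0 (enum_val k).2).
rewrite -[LHS](antisym_sum_bracket AT) (reindex_onto enum_val enum_rank)/=.
  by apply: eq_bigl => k; rewrite enum_valK eqxx.
by move=> k _; rewrite enum_rankK.
Qed.

(** The factor 8 pays for loops of four sides, each entry of the second level
    contributing to two antisymmetrised entries. *)
Definition boxnorm d (g : tens2 R d) : R :=
  l1norm g.1.2 + 8 * \sum_i \sum_j Num.sqrt `|g.2 i j|.

Lemma sqrtrD_le (a b : R) : 0 <= a -> 0 <= b ->
  Num.sqrt (a + b) <= Num.sqrt a + Num.sqrt b.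
Proof.
move=> a0 b0; have A := sqrtr_ge0 a; have B := sqrtr_ge0 b.
rewrite -[leRHS]ger0_norm ?addr_ge0// -[leRHS]sqrtr_sqr ler_wsqrtr// sqrrD.
by rewrite !sqr_sqrtr// lerD2r lerDl mulrn_wge0// mulr_ge0.
Qed.

(** An element of the group is the exponential of its first level times a
    product of commutators, all of which are reached by explicit paths. *)
Lemma ccnorm_le_boxnorm d (g : tens2 R d) : G2 g -> (ccnorm g <= (boxnorm g)%:E)%E.
Proof.
case: g => -[g0 a] G gG; have /G2P [/= g1 H] := gG; subst g0.
pose A := G - 2^-1 *: otimes a a; have AE i j : A i j = (G i j - G j i) / 2.
  rewrite !mxE !big_ord1 !mxE.
  by have := H i j; move: (a 0 i) (a 0 j) (G i j) (G j i) => p q r s; lra.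
have AT : A^T = - A.
  by apply/matrixP => i j; rewrite mxE [RHS]mxE !AE; field.
have gE : (1, a, G) = tmul (texp (a, 0)) (1, 0, A).
  rewrite /tmul /texp /= mulr1 !scale1r add0r; congr (_, _, _).
  by apply/matrixP => i j; rewrite !mxE !big_ord1 !mxE; ring.
apply: ccnorm_reach; rewrite gE; apply: reach_le.
  apply: reach_tmul; first exact: reach_texp.
  rewrite -(antisym_sum_bracket AT).
  exact: (reach_sum_bracket _ (fun i j => A i j / 2)).
rewrite -gE /boxnorm /= lerD2l -big_distrr/=.
rewrite -(pair_bigA _ (fun i j => Num.sqrt `|A i j / 2|))/=.
have -> : 8 * (\sum_i \sum_j Num.sqrt `|G i j|) =
    4 * (\sum_i \sum_j (Num.sqrt `|G i j| + Num.sqrt `|G j i|)).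
  under [in RHS]eq_bigr do rewrite big_split/=.
  by rewrite big_split/= [X in _ = _ * (_ + X)]exchange_big/=; ring.
rewrite ler_wpM2l//; apply: ler_sum => i _; apply: ler_sum => j _.
apply: le_trans (sqrtrD_le (normr_ge0 _) (normr_ge0 _)); rewrite ler_wsqrtr//.
rewrite AE -mulrA normrM.
have := ler_normB (G i j) (G j i); have := normr_ge0 (G i j - G j i).
by rewrite (ger0_norm (_ : 0 <= 2^-1 / 2)); lra.
Qed.

End CCUpper.

(** * Integration and powers *)

Section IntegralTools.
Local Open Scope ereal_scope.

(** Monotonicity of the integral of nonnegative functions that need not be
    measurable: the integral is a supremum over the simple functions below. It
    applies to integrands built from the Carnot-Caratheodory metric. *)
Lemma ge0_le_integral_nonmeas d (U : measurableType d) (R : realType)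
    (mu : {measure set U -> \bar R}) (D : set U) (f g : U -> \bar R) :
  (forall x, D x -> 0 <= f x) -> (forall x, D x -> f x <= g x) ->
  \int[mu]_(x in D) f x <= \int[mu]_(x in D) g x.
Proof.
move=> f0 fg; rewrite !ge0_integralE//; last first.
  by move=> x Dx; apply: le_trans (fg _ Dx); exact: f0.
apply: ereal_sup_le => _ [h hf <-]; exists h => // x.
apply: le_trans (hf x) _; rewrite /patch; case: ifPn => // xD.
by apply: fg; rewrite inE in xD.
Qed.

End IntegralTools.

Section PowerTools.
Context {R : realType}.
Implicit Types (a b c p q : R).

Lemma ge0_ler_powR2 p a b : 0 <= p -> 0 <= a -> a <= b -> a `^ p <= b `^ p.
Proof.
move=> p0 a0 ab; apply: ge0_ler_powR => //; rewrite nnegrE//.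
exact: le_trans ab.
Qed.

(** Young's inequality in the form that trades an L^1 for an L^p bound. *)
Lemma young_threshold p a lam : 1 <= p -> 0 <= a -> 0 < lam ->
  a <= lam + lam `^ (1 - p) * a `^ p.
Proof.
move=> p1 a0 l0; have [al|la] := leP a lam.
  by apply: (le_trans al); rewrite lerDl mulr_ge0// powR_ge0.
apply: (@le_trans _ _ (lam `^ (1 - p) * a `^ p)); last by rewrite lerDr ltW.
have ap : 0 < a by exact: lt_trans la.
rewrite -(@mulr_powRB1 _ a p)//; last exact: lt_le_trans p1.
rewrite mulrCA ler_pMr//; apply: (@le_trans _ _ (lam `^ (1 - p) * lam `^ (p - 1))).
  rewrite -powRD ?(gt_eqF l0) ?implybT//.
  by rewrite (_ : 1 - p + (p - 1) = 0) ?powRr0//; ring.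
by rewrite ler_wpM2l ?powR_ge0// ge0_ler_powR2 ?subr_ge0// ltW.
Qed.

Lemma powR_add_le q a b : 0 <= q -> 0 <= a -> 0 <= b ->
  (a + b) `^ q <= 2 `^ q * (a `^ q + b `^ q).
Proof.
move=> q0 a0 b0; wlog ab : a b a0 b0 / a <= b.
  move=> H; have [ab|/ltW ba] := leP a b; first exact: H.
  by rewrite addrC [a `^ q + _]addrC; exact: H.
apply: (@le_trans _ _ ((2 * b) `^ q)).
  by apply: ge0_ler_powR2; [|exact: addr_ge0|lra].
by rewrite powRM// ler_wpM2l ?powR_ge0// lerDr powR_ge0.
Qed.

(** Tangent line inequality at c, from which Jensen's inequality follows. *)
Lemma powR_tangent q a c : 1 <= q -> 0 <= a -> 0 <= c ->
  c `^ q + q * c `^ (q - 1) * (a - c) <= a `^ q.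
Proof.
move=> q1 a0 c0; have q0 : 0 < q by exact: lt_le_trans q1.
move: q1; rewrite le_eqVlt => /orP[/eqP<-|q1].
  by rewrite subrr powRr0 !powRr1// mulr1 mul1r addrC subrK.
have q10 : 0 < q - 1 by rewrite subr_gt0.
have := @conjugate_powR _ a (c `^ (q - 1)) q (q / (q - 1)) a0 (powR_ge0 _ _) q0
  (divr_gt0 q0 q10) _.
have -> : q^-1 + (q / (q - 1))^-1 = 1.
  by rewrite invf_div; field; rewrite !gt_eqF.
move=> /(_ erefl).
rewrite -powRrM (_ : (q - 1) * (q / (q - 1)) = q); last by field; rewrite gt_eqF.
rewrite -(ler_pM2l q0) (_ : q * (a `^ q / q + c `^ q / (q / (q - 1))) =
  a `^ q + (q - 1) * c `^ q); last by field; rewrite !gt_eqF.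
rewrite mulrBr -[q * c `^ (q - 1) * c]mulrA [c `^ (q - 1) * c]mulrC mulr_powRB1//.
move: (c `^ (q - 1)) (c `^ q) (a `^ q) => x y z; lra.
Qed.

Lemma powR_convex_half q a b : 1 <= q -> 0 <= a -> 0 <= b ->
  ((a + b) / 2) `^ q <= (a `^ q + b `^ q) / 2.
Proof.
move=> q1 a0 b0; have c0 : 0 <= (a + b) / 2 by rewrite divr_ge0// addr_ge0.
have := lerD (powR_tangent q1 a0 c0) (powR_tangent q1 b0 c0).
move: (_ `^ (q - 1)) (_ `^ q) (a `^ q) (b `^ q) => x y z w.
have -> : y + q * x * (a - (a + b) / 2) + (y + q * x * (b - (a + b) / 2)) = 2 * y.
  by field.
lra.
Qed.

Lemma powR_superadd q a b : 1 <= q -> 0 <= a -> 0 <= b ->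
  a `^ q + b `^ q <= (a + b) `^ q.
Proof.
move=> q1 a0 b0; have q0 : 0 < q by exact: lt_le_trans q1.
rewrite -!(@mulr_powRB1 _ _ q)// ?addr_ge0// mulrDl lerD// ler_wpM2l//.
  by rewrite ge0_ler_powR2 ?subr_ge0// lerDl.
by rewrite ge0_ler_powR2 ?subr_ge0// lerDr.
Qed.

Lemma jensen_powR (I : Type) (s : seq I) (w f : I -> R) q A :
  1 <= q -> (forall i, 0 <= w i) -> (forall i, 0 <= f i) ->
  0 < A -> \sum_(i <- s) w i <= A ->
  (\sum_(i <- s) w i * f i) `^ q <= A `^ (q - 1) * \sum_(i <- s) w i * f i `^ q.
Proof.
move=> q1 w0 f0 A0 wA; have q0 : 0 < q by exact: lt_le_trans q1.
set S := \sum_(i <- s) w i * f i.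
have S0 : 0 <= S by apply: sumr_ge0 => i _; exact: mulr_ge0.
pose c := S / A; have c0 : 0 <= c by rewrite divr_ge0// ltW.
have -> : S = A * c by rewrite /c; field; rewrite gt_eqF.
rewrite powRM ?(ltW A0)// -(mulr_powRB1 (ltW A0) q0).
rewrite [A * _]mulrC -mulrA ler_wpM2l ?powR_ge0//.
apply: (@le_trans _ _ (\sum_(i <- s)
   w i * (c `^ q + q * c `^ (q - 1) * (f i - c)))); last first.
  by apply: ler_sum => i _; rewrite ler_wpM2l// powR_tangent.
have -> : \sum_(i <- s) w i * (c `^ q + q * c `^ (q - 1) * (f i - c)) =
   (\sum_(i <- s) w i) * (c `^ q - q * c `^ (q - 1) * c) + q * c `^ (q - 1) * S.
  rewrite /S mulr_suml mulr_sumr -big_split/=; apply: eq_bigr => i _; ring.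
have -> : S = A * c by rewrite /c; field; rewrite gt_eqF.
rewrite -mulrA [c `^ (q - 1) * c]mulrC mulr_powRB1//.
have -> : q * c `^ (q - 1) * (A * c) = q * A * (c * c `^ (q - 1)) by ring.
rewrite mulr_powRB1//.
have cq := powR_ge0 c q; move: (c `^ q) cq => y y0.
set W := \sum_(i <- s) w i in wA *.
have : 0 <= (A - W) * ((q - 1) * y).
  by rewrite !mulr_ge0// subr_ge0.
lra.
Qed.

Lemma sum_geo_dist (r : R) j N : 0 <= r < 1 ->
  \sum_(0 <= m < N) r ^+ ((m - j) + (j - m)) <= 2 / (1 - r).
Proof.
move=> /andP[r0 r1]; rewrite ler_pdivlMr ?subr_gt0// mulrC.
set S := fun N => (1 - r) * \sum_(0 <= m < N) r ^+ ((m - j) + (j - m)).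
have S1 n : (n <= j)%N -> S n <= r ^+ (j - n).+1.
  elim: n => [|n IH] nj; first by rewrite /S big_nil mulr0 exprn_ge0.
  rewrite /S big_nat_recr//= mulrDr; apply: (le_trans (lerD (IH (ltnW nj)) (lexx _))).
  have -> : (n - j + (j - n) = (j - n.+1).+1)%N by lia.
  have -> : (j - n = (j - n.+1).+1)%N by lia.
  by rewrite mulrBl mul1r -exprS [leLHS]addrCA subrr addr0.
have S2 n : S (j + n)%N <= 2 - r ^+ n.
  elim: n => [|n IH].
    rewrite addn0 expr0; apply: (le_trans (S1 j (leqnn _))).
    by rewrite subnn expr1; lra.
  rewrite addnS /S big_nat_recr//= mulrDr; apply: (le_trans (lerD IH (lexx _))).
  have -> : (j + n - j + (j - (j + n)) = n)%N by lia.
  by rewrite exprS; lra.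
rewrite -/(S N); have [Nj|/ltnW jN] := leqP N j.
  by apply: (le_trans (S1 _ Nj)); apply: (@le_trans _ _ 1); [apply: exprn_ile1 => //; exact: ltW|lra].
rewrite -(subnKC jN); apply: (le_trans (S2 _)).
by rewrite lerBlDr lerDl exprn_ge0.
Qed.

End PowerTools.

(** * Local oscillation and smoothing kernels *)

Section Oscillation.
Context {R : realType}.
Variable (T : R).
Hypothesis T0 : 0 < T.
Local Notation mu := (@lebesgue_measure R).
Implicit Types (x f : R -> R) (p c : R).

Definition strip (c : R) : set (R * R) :=
  [set u | [/\ 0 <= u.1 <= T, 0 <= u.2 <= T & `|u.2 - u.1| <= c]].

Lemma measurable_preimage_le d (U : measurableType d) (f : U -> R) c :
  measurable_fun setT f -> measurable [set u | f u <= c].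
Proof.
move=> mf; have := mf measurableT `]-oo, c]%classic (measurable_itv _).
rewrite setTI; congr (measurable _); apply/seteqP; split => u /=;
  by rewrite in_itv.
Qed.

Lemma measurable_incr x : continuous x ->
  measurable_fun setT (fun u : R * R => x u.2 - x u.1).
Proof.
move=> cx; have mx := continuous_measurable_fun cx.
by apply: measurable_funB; apply: (measurableT_comp mx).
Qed.

Lemma measurable_strip c : measurable (strip c).
Proof.
have -> : strip c = [set u | - u.1 <= 0] `&` [set u | u.1 <= T] `&`
   ([set u | - u.2 <= 0] `&` [set u | u.2 <= T]) `&` [set u | `|u.2 - u.1| <= c].
  apply/seteqP; split => u /=; rewrite !oppr_le0.
    by case=> /andP[? ?] /andP[? ?] ?.
  by case=> [[[? ?] [? ?]] ?]; split => //; apply/andP.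
have m1 : measurable_fun setT (fst : R * R -> R) by exact: measurable_fst.
have m2 : measurable_fun setT (snd : R * R -> R) by exact: measurable_snd.
apply: measurableI; first by do 2? apply: measurableI; apply: measurable_preimage_le;
  rewrite //; exact: measurableT_comp.
apply: measurable_preimage_le; apply: measurableT_comp => //.
exact: measurable_funB.
Qed.

Definition osc_power p c x (u : R * R) : R :=
  \1_(strip c) u * `|x u.2 - x u.1| `^ p.

Lemma osc_power_ge0 p c x u : 0 <= osc_power p c x u.
Proof. by rewrite mulr_ge0// powR_ge0. Qed.

Lemma measurable_osc_power p c x : continuous x ->
  measurable_fun setT (osc_power p c x).
Proof.
move=> cx; apply: measurable_funM.
  by apply: measurable_indic; exact: measurable_strip.
apply: (measurableT_comp (measurable_powR p)).
by apply: (measurableT_comp (@normr_measurable R setT)); exact: measurable_incr.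
Qed.

Definition local_osc p c x (s : R) : \bar R :=
  (\int[mu]_v (osc_power p c x (s, v))%:E)%E.

Lemma measurable_local_osc p c x : continuous x ->
  measurable_fun setT (local_osc p c x).
Proof.
move=> cx; apply: (@measurable_fun_fubini_tonelli_F _ _ _ _ _ mu
  (fun u => (osc_power p c x u)%:E)).
  by apply/measurable_EFinP; exact: measurable_osc_power.
by move=> u; rewrite lee_fin osc_power_ge0.
Qed.

Lemma local_osc_ge0 p c x s : (0 <= local_osc p c x s)%E.
Proof. by apply: integral_ge0 => v _; rewrite lee_fin osc_power_ge0. Qed.

Lemma integral_local_osc p c x : continuous x ->
  (\int[mu \x mu]_u (osc_power p c x u)%:E = \int[mu]_s local_osc p c x s)%E.
Proof.
move=> cx; apply: fubini_tonelli1.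
  by apply/measurable_EFinP; exact: measurable_osc_power.
by move=> u; rewrite lee_fin osc_power_ge0.
Qed.

Lemma continuous_bounded x : continuous x ->
  exists2 M : R, 0 <= M & forall t, 0 <= t <= T -> `|x t| <= M.
Proof.
move=> cx; have cI : {within `[0, T], continuous (fun t => `|x t|)}.
  apply: continuous_subspaceT => t; apply: continuous_comp; first exact: cx.
  exact: norm_continuous.
have [t tI tM] := EVT_max (ltW T0) cI.
exists `|x t| => // s sI; apply: tM; by rewrite in_itv.
Qed.

Lemma local_osc_lty p c x s : 0 <= p -> continuous x ->
  (local_osc p c x s < +oo)%E.
Proof.
move=> p0 cx; have [M M0 xM] := continuous_bounded cx.
apply: (@le_lt_trans _ _ (\int[mu]_(v in `[0%R, T]) ((M + M) `^ p)%:E)%E).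
  rewrite [leRHS]integral_mkcond; apply: ge0_le_integral_nonmeas => v _.
    by rewrite lee_fin osc_power_ge0.
  rewrite patchE; case: ifPn => vI; last first.
    rewrite /osc_power indicE memNset ?mul0r// => -[_ /= v2 _].
    by move: vI; rewrite notin_setE/= in_itv/=; apply.
  rewrite /osc_power indicE; case: (boolP ((s, v) \in _)); last first.
    by rewrite mul0r lee_fin powR_ge0.
  rewrite inE => -[/= s1 v1 _]; rewrite mul1r lee_fin ge0_ler_powR2//.
  by rewrite (le_trans (ler_normB _ _))// lerD// xM.
by rewrite integral_cst//= lebesgue_measure_itv/= lte_fin T0 -EFinB -EFinM ltry.
Qed.

Local Notation I f := (\int[mu]_(u in `[0, T]) f u).

Lemma continuous_integrable f : continuous f ->
  mu.-integrable `[0, T] (EFin \o f).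
Proof.
move=> cf; apply: continuous_compact_integrable; first exact: segment_compact.
exact: continuous_subspaceT.
Qed.

Lemma Rintegral_le_integral f (H : R -> R) : continuous f ->
  (forall u, 0 <= H u) -> (forall u, 0 <= u <= T -> `|f u| <= H u) ->
  (`|I f|%:E <= \int[mu]_u (H u)%:E)%E.
Proof.
move=> cf H0 fH; have If := continuous_integrable cf.
rewrite EFin_normr_Rintegral//.
apply: (le_trans (le_abse_integral _ _ _)) => //.
  by case/integrableP: If.
rewrite integral_mkcond; apply: ge0_le_integral_nonmeas => u _.
  by rewrite patchE; case: ifPn.
rewrite patchE; case: ifPn => [|_]; last by rewrite lee_fin.
by rewrite inE/= in_itv/= => uI; rewrite lee_fin; exact: fH.
Qed.

End Oscillation.

HB.lock Definition osc (R : realType) (T p c : R) (x : R -> R) (s : R) : R :=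
  fine (local_osc T p c x s).

Section OscillationBound.
Context {R : realType}.
Variable (T : R).
Hypothesis T0 : 0 < T.
Local Notation mu := (@lebesgue_measure R).
Local Notation I f := (\int[mu]_(u in `[0, T]) f u).
Implicit Types (x f : R -> R) (p c : R).

Lemma osc_ge0 p c x s : 0 <= osc T p c x s.
Proof. by rewrite osc.unlock fine_ge0// local_osc_ge0. Qed.

Lemma oscE p c x s : 0 <= p -> continuous x ->
  (osc T p c x s)%:E = local_osc T p c x s.
Proof.
move=> p0 cx; rewrite osc.unlock fineK// ge0_fin_numE ?local_osc_ge0//.
exact: local_osc_lty.
Qed.

(** Young's inequality converts the increments of x near s, which are integrated
    to the first power, into the oscillation of order p. The threshold lam is
    later taken of the size of the normalised oscillation. *)
Lemma Rintegral_osc_le p c x s f M lam : 1 <= p -> continuous x -> continuous f ->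
  0 <= c -> 0 <= M -> 0 < lam -> 0 <= s <= T ->
  (forall u, 0 <= u <= T -> `|f u| <= M * `|x u - x s|) ->
  (forall u, 0 <= u <= T -> c < `|u - s| -> f u = 0) ->
  `|I f| <= M * (2 * c * lam + lam `^ (1 - p) * osc T p c x s).
Proof.
move=> p1 cx cf c0 M0 l0 sI fM f0; have p0 : 0 <= p by exact: le_trans p1.
pose H u := M * (lam * \1_(`[s - c, s + c]%classic) u +
  lam `^ (1 - p) * osc_power T p c x (s, u)).
have H0 u : 0 <= H u.
  by rewrite mulr_ge0// addr_ge0// mulr_ge0 ?powR_ge0 ?osc_power_ge0// ltW.
rewrite -lee_fin; apply: (le_trans (@Rintegral_le_integral _ T f H cf H0 _)).
  move=> u uI; have [us|us] := leP `|u - s| c; last by rewrite f0// normr0.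
  apply: (le_trans (fM _ uI)); rewrite ler_wpM2l// indicE mem_set/=; last first.
    by rewrite in_itv/=; move: us; rewrite ler_norml => /andP[? ?]; lra.
  by rewrite mulr1 /osc_power indicE mem_set//= mul1r young_threshold.
have mosc : measurable_fun setT (fun u => osc_power T p c x (s, u)).
  by apply: (measurableT_comp (measurable_osc_power T p c cx)); exact: measurable_pair1.
rewrite /H; under eq_integral do rewrite EFinM EFinD.
have m1 : measurable_fun setT (EFin \o (fun u => lam * \1_(`[s - c, s + c]%classic) u)).
  by apply/measurable_EFinP; exact: measurable_funM.
have m2 : measurable_fun setT (EFin \o (fun u => lam `^ (1 - p) * osc_power T p c x (s, u))).
  by apply/measurable_EFinP; apply: measurable_funM.
rewrite ge0_integralZl_EFin//; last 2 first.
- move=> u _; rewrite -EFinD lee_fin addr_ge0// mulr_ge0 ?powR_ge0 ?osc_power_ge0//.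
  exact: ltW.
- exact: emeasurable_funD.
rewrite ge0_integralD//; last 2 first.
- by move=> u _; rewrite lee_fin mulr_ge0// ltW.
- by move=> u _; rewrite lee_fin mulr_ge0 ?powR_ge0// osc_power_ge0.
under [X in (_ * (_ + X) <= _)%E]eq_integral do rewrite EFinM.
under [X in (_ * (X + _) <= _)%E]eq_integral do rewrite EFinM.
rewrite !ge0_integralZl_EFin ?powR_ge0//; last 4 first.
- by move=> u _; rewrite lee_fin osc_power_ge0.
- exact/measurable_EFinP.
- by apply/measurable_EFinP; apply: measurable_indic; exact: measurable_itv.
- exact: ltW.
rewrite -/(local_osc T p c x s) -oscE// integral_indic//= setIT.
rewrite lebesgue_measure_itv/= lte_fin.
rewrite (_ : (if _ then _ else _) = (2 * c)%:E); last first.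
  case: ifPn => [_|]; first by congr (_%:E); lra.
  by rewrite -leNgt => cs; congr (_%:E); lra.
by rewrite -!EFinM lee_fin ler_wpM2l// lerD2r; lra.
Qed.

End OscillationBound.

Section Smoothing.
Context {R : realType}.
Variable (T : R).
Hypothesis T0 : 0 < T.
Local Notation mu := (@lebesgue_measure R).
Local Notation I f := (\int[mu]_(u in `[0, T]) f u).
Implicit Types (x f g : R -> R) (p c e s t u : R).

Lemma IntegralB f g : continuous f -> continuous g ->
  I (fun u => f u - g u) = I f - I g.
Proof. by move=> cf cg; apply: RintegralB => //; exact: continuous_integrable. Qed.

Lemma IntegralZl a f : continuous f -> I (fun u => a * f u) = a * I f.
Proof. by move=> cf; apply: RintegralZl => //; exact: continuous_integrable. Qed.

Lemma le_Integral f g : continuous f -> continuous g ->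
  (forall u, 0 <= u <= T -> f u <= g u) -> I f <= I g.
Proof.
move=> cf cg fg; apply: le_Rintegral => //.
  exact: continuous_integrable.
exact: continuous_integrable.
Qed.

Lemma Integral_cst a : I (fun=> a) = a * T.
Proof.
by rewrite Rintegral_cst//= lebesgue_measure_itv/= lte_fin T0 -EFinB/= subr0.
Qed.

Lemma Integral_window_le f M c s : continuous f -> 0 <= c -> 0 <= M ->
  (forall u, 0 <= u <= T -> `|f u| <= M) ->
  (forall u, 0 <= u <= T -> c < `|u - s| -> f u = 0) ->
  `|I f| <= M * (2 * c).
Proof.
move=> cf c0 M0 fM f0.
rewrite -lee_fin; apply: (le_trans (@Rintegral_le_integral _ T f
  (fun u => M * \1_(`[s - c, s + c]%classic) u) cf _ _)).
- by move=> u; rewrite mulr_ge0.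
- move=> u uI; have [us|us] := leP `|u - s| c; last first.
    by rewrite f0// normr0 mulr_ge0.
  rewrite indicE mem_set/= ?mulr1 ?fM//.
  by rewrite in_itv/=; move: us; rewrite ler_norml => /andP[? ?]; lra.
- under eq_integral do rewrite EFinM.
  rewrite ge0_integralZl_EFin//; last first.
    by apply/measurable_EFinP; apply: measurable_indic; exact: measurable_itv.
  rewrite integral_indic//= setIT lebesgue_measure_itv/= lte_fin.
  rewrite (_ : (if _ then _ else _) = (2 * c)%:E) ?lee_fin//.
  case: ifPn => [_|]; first by congr (_%:E); lra.
  by rewrite -leNgt => cs; congr (_%:E); lra.
Qed.

Lemma lipschitz_continuous f (C : R) :
  (forall u v, `|f u - f v| <= C * `|u - v|) -> continuous f.
Proof.
move=> fC u; apply/cvgrPdist_le => e e0.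
have C1 : 0 < `|C| + 1 by rewrite ltr_wpDl.
near=> v; apply: (le_trans (fC u v)).
apply: (@le_trans _ _ ((`|C| + 1) * `|u - v|)).
  by rewrite ler_wpM2r//; apply: (le_trans (ler_norm _)); rewrite lerDl.
rewrite mulrC -ler_pdivlMr//; near: v.
apply/nbhs_ballP; exists (e / (`|C| + 1)); first exact: divr_gt0.
by move=> v /= /ltW.
Unshelve. all: by end_near. Qed.

Definition plateau e t u : R := Num.min 1 (Num.max 0 (2 - `|t - u| / e)).

Lemma plateau_ge0 e t u : 0 <= plateau e t u.
Proof. by rewrite /plateau le_min ler01 le_max lexx. Qed.

Lemma plateau_le1 e t u : plateau e t u <= 1.
Proof. by rewrite /plateau ge_min lexx. Qed.

Lemma plateau_sym e t u : plateau e t u = plateau e u t.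
Proof. by rewrite /plateau distrC. Qed.

Lemma plateau_eq0 e t u : 0 < e -> 2 * e < `|u - t| -> plateau e t u = 0.
Proof.
move=> e0 h; rewrite /plateau max_l ?min_r ?ler01// subr_le0 ler_pdivlMr//.
by rewrite distrC ltW.
Qed.

Lemma plateau_eq1 e t u : 0 < e -> `|t - u| <= e -> plateau e t u = 1.
Proof.
move=> e0 h; have : `|t - u| / e <= 1 by rewrite ler_pdivrMr// mul1r.
by move=> {}h; rewrite /plateau max_r ?min_l//; lra.
Qed.

Lemma plateau_lip e t s u : 0 < e -> `|plateau e t u - plateau e s u| <= `|t - s| / e.
Proof.
move=> e0.
have clamp_lip (a b : R) : `|Num.min 1 (Num.max 0 a) - Num.min 1 (Num.max 0 b)| <= `|a - b|.
  have := ler_norm (a - b); have := ler_norm (b - a); rewrite (distrC b).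
  move: `|a - b| => d d1 d2; rewrite ler_norml.
  by rewrite /Num.min /Num.max; repeat case: ifPn; rewrite -?leNgt => *; lra.
apply: (le_trans (clamp_lip _ _)).
have -> : 2 - `|t - u| / e - (2 - `|s - u| / e) = (`|s - u| - `|t - u|) / e by ring.
rewrite normrM normfV (gtr0_norm e0) ler_pM2r ?invr_gt0//.
apply: (le_trans (ler_dist_dist _ _)).
by rewrite (_ : s - u - (t - u) = s - t) ?(distrC s)//; ring.
Qed.

Lemma plateau_continuous e t : 0 < e -> continuous (plateau e t).
Proof.
move=> e0; apply: (@lipschitz_continuous _ e^-1) => u v.
by rewrite !(plateau_sym e t) mulrC plateau_lip.
Qed.

Definition mass e t : R := I (plateau e t).

(** An interval of length e / 2 with endpoint t lies in [0, T], on one side of t or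
    the other, and the plateau is 1 there. *)
Lemma mass_ge e t : 0 < e <= T -> 0 <= t <= T -> e / 2 <= mass e t.
Proof.
move=> /andP[e0 eT] /andP[t0 tT].
have If := @continuous_integrable _ T _ (@plateau_continuous e t e0).
have key (a : R) : 0 <= a -> a + e / 2 <= T -> a <= t <= a + e / 2 -> e / 2 <= mass e t.
  move=> a0 aT /andP[at_ ta].
  have sub : `[a, a + e / 2] `<=` `[0, T].
    by move=> u; rewrite /= !in_itv/= => /andP[? ?]; lra.
  apply: (@le_trans _ _ (\int[mu]_(u in `[a, a + e / 2]) plateau e t u)).
    rewrite (_ : \int[mu]_(u in _) _ = \int[mu]_(u in `[a, a + e / 2]) 1).
      rewrite Rintegral_cst//= lebesgue_measure_itv/= lte_fin ltrDl divr_gt0//.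
      by rewrite -EFinB/= mul1r; lra.
    apply: eq_Rintegral => u; rewrite inE/= in_itv/= => uI.
    by rewrite plateau_eq1// ler_norml; lra.
  rewrite /mass -lee_fin /Rintegral !fineK; last 2 first.
  - by apply: integrable_fin_num.
  - by apply: integrable_fin_num => //; exact: integrableS If.
  apply: ge0_subset_integral => //; first by case/integrableP: If.
  by move=> u _; rewrite lee_fin plateau_ge0.
have [tT2|tT2] := leP t (T / 2); first by apply: (key t); lra.
by apply: (key (t - e / 2)); lra.
Qed.

Definition kern e t u : R := (mass e t)^-1 * plateau e t u.

End Smoothing.

HB.lock Definition smooth (R : realType) (T e : R) (x : R -> R) (t : R) : R :=
  \int[@lebesgue_measure R]_(u in `[0, T]) (kern T e t u * x u).

Section SmoothingEstimates.
Context {R : realType}.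
Variable (T : R).
Hypothesis T0 : 0 < T.
Local Notation mu := (@lebesgue_measure R).
Local Notation I f := (\int[mu]_(u in `[0, T]) f u).
Local Notation mass := (mass T).
Local Notation kern := (kern T).
Local Notation smooth := (smooth T).
Implicit Types (x f g : R -> R) (p c e s t u : R).

Section Kernel.
Variables (e : R).
Hypothesis eT : 0 < e <= T.
Let e0 : 0 < e. Proof. by case/andP: eT. Qed.

Lemma mass_gt0 t : 0 <= t <= T -> 0 < mass e t.
Proof. by move=> tI; apply: lt_le_trans (mass_ge eT tI); exact: divr_gt0. Qed.

Lemma inv_mass_le t : 0 <= t <= T -> (mass e t)^-1 <= 2 / e.
Proof.
move=> tI; rewrite -[leRHS]invrK lef_pV2 ?posrE ?mass_gt0// ?invr_gt0 ?divr_gt0//.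
by rewrite invf_div mass_ge.
Qed.

Lemma kern_ge0 t u : 0 <= t <= T -> 0 <= kern e t u.
Proof. by move=> tI; rewrite mulr_ge0 ?plateau_ge0// invr_ge0 ltW// mass_gt0. Qed.

Lemma kern_le t u : 0 <= t <= T -> kern e t u <= 2 / e.
Proof.
move=> tI; rewrite -[leRHS]mulr1 ler_pM ?plateau_ge0 ?plateau_le1 ?inv_mass_le//.
by rewrite invr_ge0 ltW// mass_gt0.
Qed.

Lemma kern_eq0 t u : 2 * e < `|u - t| -> kern e t u = 0.
Proof. by move=> h; rewrite /kern plateau_eq0// mulr0. Qed.

Lemma kern_continuous t : continuous (kern e t).
Proof.
by move=> u; apply: cvgMr; exact: plateau_continuous.
Qed.

Lemma Integral_kern t : 0 <= t <= T -> I (kern e t) = 1.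
Proof.
move=> tI; rewrite (IntegralZl T _ (@plateau_continuous _ e t e0)) mulVf//.
by rewrite gt_eqF// mass_gt0.
Qed.

Lemma mass_lip t s : `|t - s| <= 2 * e -> `|mass e t - mass e s| <= 8 * `|t - s|.
Proof.
move=> ts; rewrite /mass -IntegralB; try exact: plateau_continuous.
have cf : continuous (fun u => plateau e t u - plateau e s u).
  by move=> u; apply: cvgB; exact: plateau_continuous.
have h0 : 0 <= `|t - s| / e by rewrite divr_ge0// ltW.
apply: (le_trans (@Integral_window_le _ T _ (`|t - s| / e) (4 * e) s cf _ h0 _ _)).
- by rewrite mulr_ge0// ltW.
- by move=> u _; exact: plateau_lip.
- move=> u _ us; have := ler_distD t u s => tri.
  by rewrite !plateau_eq0 ?subrr//; move: us ts tri e0; lra.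
- have -> : `|t - s| / e * (2 * (4 * e)) = 8 * `|t - s| by field; rewrite gt_eqF.
  exact: lexx.
Qed.

Lemma kern_lip t s u : 0 <= t <= T -> 0 <= s <= T -> `|t - s| <= 2 * e ->
  `|kern e t u - kern e s u| <= 34 * `|t - s| / e ^+ 2.
Proof.
move=> tI sI ts; have mt := mass_gt0 tI; have ms := mass_gt0 sI.
have -> : kern e t u - kern e s u = (mass e t)^-1 * (plateau e t u - plateau e s u) +
    plateau e s u * ((mass e s - mass e t) * ((mass e t)^-1 * (mass e s)^-1)).
  by rewrite /kern; field; rewrite !gt_eqF.
have := ler_normD ((mass e t)^-1 * (plateau e t u - plateau e s u))
 (plateau e s u * ((mass e s - mass e t) * ((mass e t)^-1 * (mass e s)^-1))).
move=> /le_trans; apply.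
have -> : 34 * `|t - s| / e ^+ 2 =
  2 / e * (`|t - s| / e) + 1 * (8 * `|t - s| * (2 / e * (2 / e))).
  by field; rewrite gt_eqF.
have it : `|(mass e t)^-1| <= 2 / e by rewrite gtr0_norm ?invr_gt0// inv_mass_le.
have is_ : `|(mass e s)^-1| <= 2 / e by rewrite gtr0_norm ?invr_gt0// inv_mass_le.
rewrite lerD// normrM ler_pM//; first exact: plateau_lip.
  by rewrite ger0_norm ?plateau_ge0// plateau_le1.
rewrite normrM ler_pM//; last by rewrite normrM ler_pM.
by rewrite distrC mass_lip.
Qed.

Section Estimates.
Variables (p : R) (x : R -> R) (c : R).
Hypotheses (p1 : 1 <= p) (cx : continuous x) (c4 : 4 * e <= c).

Lemma kernM_continuous t f : continuous f -> continuous (fun u => kern e t u * f u).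
Proof. by move=> cf u; apply: cvgM; [exact: kern_continuous|exact: cf]. Qed.

Lemma subc_continuous (a : R) : continuous (fun u => x u - a).
Proof. by move=> u; apply: cvgB; [exact: cx|exact: cvg_cst]. Qed.

Lemma smooth_subc t (a : R) : 0 <= t <= T ->
  smooth e x t - a = I (fun u => kern e t u * (x u - a)).
Proof.
move=> tI; transitivity (smooth e x t - a * I (kern e t)).
  by rewrite Integral_kern// mulr1.
rewrite smooth.unlock -IntegralZl; last exact: kern_continuous.
rewrite -IntegralB; [|exact: kernM_continuous|]; last first.
  by move=> u; apply: cvgMr; exact: kern_continuous.
by apply: eq_Rintegral => u _; rewrite mulrBr [a * _]mulrC.
Qed.

Lemma smooth_dist_le t s lam : 0 <= t <= T -> 0 <= s <= T -> 0 < lam ->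
  `|t - s| <= 2 * e ->
  `|smooth e x t - x s| <= 2 / e * (2 * c * lam + lam `^ (1 - p) * osc T p c x s).
Proof.
move=> tI sI l0 ts; rewrite smooth_subc//.
apply: Rintegral_osc_le => //.
- exact/kernM_continuous/subc_continuous.
- by apply: le_trans c4; rewrite mulr_ge0// ltW.
- by rewrite divr_ge0// ltW.
- move=> u uI; rewrite normrM ler_wpM2r// ger0_norm ?kern_ge0//.
  exact: kern_le.
- move=> u uI us; have := ler_distD t u s => tri.
  by rewrite kern_eq0 ?mul0r//; move: us ts tri e0 c4; lra.
Qed.

Lemma smooth_lip_le t s lam : 0 <= t <= T -> 0 <= s <= T -> 0 < lam ->
  `|t - s| <= 2 * e ->
  `|smooth e x t - smooth e x s| <=
    34 * `|t - s| / e ^+ 2 * (2 * c * lam + lam `^ (1 - p) * osc T p c x s).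
Proof.
move=> tI sI l0 ts.
have -> : smooth e x t - smooth e x s =
    (smooth e x t - x s) - (smooth e x s - x s) by ring.
rewrite !smooth_subc// -IntegralB; try exact/kernM_continuous/subc_continuous.
apply: Rintegral_osc_le => //.
- by move=> u; apply: cvgB; exact/kernM_continuous/subc_continuous.
- by apply: le_trans c4; rewrite mulr_ge0// ltW.
- by rewrite divr_ge0 ?sqr_ge0// mulr_ge0.
- by move=> u uI; rewrite -mulrBl normrM ler_wpM2r// kern_lip.
- move=> u uI us; have := ler_distD t u s => tri.
  by rewrite !kern_eq0 ?mul0r ?subrr//; move: us ts tri e0 c4; lra.
Qed.

(** Smoothing takes a weighted mean, so it inherits any bound valid on the window. *)
Lemma smooth_mean_le t (a d : R) : 0 <= t <= T -> 0 <= d ->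
  (forall u, 0 <= u <= T -> `|u - t| <= 2 * e -> `|x u - a| <= d) ->
  `|smooth e x t - a| <= d.
Proof.
move=> tI d0 xd; rewrite smooth_subc// -[d]mulr1 -(Integral_kern tI).
rewrite -IntegralZl; last exact: kern_continuous.
have cf := kernM_continuous (t := t) (@subc_continuous a).
apply: (le_trans (le_normr_Rintegral _ _)) => //.
  exact: continuous_integrable.
apply: le_Integral.
- move=> u; apply: (@cvg_comp _ _ _ _ Num.norm); first exact: cf.
  exact: norm_continuous.
- by move=> u; apply: cvgMr; exact: kern_continuous.
move=> u uI; have [ut|ut] := leP `|u - t| (2 * e); last first.
  by rewrite kern_eq0// mul0r mulr0 normr0.
by rewrite normrM mulrC (ger0_norm (kern_ge0 u tI)) ler_wpM2r ?kern_ge0// xd.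
Qed.

End Estimates.
End Kernel.

(** At the scale T the kernel is constant on the square of [0, T]. *)
Lemma smooth_T_const x t s : 0 <= t <= T -> 0 <= s <= T -> smooth T x t = smooth T x s.
Proof.
move=> tI sI.
have E r u : 0 <= r <= T -> 0 <= u <= T -> plateau T r u = 1.
  by move=> rI uI; rewrite plateau_eq1// ler_norml; lra.
have M r : 0 <= r <= T -> mass T r = T.
  move=> rI; transitivity (I (fun=> 1)); last by rewrite (Integral_cst T0) mul1r.
  apply: eq_Rintegral => u.
  by rewrite inE/= in_itv; exact: E.
rewrite smooth.unlock; apply: (@eq_Rintegral _ _ _ mu) => u.
by rewrite inE/= in_itv => uI; rewrite /kern !E// !M.
Qed.

End SmoothingEstimates.

(** * The paraproduct as a substitute for the iterated integral *)

Section ParaproductAlgebra.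
Context {R : realType}.
Implicit Types (m j N : nat) (K : R).

(** Gain at scale m for two points at distance T / 2 ^ j: the Lipschitz constant
    of the smoothing when m <= j, and nothing beyond. *)
Definition kappa m j : R := Num.min 1 (2 ^+ m / 2 ^+ j).

Lemma kappa_ge0 m j : 0 <= kappa m j.
Proof. by rewrite le_min ler01 divr_ge0// exprn_ge0. Qed.

Lemma kappa_ge m j : (j <= m)%N -> kappa m j = 1.
Proof.
move=> jm; rewrite /kappa min_l// ler_pdivlMr ?exprn_gt0// mul1r.
by rewrite ler_weXn2l// ler1n.
Qed.

Lemma kappa_le m j : (m <= j)%N -> kappa m j = 2 ^+ m / 2 ^+ j.
Proof.
move=> mj; rewrite /kappa min_r// ler_pdivrMr ?exprn_gt0// mul1r.
by rewrite ler_weXn2l// ler1n.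
Qed.

Lemma ler_add2 (a b c : R) : a <= c -> b <= c -> a + b <= 2 * c.
Proof. by move=> ac bc; rewrite mulr_natl mulr2n lerD. Qed.

Lemma mul_le_sqrs (a b : R) : 0 <= a -> 0 <= b -> a * b <= a ^+ 2 + b ^+ 2.
Proof.
move=> a0 b0; have := sqr_ge0 (a - b); have := mulr_ge0 a0 b0.
rewrite sqrrB; lra.
Qed.

(** The algebra behind the paraproduct, for abstract approximations Xs, Xt of
    xs, xt and Ys, Yt of ys, yt. Scales m <= j are coarser than the distance of
    the two points, and there the increments of the approximations are small;
    at the finer scales each approximation is close to its limit, and the
    contribution of the increment of x telescopes. *)
Lemma paraproduct_defect_le (Xs Xt Ys Yt a a' b b' : nat -> R)
    (xs xt ys yt K : R) j N : 1 <= K ->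
  (forall m, 0 <= a m) -> (forall m, 0 <= a' m) ->
  (forall m, 0 <= b m) -> (forall m, 0 <= b' m) ->
  (forall m, `|Xs m - xs| <= K * a m) ->
  (forall m, `|Xt m - xt| <= K * a' m) ->
  (forall m, `|Ys m - ys| <= K * b m) ->
  (forall m, `|Ys m.+1 - ys| <= K * b m) ->
  (forall m, `|Yt m - yt| <= K * b' m) ->
  (forall m, `|Yt m.+1 - yt| <= K * b' m) ->
  (forall m, (m <= j)%N -> `|Xt m - Xs m| <= K * kappa m j * a m) ->
  (forall m, (m <= j)%N -> `|Yt m - Ys m| <= K * kappa m j * b m) ->
  (forall m, (m <= j)%N -> `|Yt m.+1 - Ys m.+1| <= K * kappa m j * b m) ->
  (j < N)%N ->
  `|\sum_(0 <= m < N)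
      ((Xt m - xs) * (Yt m.+1 - Yt m) - (Xs m - xs) * (Ys m.+1 - Ys m))| <=
  8 * K ^+ 2 * (`|xt - xs| ^+ 2 + \sum_(0 <= m < N.+1)
     kappa m j * (a m ^+ 2 + a' m ^+ 2 + (b m ^+ 2 + b' m ^+ 2))).
Proof.
move=> K1 a0 a'0 b0 b'0 HXs HXt HYs HYs1 HYt HYt1 SX SY SY1 jN.
pose F m := a m ^+ 2 + a' m ^+ 2 + (b m ^+ 2 + b' m ^+ 2).
have F0 m : 0 <= F m by rewrite !addr_ge0// sqr_ge0.
have K0 : 0 <= K by lra.
have KK : K <= K ^+ 2 by rewrite expr2 ler_peMl.
have Dle (Y c : nat -> R) (y : R) m : `|Y m - y| <= K * c m -> `|Y m.+1 - y| <= K * c m ->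
    `|Y m.+1 - Y m| <= 2 * (K * c m).
  move=> A B; have -> : Y m.+1 - Y m = (Y m.+1 - y) - (Y m - y) by ring.
  by apply: (le_trans (ler_normB _ _)); exact: (ler_add2 B A).
have Ds m := Dle Ys b ys m (HYs m) (HYs1 m).
have Dt m := Dle Yt b' yt m (HYt m) (HYt1 m).
have low m : (m <= j)%N ->
   `|(Xt m - xs) * (Yt m.+1 - Yt m) - (Xs m - xs) * (Ys m.+1 - Ys m)| <=
    4 * K ^+ 2 * (kappa m j * F m).
  move=> mj; have k0 := kappa_ge0 m j.
  have -> : (Xt m - xs) * (Yt m.+1 - Yt m) - (Xs m - xs) * (Ys m.+1 - Ys m) =
    (Xt m - Xs m) * (Yt m.+1 - Yt m) +
    (Xs m - xs) * ((Yt m.+1 - Ys m.+1) - (Yt m - Ys m)) by ring.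
  have D2 : `|(Yt m.+1 - Ys m.+1) - (Yt m - Ys m)| <= 2 * (K * kappa m j * b m).
    by apply: (le_trans (ler_normB _ _)); exact: (ler_add2 (SY1 _ mj) (SY _ mj)).
  apply: (le_trans (ler_normD _ _)); rewrite !normrM.
  apply: (le_trans (lerD (ler_pM (normr_ge0 _) (normr_ge0 _) (SX _ mj) (Dt m))
                         (ler_pM (normr_ge0 _) (normr_ge0 _) (HXs m) D2))).
  have A := mul_le_sqrs (a0 m) (b'0 m); have B := mul_le_sqrs (a0 m) (b0 m).
  have -> : K * kappa m j * a m * (2 * (K * b' m)) +
      K * a m * (2 * (K * kappa m j * b m)) =
    2 * K ^+ 2 * (kappa m j * (a m * b' m + a m * b m)) by ring.
  have -> : 4 * K ^+ 2 * (kappa m j * F m) = 2 * K ^+ 2 * (kappa m j * (2 * F m)) by ring.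
  rewrite ler_wpM2l ?mulr_ge0 ?sqr_ge0// ler_wpM2l//.
  have := sqr_ge0 (a' m); have := sqr_ge0 (b m); have := sqr_ge0 (b' m).
  by rewrite /F; lra.
have high m : (j < m)%N ->
   `|(Xt m - xt) * (Yt m.+1 - Yt m) - (Xs m - xs) * (Ys m.+1 - Ys m)| <=
    4 * K ^+ 2 * (kappa m j * F m).
  move=> jm; rewrite kappa_ge ?(ltnW jm)// mul1r.
  apply: (le_trans (ler_normB _ _)); rewrite !normrM.
  apply: (le_trans (lerD (ler_pM (normr_ge0 _) (normr_ge0 _) (HXt m) (Dt m))
                         (ler_pM (normr_ge0 _) (normr_ge0 _) (HXs m) (Ds m)))).
  have -> : K * a' m * (2 * (K * b' m)) + K * a m * (2 * (K * b m)) =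
    2 * K ^+ 2 * (a' m * b' m + a m * b m) by ring.
  have -> : 4 * K ^+ 2 * F m = 2 * K ^+ 2 * (2 * F m) by ring.
  rewrite ler_wpM2l ?mulr_ge0 ?sqr_ge0//.
  have := mul_le_sqrs (a0 m) (b0 m); have := mul_le_sqrs (a'0 m) (b'0 m).
  by have := F0 m; rewrite /F; lra.
have mid : `|(xt - xs) * (Yt N - Yt j.+1)| <=
    4 * K ^+ 2 * (`|xt - xs| ^+ 2 + kappa N j * F N + kappa j j * F j).
  rewrite normrM (kappa_ge (ltnW jN)) (kappa_ge (leqnn j)) !mul1r.
  have Y : `|Yt N - Yt j.+1| <= K * (b' N + b' j).
    have -> : Yt N - Yt j.+1 = (Yt N - yt) - (Yt j.+1 - yt) by ring.
    by apply: (le_trans (ler_normB _ _)); rewrite mulrDr lerD.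
  apply: (le_trans (ler_wpM2l (normr_ge0 _) Y)).
  have A := mul_le_sqrs (normr_ge0 (xt - xs)) (b'0 N).
  have B := mul_le_sqrs (normr_ge0 (xt - xs)) (b'0 j).
  have h0 := normr_ge0 (xt - xs); move: `|xt - xs| h0 A B => h h0 A B.
  have -> : h * (K * (b' N + b' j)) = K * (h * b' N + h * b' j) by ring.
  rewrite -[leRHS]mulrA; apply: (le_trans (ler_wpM2r _ KK)).
    by rewrite addr_ge0// mulr_ge0.
  rewrite mulrCA ler_wpM2l ?sqr_ge0//.
  have := sqr_ge0 h; have := sqr_ge0 (b' N); have := sqr_ge0 (b' j).
  have oN : b' N ^+ 2 <= F N by rewrite /F addrA lerDr !addr_ge0// sqr_ge0.
  have oj : b' j ^+ 2 <= F j by rewrite /F addrA lerDr !addr_ge0// sqr_ge0.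
  lra.
rewrite (@big_cat_nat _ _ _ j.+1)//=.
have -> : \sum_(j.+1 <= m < N)
    ((Xt m - xs) * (Yt m.+1 - Yt m) - (Xs m - xs) * (Ys m.+1 - Ys m)) =
  \sum_(j.+1 <= m < N)
    ((Xt m - xt) * (Yt m.+1 - Yt m) - (Xs m - xs) * (Ys m.+1 - Ys m)) +
  (xt - xs) * (Yt N - Yt j.+1).
  rewrite -(telescope_sumr _ jN) mulr_sumr -big_split/=.
  by apply: eq_bigr => m _; ring.
apply: (@le_trans _ _ (\sum_(0 <= m < j.+1) 4 * K ^+ 2 * (kappa m j * F m) +
  \sum_(j.+1 <= m < N) 4 * K ^+ 2 * (kappa m j * F m) +
  4 * K ^+ 2 * (`|xt - xs| ^+ 2 + kappa N j * F N + kappa j j * F j))).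
  rewrite addrA; apply: (le_trans (ler_normD _ _)); apply: lerD => //.
  apply: (le_trans (ler_normD _ _)); apply: lerD.
    apply: (le_trans (ler_norm_sum _ _ _)); rewrite big_nat [leRHS]big_nat.
    by apply: ler_sum => m /andP[_ mj]; exact: low.
  apply: (le_trans (ler_norm_sum _ _ _)); rewrite big_nat [leRHS]big_nat.
  by apply: ler_sum => m /andP[mj _]; exact: high.
rewrite -big_cat_nat//= -mulr_sumr -mulrDr.
have -> : 8 * K ^+ 2 = 4 * K ^+ 2 * 2 by ring.
rewrite -[leRHS]mulrA ler_wpM2l ?mulr_ge0 ?sqr_ge0//.
rewrite big_nat_recr//=.
have FE : \sum_(0 <= m < N) kappa m j * (a m ^+ 2 + a' m ^+ 2 + (b m ^+ 2 + b' m ^+ 2))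
  = \sum_(0 <= m < N) kappa m j * F m by [].
rewrite {}FE -/(F N); set S := \sum_(0 <= m < N) _.
have Sj : kappa j j * F j <= S.
  rewrite /S (@big_cat_nat _ _ _ j)//=; last exact: ltnW.
  rewrite [X in _ + X]big_ltn// addrCA lerDl addr_ge0// sumr_ge0// => m _;
    by rewrite mulr_ge0 ?kappa_ge0.
have N0 : 0 <= kappa N j * F N by rewrite mulr_ge0 ?kappa_ge0.
have x0 := sqr_ge0 `|xt - xs|; lra.
Qed.

End ParaproductAlgebra.

Section Scales.
Context {R : realType}.
Variables (T alpha p : R).
Hypotheses (T0 : 0 < T) (p1 : 1 <= p).
Implicit Types (x y : R -> R) (s t lam : R) (m j N : nat).

Definition eps m : R := T / 2 ^+ m.

Lemma eps_gt0 m : 0 < eps m.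
Proof. by rewrite divr_gt0// exprn_gt0. Qed.

Lemma eps_le m : 0 < eps m <= T.
Proof.
rewrite eps_gt0/= ler_pdivrMr ?exprn_gt0// ler_peMr ?(ltW T0)//.
by rewrite exprn_ege1// ler1n.
Qed.

Lemma epsS m : eps m.+1 = eps m / 2.
Proof. by rewrite /eps exprS invfM mulrA mulrAC. Qed.

Definition dyadic_mean m x t : R := smooth T (eps m) x t.

(** The mean oscillation of order p near s, in the dimension of x. *)
Definition osc_size m x s : R := (osc T p (4 * eps m) x s / eps m) `^ p^-1.

Lemma osc_size_ge0 m x s : 0 <= osc_size m x s.
Proof. exact: powR_ge0. Qed.

Lemma osc_sizeE m x s :
  osc T p (4 * eps m) x s = eps m * osc_size m x s `^ p.
Proof.
have p0 : 0 < p by exact: lt_le_trans p1.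
rewrite /osc_size -powRrM mulVf ?gt_eqF// powRr1.
  by rewrite [RHS]mulrC divfK// gt_eqF// eps_gt0.
by rewrite divr_ge0 ?osc_ge0// ltW// eps_gt0.
Qed.

Lemma osc_balance m x s lam : 0 < lam -> osc_size m x s <= lam ->
  lam `^ (1 - p) * osc T p (4 * eps m) x s <= eps m * lam.
Proof.
move=> l0 le; have p0 : 0 <= p by exact: le_trans p1.
rewrite osc_sizeE mulrCA ler_wpM2l ?(ltW (eps_gt0 m))//.
apply: (@le_trans _ _ (lam `^ (1 - p) * lam `^ p)).
  by rewrite ler_wpM2l ?powR_ge0// ge0_ler_powR2// osc_size_ge0.
by rewrite -powRD ?(gt_eqF l0) ?implybT// subrK powRr1// ltW.
Qed.

(** Thresholds are positive while the oscillation may vanish; this passes to the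
    limit. *)
Lemma le_mul_of_gt (K a b : R) : 0 < K -> 0 <= a ->
  (forall lam, 0 < lam -> a <= lam -> b <= K * lam) -> b <= K * a.
Proof.
move=> K0 a0 H; apply/ler_addgt0Pr => e e0.
have -> : K * a + e = K * (a + e / K) by field; rewrite gt_eqF.
by apply: H; rewrite ?lerDl ?ltr_wpDl// ?divr_ge0 ?divr_gt0// ltW.
Qed.

Lemma smooth_close m x t e : continuous x -> 0 <= t <= T ->
  0 < e <= T -> e <= eps m -> eps m <= 2 * e ->
  `|smooth T e x t - x t| <= 36 * osc_size m x t.
Proof.
move=> cx tI eT em me; have em0 := eps_gt0 m.
have e0 : 0 < e by case/andP: eT.
apply: le_mul_of_gt => // [|lam l0 le]; first exact: osc_size_ge0.
have c4 : 4 * e <= 4 * eps m by rewrite ler_pM2l.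
apply: (le_trans (smooth_dist_le T0 eT p1 cx c4 tI tI l0 _)).
  by rewrite subrr normr0 mulr_ge0// ltW.
have := osc_balance l0 le; set G := _ * osc _ _ _ _ _ => GE.
apply: (@le_trans _ _ (2 / e * (2 * (4 * eps m) * lam + eps m * lam))).
  by rewrite ler_wpM2l// ?divr_ge0 ?lerD// ltW.
have -> : 2 / e * (2 * (4 * eps m) * lam + eps m * lam) = 18 * (eps m / e) * lam.
  by field; rewrite gt_eqF.
rewrite ler_wpM2r ?(ltW l0)//.
have : eps m / e <= 2 by rewrite ler_pdivrMr.
lra.
Qed.

Lemma smooth_slope m x t s e : continuous x -> 0 <= t <= T -> 0 <= s <= T ->
  0 < e <= T -> e <= eps m -> eps m <= 2 * e -> `|t - s| <= eps m ->
  `|smooth T e x t - smooth T e x s| <= 36 * 34 * (`|t - s| / eps m) * osc_size m x s.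
Proof.
move=> cx tI sI eT em me ts; have em0 := eps_gt0 m.
have e0 : 0 < e by case/andP: eT.
have [->|tns] := eqVneq t s.
  by rewrite !subrr !normr0 mul0r mulr0 mul0r.
have h0 : 0 < `|t - s| by rewrite normr_gt0 subr_eq0.
apply: le_mul_of_gt => [||lam l0 le].
- by rewrite mulr_gt0// divr_gt0.
- exact: osc_size_ge0.
have c4 : 4 * e <= 4 * eps m by rewrite ler_pM2l.
apply: (le_trans (smooth_lip_le T0 eT p1 cx c4 tI sI l0 (le_trans ts me))).
have := osc_balance l0 le; set G := _ * osc _ _ _ _ _ => GE.
apply: (@le_trans _ _ (34 * `|t - s| / e ^+ 2 * (2 * (4 * eps m) * lam + eps m * lam))).
  by rewrite ler_wpM2l// ?divr_ge0 ?lerD// ?sqr_ge0// mulr_ge0.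
have -> : 34 * `|t - s| / e ^+ 2 * (2 * (4 * eps m) * lam + eps m * lam) =
    9 * 34 * (eps m / e) ^+ 2 * (`|t - s| / eps m * lam).
  by field; rewrite !gt_eqF.
rewrite -[leRHS]mulrA ler_wpM2r//.
  by rewrite mulr_ge0 ?divr_ge0// ltW.
have ee : eps m / e <= 2 by rewrite ler_pdivrMr.
have ee0 : 0 <= eps m / e by rewrite divr_ge0// ltW.
have : (eps m / e) ^+ 2 <= 4.
  by rewrite (_ : 4 = 2 ^+ 2) ?lerXn2r ?nnegrE//; ring.
lra.
Qed.

(** The larger of the closeness constant 36 and the slope constant 36 * 34. *)
Definition K0 : R := locked (36 * 34).

Lemma K0E : K0 = 36 * 34.
Proof. by rewrite /K0 -lock. Qed.

Lemma K0_ge36 : 36 <= K0.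
Proof. rewrite K0E; lra. Qed.

Lemma dyadic_mean_close m x t : continuous x -> 0 <= t <= T ->
  `|dyadic_mean m x t - x t| <= K0 * osc_size m x t /\
  `|dyadic_mean m.+1 x t - x t| <= K0 * osc_size m x t.
Proof.
move=> cx tI; have e0 := eps_gt0 m; have o0 := osc_size_ge0 m x t.
have K36 : 36 * osc_size m x t <= K0 * osc_size m x t by rewrite ler_wpM2r// K0_ge36.
split; apply: le_trans K36; apply: smooth_close => //; rewrite ?eps_le// ?epsS; lra.
Qed.

Lemma dyadic_mean_slope m x t s : continuous x -> 0 <= t <= T -> 0 <= s <= T ->
  `|t - s| <= eps m ->
  `|dyadic_mean m x t - dyadic_mean m x s| <= K0 * (`|t - s| / eps m) * osc_size m x s /\
  `|dyadic_mean m.+1 x t - dyadic_mean m.+1 x s| <= K0 * (`|t - s| / eps m) * osc_size m x s.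
Proof.
move=> cx tI sI ts; have e0 := eps_gt0 m.
by rewrite K0E; split; apply: smooth_slope => //; rewrite ?eps_le// ?epsS; lra.
Qed.

Lemma dyadic_mean_0 x t s : 0 <= t <= T -> 0 <= s <= T -> dyadic_mean 0 x t = dyadic_mean 0 x s.
Proof. by move=> tI sI; rewrite /dyadic_mean /eps expr0 divr1; exact: smooth_T_const. Qed.

(** With P_m the mean at scale m, this sum of P_m x * (P_(m+1) y - P_m y) stands
    for the integral of x against y: y is differentiated scale by scale and x is
    only seen at coarser scales. *)
Definition paraproduct N x y t : R :=
  \sum_(0 <= m < N) dyadic_mean m x t * (dyadic_mean m.+1 y t - dyadic_mean m y t).

Definition area_defect N x y s t : R :=
  paraproduct N x y t - paraproduct N x y s - x s * (dyadic_mean N y t - dyadic_mean N y s).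

(** The increment of the smoothed y telescopes, because the mean at scale 0 is
    constant. *)
Lemma area_defectE N x y s t : 0 <= t <= T -> 0 <= s <= T ->
  area_defect N x y s t =
  \sum_(0 <= m < N) ((dyadic_mean m x t - x s) * (dyadic_mean m.+1 y t - dyadic_mean m y t) -
                     (dyadic_mean m x s - x s) * (dyadic_mean m.+1 y s - dyadic_mean m y s)).
Proof.
move=> tI sI; rewrite /area_defect /paraproduct.
have E := dyadic_mean_0 y tI sI.
have -> : dyadic_mean N y t - dyadic_mean N y s =
   (dyadic_mean N y t - dyadic_mean 0 y t) - (dyadic_mean N y s - dyadic_mean 0 y s).
  by rewrite E; move: (dyadic_mean N y t) (dyadic_mean N y s) (dyadic_mean 0 y s) => a b c; ring.
rewrite -(@telescope_sumr _ 0 N (fun m => dyadic_mean m y t))//.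
rewrite -(@telescope_sumr _ 0 N (fun m => dyadic_mean m y s))// -!sumrB mulr_sumr -sumrB.
apply: eq_bigr => m _.
move: (dyadic_mean m x t) (dyadic_mean m x s) (dyadic_mean m.+1 y t) (dyadic_mean m.+1 y s) (dyadic_mean m y t) (dyadic_mean m y s).
by move=> a b c d e f; ring.
Qed.

Definition oscs m x y s t : R :=
  osc_size m x s ^+ 2 + osc_size m x t ^+ 2 +
  (osc_size m y s ^+ 2 + osc_size m y t ^+ 2).

Lemma oscs_ge0 m x y s t : 0 <= oscs m x y s t.
Proof. by rewrite !addr_ge0// sqr_ge0. Qed.

Lemma area_defect_le N x y j s t : continuous x -> continuous y ->
  0 <= t <= T -> 0 <= s <= T -> `|t - s| <= eps j -> (j < N)%N ->
  `|area_defect N x y s t| <=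
  8 * K0 ^+ 2 * (`|x t - x s| ^+ 2 +
     \sum_(0 <= m < N.+1) kappa m j * oscs m x y s t).
Proof.
move=> cx cy tI sI ts jN; rewrite area_defectE//.
have K36 := K0_ge36.
have tsm m : (m <= j)%N -> `|t - s| <= eps m.
  move=> mj; apply: (le_trans ts); rewrite /eps ler_pM2l// lef_pV2 ?posrE ?exprn_gt0//.
  by rewrite ler_weXn2l// ler1n.
have rk m : (m <= j)%N -> `|t - s| / eps m <= kappa m j.
  move=> mj; have em := eps_gt0 m.
  rewrite kappa_le// ler_pdivrMr//; apply: (le_trans ts).
  rewrite /eps le_eqVlt; apply/orP; left; apply/eqP; field.
  by rewrite !expf_neq0.
have slope m z (c : R) : (m <= j)%N -> c <= K0 * (`|t - s| / eps m) * osc_size m z s ->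
    c <= K0 * kappa m j * osc_size m z s.
  move=> mj /le_trans; apply; rewrite ler_wpM2r ?osc_size_ge0// ler_wpM2l ?rk//.
  by apply: le_trans K36.
apply: (@paraproduct_defect_le _ (fun m => dyadic_mean m x s) (fun m => dyadic_mean m x t)
  (fun m => dyadic_mean m y s) (fun m => dyadic_mean m y t)
  (fun m => osc_size m x s) (fun m => osc_size m x t)
  (fun m => osc_size m y s) (fun m => osc_size m y t)
  (x s) (x t) (y s) (y t) K0 j N).
- by apply: le_trans K36; lra.
- by move=> m; exact: osc_size_ge0.
- by move=> m; exact: osc_size_ge0.
- by move=> m; exact: osc_size_ge0.
- by move=> m; exact: osc_size_ge0.
- exact: (fun m => (dyadic_mean_close m cx sI).1).
- exact: (fun m => (dyadic_mean_close m cx tI).1).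
- exact: (fun m => (dyadic_mean_close m cy sI).1).
- exact: (fun m => (dyadic_mean_close m cy sI).2).
- exact: (fun m => (dyadic_mean_close m cy tI).1).
- exact: (fun m => (dyadic_mean_close m cy tI).2).
- exact: (fun m mj => slope m x _ mj (dyadic_mean_slope cx tI sI (tsm m mj)).1).
- exact: (fun m mj => slope m y _ mj (dyadic_mean_slope cy tI sI (tsm m mj)).1).
- exact: (fun m mj => slope m y _ mj (dyadic_mean_slope cy tI sI (tsm m mj)).2).
- exact: jN.
Qed.

End Scales.

Section IntegralBounds.
Context d (U : measurableType d) {R : realType} (mu : {measure set U -> \bar R}).
Variables (D : set U) (mD : measurable D).
Implicit Types (f g : U -> R) (a b k : R).

Lemma integral_le_mono f g a : (forall u, D u -> 0 <= f u) ->
  (forall u, D u -> f u <= g u) ->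
  (\int[mu]_(u in D) (g u)%:E <= a%:E -> \int[mu]_(u in D) (f u)%:E <= a%:E)%E.
Proof.
move=> f0 fg; apply: le_trans; apply: ge0_le_integral_nonmeas => u Du;
  rewrite lee_fin; [exact: f0|exact: fg].
Qed.

Lemma integral_le_add f g a b :
  measurable_fun D f -> measurable_fun D g ->
  (forall u, D u -> 0 <= f u) -> (forall u, D u -> 0 <= g u) ->
  (\int[mu]_(u in D) (f u)%:E <= a%:E -> \int[mu]_(u in D) (g u)%:E <= b%:E ->
   \int[mu]_(u in D) (f u + g u)%:E <= (a + b)%:E)%E.
Proof.
move=> mf mg f0 g0 fa gb; under eq_integral do rewrite EFinD.
by rewrite ge0_integralD//; [rewrite EFinD leeD|exact/measurable_EFinP|exact/measurable_EFinP].
Qed.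

Lemma integral_le_scale f k a : measurable_fun D f -> 0 <= k ->
  (forall u, D u -> 0 <= f u) ->
  (\int[mu]_(u in D) (f u)%:E <= a%:E ->
   \int[mu]_(u in D) (k * f u)%:E <= (k * a)%:E)%E.
Proof.
move=> mf k0 f0 fa; under eq_integral do rewrite EFinM.
rewrite ge0_integralZl_EFin//; last exact/measurable_EFinP.
by rewrite EFinM lee_wpmul2l// lee_fin.
Qed.

Lemma integral_le_sum (I : Type) (s : seq I) (f : I -> U -> R) (a : I -> R) :
  (forall i, measurable_fun D (f i)) -> (forall i u, D u -> 0 <= f i u) ->
  (forall i, \int[mu]_(u in D) (f i u)%:E <= (a i)%:E)%E ->
  (\int[mu]_(u in D) (\sum_(i <- s) f i u)%:E <= (\sum_(i <- s) a i)%:E)%E.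
Proof.
move=> mf f0 fa; elim: s => [|i s IH].
  under eq_integral do rewrite big_nil; rewrite big_nil.
  by rewrite integral0.
rewrite big_cons; under eq_integral do rewrite big_cons.
apply: integral_le_add => //; first exact: measurable_sum.
- by move=> u Du; apply: f0.
- by move=> u Du; apply: sumr_ge0 => j _; exact: f0.
Qed.

End IntegralBounds.

(** * Oscillation at all scales against the Sobolev seminorm *)

Section SobolevSums.
Context {R : realType}.
Variables (T alpha p : R).
Hypotheses (T0 : 0 < T) (p1 : 1 <= p) (a0 : 0 < alpha).
Local Notation mu := (@lebesgue_measure R).
Local Notation w := (sob_weight alpha p).
Local Notation Q := (`[0%R, T]%classic `*` `[0%R, T]%classic : set (R * R)).
Implicit Types (x y : R -> R) (u : R * R) (m j N : nat).

Let r := alpha * p + 1.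
Let r0 : 0 < r.
Proof. by rewrite ltr_wpDl// mulr_ge0// ltW// (lt_le_trans _ p1). Qed.

Definition sobint (D : R * R -> R) : \bar R :=
  (\int[mu \x mu]_(u in Q) (D u * w u)%:E)%E.

Lemma measurable_square : measurable Q.
Proof. by apply: measurableX; exact: measurable_itv. Qed.

Lemma sob_weight_ge0 u : 0 <= w u.
Proof. by rewrite invr_ge0 powR_ge0. Qed.

Lemma measurable_sob_weight : measurable_fun setT w.
Proof.
have -> : w = (fun z : R => z `^ (- r)) \o (fun u : R * R => `|u.2 - u.1|).
  by apply/funext => u; rewrite /= powRN.
apply: (measurableT_comp (measurable_powR _)).
apply: (measurableT_comp (@normr_measurable R setT)).
by apply: (@measurable_incr _ (fun z => z)) => ?.
Qed.

Lemma sum_geo_cut (L B : R) (P : pred nat) N : 1 < L -> 0 <= B ->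
  (forall m, P m -> L ^+ m <= B) ->
  \sum_(0 <= m < N | P m) L ^+ m <= L / (L - 1) * B.
Proof.
move=> L1 B0 PB; have L0 : 0 <= L by exact/ltW/(lt_trans _ L1).
have L10 : 0 < L - 1 by rewrite subr_gt0.
have geo n : \sum_(0 <= m < n) L ^+ m <= L ^+ n / (L - 1).
  elim: n => [|n IH]; first by rewrite big_nil divr_ge0 ?exprn_ge0// ltW.
  rewrite big_nat_recr//=; apply: (le_trans (lerD IH (lexx _))).
  by rewrite exprS le_eqVlt; apply/orP; left; apply/eqP; field; rewrite gt_eqF.
elim: N => [|N IH].
  by rewrite big_nil mulr_ge0// divr_ge0// ltW.
rewrite big_mkcond big_nat_recr//= -big_mkcond/=.
case: ifPn => PN; last by rewrite addr0.
apply: (@le_trans _ _ (\sum_(0 <= m < N.+1) L ^+ m)).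
  rewrite big_nat_recr//= lerD2r big_mkcond/=; apply: ler_sum => m _.
  by case: ifP => // _; exact: exprn_ge0.
apply: (le_trans (geo _)); rewrite exprS mulrAC ler_wpM2l ?PB//.
by rewrite divr_ge0// ltW.
Qed.

(** Factor by which the weight grows when a distance is halved. *)
Definition weight_ratio : R := 2 `^ r.

Lemma weight_ratio_gt1 : 1 < weight_ratio.
Proof.
have := @gt0_ltr_powR R r r0 1 2; rewrite powR1; apply; rewrite ?nnegrE//.
by rewrite ltr1n.
Qed.

Lemma weight_ratio_ge0 : 0 <= weight_ratio.
Proof. exact: powR_ge0. Qed.

Lemma weight_ratio_exp m : weight_ratio ^+ m = (2 ^+ m) `^ r.
Proof.
rewrite -(@powR_mulrn _ weight_ratio m weight_ratio_ge0) -(@powR_mulrn _ 2 m (ler0n _ 2)).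
exact: powRAC.
Qed.

Definition C1 : R := weight_ratio / (weight_ratio - 1) * (4 * T) `^ r.

Lemma C1_ge0 : 0 <= C1.
Proof.
have L1 := weight_ratio_gt1.
by rewrite mulr_ge0 ?powR_ge0// divr_ge0//; lra.
Qed.

(** At a given distance the geometric sum over the scales is dominated by a
    multiple of its last term, which is comparable to the weight. *)
Lemma sum_osc_power_le x N u :
  \sum_(0 <= m < N) weight_ratio ^+ m * osc_power T p (4 * eps T m) x u <=
  C1 * (`|x u.2 - x u.1| `^ p * w u).
Proof.
have p0 : p != 0 by rewrite gt_eqF// (lt_le_trans _ p1).
have R0 : 0 <= C1 * (`|x u.2 - x u.1| `^ p * w u).
  apply: mulr_ge0; first exact: C1_ge0.
  by rewrite mulr_ge0 ?powR_ge0// sob_weight_ge0.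
have [u12|u12] := eqVneq u.2 u.1.
  rewrite big1// => m _.
  by rewrite /osc_power u12 subrr normr0 powR0// !mulr0.
set h := `|u.2 - u.1|; have h0 : 0 < h by rewrite normr_gt0 subr_eq0.
under eq_bigr do rewrite /osc_power mulrA.
rewrite -mulr_suml mulrCA -[leLHS]mulrC ler_wpM2l ?powR_ge0//.
apply: (@le_trans _ _ (\sum_(0 <= m < N | h <= 4 * eps T m) weight_ratio ^+ m)).
  rewrite [leRHS]big_mkcond/=; apply: ler_sum => m _.
  rewrite indicE; case: (boolP (u \in _)) => [|_]; last first.
    by rewrite mulr0; case: ifP => // _; rewrite exprn_ge0// weight_ratio_ge0.
  by rewrite inE => -[_ _ ->]; rewrite mulr1.
rewrite /C1 -[leRHS]mulrA; apply: sum_geo_cut; first exact: weight_ratio_gt1.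
  by rewrite mulr_ge0 ?powR_ge0// sob_weight_ge0.
move=> m; rewrite /eps mulrA ler_pdivlMr ?exprn_gt0// => hm.
rewrite weight_ratio_exp /sob_weight -/h -/r ler_pdivlMr ?powR_gt0// -powRM// ?(ltW h0)//.
by apply: ge0_ler_powR2; [exact: ltW|rewrite mulr_ge0// ltW|rewrite mulrC].
Qed.

Definition incr_power x u : R := `|x u.2 - x u.1| `^ p.

Lemma measurable_incr_power x : continuous x -> measurable_fun setT (incr_power x).
Proof.
move=> cx; apply: (measurableT_comp (measurable_powR p)).
by apply: (measurableT_comp (@normr_measurable R setT)); exact: measurable_incr.
Qed.

Lemma osc_power_out c x u : ~ Q u -> osc_power T p c x u = 0.
Proof.
move=> uQ; rewrite /osc_power indicE memNset ?mul0r// => -[u1 u2 _].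
by apply: uQ; split; rewrite /= in_itv.
Qed.

Lemma integral_sum_osc_le x N S : continuous x ->
  (sobint (incr_power x) <= S%:E ->
   \int[mu \x mu]_u (\sum_(0 <= m < N) weight_ratio ^+ m * osc_power T p (4 * eps T m) x u)%:E
   <= (C1 * S)%:E)%E.
Proof.
move=> cx xS.
apply: (@le_trans _ _ (\int[mu \x mu]_(u in Q) (C1 * (incr_power x u * w u))%:E)%E);
  last first.
  apply: integral_le_scale => //.
  - exact: measurable_square.
  - apply: measurable_funM; apply: measurable_funTS;
      [exact: measurable_incr_power|exact: measurable_sob_weight].
  - exact: C1_ge0.
  - by move=> u _; rewrite mulr_ge0 ?powR_ge0// sob_weight_ge0.
have L0 := weight_ratio_ge0.
rewrite [leRHS]integral_mkcond; apply: ge0_le_integral_nonmeas => u _.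
  by rewrite lee_fin sumr_ge0// => m _; rewrite mulr_ge0 ?exprn_ge0 ?osc_power_ge0.
rewrite patchE; case: ifPn => uQ; first by rewrite lee_fin; exact: sum_osc_power_le.
rewrite notin_setE in uQ.
by rewrite big1// => m _; rewrite osc_power_out ?mulr0.
Qed.

Definition total_osc m x : R :=
  fine (\int[mu \x mu]_u (osc_power T p (4 * eps T m) x u)%:E)%E.

Lemma total_osc_ge0 m x : 0 <= total_osc m x.
Proof.
by rewrite fine_ge0// integral_ge0// => u _; rewrite lee_fin osc_power_ge0.
Qed.

Lemma total_oscE m x S : continuous x -> (sobint (incr_power x) <= S%:E)%E ->
  (\int[mu \x mu]_u (osc_power T p (4 * eps T m) x u)%:E = (total_osc m x)%:E)%E.
Proof.
move=> cx xS; rewrite fineK// ge0_fin_numE; last first.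
  by apply: integral_ge0 => u _; rewrite lee_fin osc_power_ge0.
have L1 := weight_ratio_gt1; have Lm : 1 <= weight_ratio ^+ m by rewrite exprn_ege1// ltW.
have := @integral_sum_osc_le x m.+1 S cx xS.
move=> H; apply: (@le_lt_trans _ _ (C1 * S)%:E); last exact: ltry.
apply: integral_le_mono H => u _; first exact: osc_power_ge0.
rewrite big_nat_recr//= -[leLHS]add0r lerD//.
  by rewrite sumr_ge0// => k _; rewrite mulr_ge0 ?exprn_ge0 ?osc_power_ge0// weight_ratio_ge0.
by rewrite ler_peMl// osc_power_ge0.
Qed.

Lemma sum_total_osc_le x N S : continuous x -> (sobint (incr_power x) <= S%:E)%E ->
  \sum_(0 <= m < N) weight_ratio ^+ m * total_osc m x <= C1 * S.
Proof.
move=> cx xS; rewrite -lee_fin; apply: le_trans (@integral_sum_osc_le x N S cx xS).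
have L0 := weight_ratio_ge0.
under eq_integral do rewrite -sumEFin.
rewrite ge0_integral_sum//; last 2 first.
- move=> m; apply/measurable_EFinP; apply: measurable_funM => //.
  exact: measurable_osc_power.
- by move=> m u _; rewrite lee_fin mulr_ge0 ?exprn_ge0 ?osc_power_ge0.
rewrite -sumEFin; apply: lee_sum => m _.
under eq_integral do rewrite EFinM.
rewrite ge0_integralZl_EFin ?exprn_ge0//; last 2 first.
- by move=> u _; rewrite lee_fin osc_power_ge0.
- by apply/measurable_EFinP; exact: measurable_osc_power.
by rewrite (@total_oscE _ _ S).
Qed.

End SobolevSums.

Section StripIntegrals.
Context {R : realType}.
Variable (T : R).
Local Notation mu := (@lebesgue_measure R).
Implicit Types (F : R -> R) (c V : R).

Lemma integral_window s c : 0 <= c ->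
  (\int[mu]_u (\1_(`[s - c, s + c]%classic) u)%:E = (2 * c)%:E)%E.
Proof.
move=> c0; rewrite integral_indic//= setIT lebesgue_measure_itv/= lte_fin.
case: ifPn => [_|]; first by rewrite -EFinB; congr (_%:E); lra.
by rewrite -leNgt => cs; congr (_%:E); lra.
Qed.

Lemma measurable_strip_fun c (h : R * R -> R) : measurable_fun setT h ->
  measurable_fun setT (fun u : R * R => \1_(strip T c) u * h u).
Proof.
move=> mh; apply: measurable_funM => //.
by apply: measurable_indic; exact: measurable_strip.
Qed.

Lemma strip_slice_le F c s : 0 <= c -> 0 <= F s ->
  (\int[mu]_t (\1_(strip T c) (s, t) * F s)%:E <= (2 * c * F s)%:E)%E /\
  (\int[mu]_t (\1_(strip T c) (t, s) * F s)%:E <= (2 * c * F s)%:E)%E.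
Proof.
move=> c0 Fs.
have H : (\int[mu]_u (F s * \1_(`[s - c, s + c]%classic) u)%:E <= (2 * c * F s)%:E)%E.
  under eq_integral do rewrite EFinM.
  rewrite ge0_integralZl_EFin//; last first.
    by apply/measurable_EFinP; apply: measurable_indic; exact: measurable_itv.
  by rewrite integral_window// -EFinM mulrC.
have le (A : bool) t : (A -> `|t - s| <= c) ->
    (A%:R : R) * F s <= F s * \1_(`[s - c, s + c]%classic) t.
  rewrite indicE => AH; case: A AH => [/(_ isT)|_]; last by rewrite mul0r mulr_ge0.
  rewrite ler_norml => /andP[? ?]; rewrite mem_set ?mul1r ?mulr1//=.
  by rewrite in_itv/=; lra.
split; apply: integral_le_mono H => t _; rewrite ?mulr_ge0// indicE; apply: le.
  by rewrite inE => -[].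
by rewrite inE => -[/= _ _]; rewrite distrC.
Qed.

Lemma strip_integral1 F c V : 0 <= c -> measurable_fun setT F ->
  (forall s, 0 <= F s) -> (\int[mu]_s (F s)%:E <= V%:E)%E ->
  (\int[mu \x mu]_u (\1_(strip T c) u * F u.1)%:E <= (2 * c * V)%:E)%E.
Proof.
move=> c0 mF F0 FV.
have m1 : measurable_fun setT (fun u : R * R => F u.1).
  exact: (measurableT_comp mF measurable_fst).
rewrite fubini_tonelli1; last 2 first.
- by apply/measurable_EFinP; exact: measurable_strip_fun.
- by move=> u; rewrite lee_fin mulr_ge0.
apply: (@le_trans _ _ (\int[mu]_s (2 * c * F s)%:E)%E); last first.
  by apply: integral_le_scale => //; rewrite mulr_ge0.
apply: ge0_le_integral_nonmeas => s _.
  by apply: integral_ge0 => t _; rewrite lee_fin mulr_ge0.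
by have [] := strip_slice_le c0 (F0 s).
Qed.

Lemma strip_integral2 F c V : 0 <= c -> measurable_fun setT F ->
  (forall s, 0 <= F s) -> (\int[mu]_s (F s)%:E <= V%:E)%E ->
  (\int[mu \x mu]_u (\1_(strip T c) u * F u.2)%:E <= (2 * c * V)%:E)%E.
Proof.
move=> c0 mF F0 FV.
have m2 : measurable_fun setT (fun u : R * R => F u.2).
  exact: (measurableT_comp mF measurable_snd).
rewrite fubini_tonelli2; last 2 first.
- by apply/measurable_EFinP; exact: measurable_strip_fun.
- by move=> u; rewrite lee_fin mulr_ge0.
apply: (@le_trans _ _ (\int[mu]_s (2 * c * F s)%:E)%E); last first.
  by apply: integral_le_scale => //; rewrite mulr_ge0.
apply: ge0_le_integral_nonmeas => s _.
  by apply: integral_ge0 => t _; rewrite lee_fin mulr_ge0.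
by have [] := strip_slice_le c0 (F0 s).
Qed.

End StripIntegrals.

(** * Energy of the areas of the paraproduct *)

Section AreaEnergy.
Context {R : realType}.
Variables (T alpha p : R).
Hypotheses (T0 : 0 < T) (p2 : 2 <= p) (a0 : 0 < alpha) (a2 : alpha < 1 / 2).
Local Notation mu := (@lebesgue_measure R).
Implicit Types (x y : R -> R) (u : R * R) (m j N : nat).

Let p1 : 1 <= p. Proof. by move: p2; lra. Qed.
Let q := p / 2.
Let q1 : 1 <= q. Proof. by rewrite /q; move: p2; lra. Qed.
Let q0 : 0 < q. Proof. by rewrite /q; move: p2; lra. Qed.
Local Notation L := (weight_ratio alpha p).

(** Weights for Jensen's inequality across the scales. This value exceeds 1,
    which makes fine scales summable, and is below 2 since alpha < 1 / 2, which
    makes coarse scales summable. *)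
Definition theta : R := 2 `^ (2 * alpha).

Lemma theta_gt1 : 1 < theta.
Proof.
have a20 : 0 < 2 * alpha by rewrite mulr_gt0.
have := @gt0_ltr_powR R _ a20 1 2; rewrite powR1; apply; rewrite ?nnegrE//.
by rewrite ltr1n.
Qed.

Lemma theta_lt2 : theta < 2.
Proof.
rewrite -[ltRHS](@powRr1 _ 2)// /theta /powR (negbTE (_ : (2:R) != 0))//.
rewrite ltr_expR ltr_pM2r; first by move: a2; lra.
by rewrite ln_gt0// ltr1n.
Qed.

Definition geo_ratio : R := Num.max theta^-1 (theta / 2).

Lemma geo_ratio_itv : 0 <= geo_ratio < 1.
Proof.
have t1 := theta_gt1; have t2 := theta_lt2; have t0 : 0 < theta by lra.
rewrite le_max invr_ge0 (ltW t0)/= gt_max invf_lt1// t1/= ltr_pdivrMr//; lra.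
Qed.

Lemma kappa_theta_le m j :
  kappa m j * (theta ^+ j / theta ^+ m) <= geo_ratio ^+ ((m - j) + (j - m)).
Proof.
have t1 := theta_gt1; have t0 : 0 < theta by lra.
have ti : 0 <= theta^-1 by rewrite invr_ge0 ltW.
have th : 0 <= theta / 2 by rewrite divr_ge0// ltW.
have r0 : 0 <= geo_ratio by case/andP: geo_ratio_itv.
have [jm|/ltnW mj] := leqP j m.
  rewrite kappa_ge// mul1r (eqP (_ : (j - m == 0)%N)) ?subn_eq0// addn0.
  rewrite -{1}(subnKC jm) exprD invfM mulrA divff ?mul1r ?expf_neq0 ?gt_eqF//.
  rewrite -exprVn lerXn2r ?nnegrE// /geo_ratio le_max lexx//.
rewrite kappa_le// (eqP (_ : (m - j == 0)%N)) ?subn_eq0// add0n.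
have -> : (2:R) ^+ m / 2 ^+ j * (theta ^+ j / theta ^+ m) = (theta / 2) ^+ (j - m).
  rewrite -{1 2}(subnKC mj) !exprD exprMn exprVn; field.
  by rewrite !expf_neq0 ?gt_eqF.
by rewrite lerXn2r ?nnegrE// /geo_ratio le_max lexx orbT.
Qed.

Definition CA : R := 2 / (1 - geo_ratio).

Lemma CA_gt0 : 0 < CA.
Proof. by case/andP: geo_ratio_itv => _ r1; rewrite divr_gt0// subr_gt0. Qed.

Lemma weight_ratio_theta j : L ^+ j = 2 ^+ j * (theta ^+ j) `^ q.
Proof.
have -> : L = 2 * theta `^ q.
  rewrite /weight_ratio /theta -powRrM (_ : alpha * p + 1 = 1 + 2 * alpha * q); last first.
    by rewrite /q; field.
  by rewrite powRD ?powRr1// pnatr_eq0 implybT.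
rewrite exprMn; congr (_ * _).
have t0 : 0 <= theta by exact: powR_ge0.
rewrite -(powR_mulrn _ (powR_ge0 _ _)) -(powR_mulrn _ t0).
exact: powRAC.
Qed.

Lemma powR_sqr (a : R) : 0 <= a -> (a ^+ 2) `^ q = a `^ p.
Proof.
by move=> a0'; rewrite -powR_mulrn// -powRrM /q; congr (_ `^ _); field.
Qed.

Definition osc4 m x y u : R :=
  osc T p (4 * eps T m) x u.1 + osc T p (4 * eps T m) x u.2 +
  (osc T p (4 * eps T m) y u.1 + osc T p (4 * eps T m) y u.2).

Lemma oscs_powR m x y s t :
  oscs T p m x y s t `^ q <= 4 `^ q * (osc4 m x y (s, t) / eps T m).
Proof.
have e0 := eps_gt0 T0 m.
have E z r : osc T p (4 * eps T m) z r / eps T m = (osc_size T p m z r ^+ 2) `^ q.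
  by rewrite powR_sqr ?osc_size_ge0// (osc_sizeE T0 p1) mulrAC divff ?mul1r// gt_eqF.
have -> : osc4 m x y (s, t) / eps T m =
    (osc_size T p m x s ^+ 2) `^ q + (osc_size T p m x t ^+ 2) `^ q +
    ((osc_size T p m y s ^+ 2) `^ q + (osc_size T p m y t ^+ 2) `^ q).
  by rewrite -(E x s) -(E x t) -(E y s) -(E y t) -!mulrDl.
rewrite /oscs.
have s2 z r := sqr_ge0 (osc_size T p m z r).
have -> : (4 : R) `^ q = 2 `^ q * 2 `^ q.
  by rewrite -powRM//; congr (_ `^ _); ring.
apply: (le_trans (powR_add_le (ltW q0) _ _)); [by rewrite addr_ge0|by rewrite addr_ge0|].
rewrite -mulrA ler_wpM2l ?powR_ge0// mulrDr lerD//.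
  by apply: powR_add_le => //; exact: ltW.
by apply: powR_add_le => //; exact: ltW.
Qed.

Definition C2 : R := (8 * K0 ^+ 2) `^ q * 2 `^ q.

(** Jensen's inequality with the weights kappa m j / theta ^+ m, of total mass at
    most CA / theta ^+ j. *)
Lemma area_defect_powR N x y j s t : continuous x -> continuous y ->
  0 <= t <= T -> 0 <= s <= T -> `|t - s| <= eps T j -> (j < N)%N ->
  `|area_defect T N x y s t| `^ q <=
  C2 * (`|x t - x s| `^ p + (CA / theta ^+ j) `^ (q - 1) *
    \sum_(0 <= m < N.+1) kappa m j / theta ^+ m *
      ((theta ^+ m) `^ q * (4 `^ q * (osc4 m x y (s, t) / eps T m)))).
Proof.
move=> cx cy tI sI ts jN.
have t1 := theta_gt1; have t0 : 0 < theta by lra.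
have tm m : 0 < theta ^+ m by rewrite exprn_gt0.
have k0 m := @kappa_ge0 R m j.
have S0 : 0 <= \sum_(0 <= m < N.+1) kappa m j * oscs T p m x y s t.
  by apply: sumr_ge0 => m _; rewrite mulr_ge0// oscs_ge0.
apply: (le_trans (ge0_ler_powR2 (ltW q0) (normr_ge0 _)
   (area_defect_le T0 p1 cx cy tI sI ts jN))).
rewrite powRM; [|by rewrite mulr_ge0 ?sqr_ge0|by rewrite addr_ge0 ?sqr_ge0].
rewrite /C2 -[leRHS]mulrA ler_wpM2l ?powR_ge0//.
apply: (le_trans (powR_add_le (ltW q0) (sqr_ge0 _) S0)).
rewrite ler_wpM2l ?powR_ge0// powR_sqr// lerD2l.
have -> : \sum_(0 <= m < N.+1) kappa m j * oscs T p m x y s t =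
  \sum_(0 <= m < N.+1) (kappa m j / theta ^+ m) * (theta ^+ m * oscs T p m x y s t).
  by apply: eq_bigr => m _; rewrite mulrA divfK// gt_eqF.
apply: (@le_trans _ _ ((CA / theta ^+ j) `^ (q - 1) *
    \sum_(0 <= m < N.+1) kappa m j / theta ^+ m *
      (theta ^+ m * oscs T p m x y s t) `^ q)).
  apply: jensen_powR => //.
  - by move=> m; rewrite divr_ge0// ltW.
  - by move=> m; rewrite mulr_ge0 ?oscs_ge0// ltW.
  - by rewrite divr_gt0// CA_gt0.
  rewrite ler_pdivlMr// mulr_suml; apply: le_trans (sum_geo_dist j N.+1 geo_ratio_itv).
  apply: ler_sum => m _; apply: le_trans (kappa_theta_le m j).
  by rewrite -mulrA [_^-1 * _]mulrC.
rewrite ler_wpM2l ?powR_ge0//; apply: ler_sum => m _.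
rewrite ler_wpM2l ?divr_ge0 ?(ltW (tm m))// powRM ?oscs_ge0 ?(ltW (tm m))//.
by rewrite ler_wpM2l ?powR_ge0// oscs_powR.
Qed.

Definition coef j m : R :=
  L ^+ j * ((CA / theta ^+ j) `^ (q - 1) * (kappa m j / theta ^+ m * (theta ^+ m) `^ q)).

Lemma coef_ge0 j m : 0 <= coef j m.
Proof.
have t0 : 0 <= theta by exact: powR_ge0.
rewrite mulr_ge0 ?exprn_ge0 ?powR_ge0// mulr_ge0 ?powR_ge0// mulr_ge0 ?powR_ge0//.
by rewrite divr_ge0 ?kappa_ge0 ?exprn_ge0.
Qed.

(** The coefficients decay geometrically away from the diagonal, so their row and
    column sums are bounded: this is what a Schur test needs. *)
Lemma coef_le j m :
  coef j m * (eps T j / eps T m) <=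
  CA `^ (q - 1) * L ^+ m * geo_ratio ^+ ((m - j) + (j - m)).
Proof.
have t1 := theta_gt1; have t0 : 0 < theta by lra.
have tm i : 0 < theta ^+ i by rewrite exprn_gt0.
rewrite /coef !weight_ratio_theta; apply: le_trans (ler_wpM2l _ (kappa_theta_le m j)); last first.
  by rewrite mulr_ge0 ?powR_ge0// mulr_ge0 ?powR_ge0// exprn_ge0.
have -> : (CA / theta ^+ j) `^ (q - 1) = CA `^ (q - 1) / (theta ^+ j) `^ (q - 1).
  rewrite powRM ?invr_ge0 ?(ltW CA_gt0) ?(ltW (tm j))//; congr (_ * _).
  by rewrite -[in LHS](powR_inv1 (ltW (tm j))) powRAC powR_inv1 ?powR_ge0.
rewrite -[(theta ^+ j) `^ q](mulr_powRB1 (ltW (tm j)) q0).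
have P0 : (theta ^+ j) `^ (q - 1) != 0 by rewrite gt_eqF// powR_gt0.
have -> : eps T j / eps T m = 2 ^+ m / 2 ^+ j.
  by rewrite /eps; field; rewrite !expf_neq0// gt_eqF.
rewrite le_eqVlt; apply/orP; left; apply/eqP.
move: (tm m) (tm j) P0 (kappa m j).
move: ((theta ^+ j) `^ (q - 1)) (CA `^ (q - 1)) ((theta ^+ m) `^ q).
move: (theta ^+ j) (theta ^+ m) => E D A B C D0 E0 A0 k; field.
by rewrite A0 !gt_eqF ?exprn_gt0.
Qed.

End AreaEnergy.

Section DyadicEnergy.
Context {R : realType}.
Variables (T alpha p : R).
Hypotheses (T0 : 0 < T) (p2 : 2 <= p) (a0 : 0 < alpha) (a2 : alpha < 1 / 2).
Local Notation mu := (@lebesgue_measure R).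
Implicit Types (x y : R -> R) (u : R * R) (m j N : nat).

Let p1 : 1 <= p. Proof. by move: p2; lra. Qed.
Let p0 : 0 <= p. Proof. by move: p2; lra. Qed.
Let q := p / 2.
Local Notation L := (weight_ratio alpha p).
Local Notation osc_m m x := (osc T p (4 * eps T m) x).

Lemma measurable_osc c x : continuous x -> measurable_fun setT (osc T p c x).
Proof.
move=> cx; apply/measurable_EFinP.
rewrite (_ : _ \o _ = local_osc T p c x); first exact: measurable_local_osc.
by apply/funext => s /=; rewrite oscE.
Qed.

Lemma integral_osc m x S : continuous x ->
  (sobint T alpha p (incr_power p x) <= S%:E)%E ->
  (\int[mu]_s (osc_m m x s)%:E = (total_osc T p m x)%:E)%E.
Proof.
move=> cx xS; rewrite -(total_oscE p1 a0 m cx xS) integral_local_osc//.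
by apply: eq_integral => s _; rewrite oscE.
Qed.

Lemma strip_osc4_le j m x y Sx Sy : continuous x -> continuous y ->
  (sobint T alpha p (incr_power p x) <= Sx%:E)%E ->
  (sobint T alpha p (incr_power p y) <= Sy%:E)%E ->
  (\int[mu \x mu]_u (\1_(strip T (eps T j)) u * osc4 T p m x y u)%:E <=
   (4 * eps T j * (total_osc T p m x + total_osc T p m y))%:E)%E.
Proof.
move=> cx cy xS yS; have e0 := ltW (eps_gt0 T0 j).
have -> : 4 * eps T j * (total_osc T p m x + total_osc T p m y) =
  2 * eps T j * total_osc T p m x + 2 * eps T j * total_osc T p m x +
  (2 * eps T j * total_osc T p m y + 2 * eps T j * total_osc T p m y).
  by move: (total_osc _ _ _ x) (total_osc _ _ _ y) (eps T j) => a b c; ring.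
have M1 z : continuous z -> measurable_fun setT
    (fun u : R * R => \1_(strip T (eps T j)) u * osc_m m z u.1).
  move=> cz; apply: measurable_strip_fun.
  exact: (measurableT_comp (measurable_osc _ cz) measurable_fst).
have M2 z : continuous z -> measurable_fun setT
    (fun u : R * R => \1_(strip T (eps T j)) u * osc_m m z u.2).
  move=> cz; apply: measurable_strip_fun.
  exact: (measurableT_comp (measurable_osc _ cz) measurable_snd).
have G0 (u : R * R) z s : 0 <= \1_(strip T (eps T j)) u * osc_m m z s.
  by rewrite mulr_ge0// osc_ge0.
have I1 z S : continuous z -> (sobint T alpha p (incr_power p z) <= S%:E)%E ->
    (\int[mu \x mu]_u (\1_(strip T (eps T j)) u * osc_m m z u.1)%:E <=
     (2 * eps T j * total_osc T p m z)%:E)%E.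
  move=> cz zS; apply: strip_integral1 => //; first exact: measurable_osc.
    by move=> s; exact: osc_ge0.
  by rewrite (integral_osc m cz zS).
have I2 z S : continuous z -> (sobint T alpha p (incr_power p z) <= S%:E)%E ->
    (\int[mu \x mu]_u (\1_(strip T (eps T j)) u * osc_m m z u.2)%:E <=
     (2 * eps T j * total_osc T p m z)%:E)%E.
  move=> cz zS; apply: strip_integral2 => //; first exact: measurable_osc.
    by move=> s; exact: osc_ge0.
  by rewrite (integral_osc m cz zS).
rewrite /osc4; under eq_integral do rewrite !mulrDr.
apply: integral_le_add => //.
- by apply: measurable_funD; [exact: M1|exact: M2].
- by apply: measurable_funD; [exact: M1|exact: M2].
- by move=> u _; rewrite addr_ge0.
- by move=> u _; rewrite addr_ge0.
- apply: integral_le_add => //; [exact: M1|exact: M2|exact: I1 xS|exact: I2 xS].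
- apply: integral_le_add => //; [exact: M1|exact: M2|exact: I1 yS|exact: I2 yS].
Qed.

(** A discretised weighted energy: the powers of weight_ratio over nested strips
    add up to the singular weight, up to constants. *)
Definition dyadic_energy N x y u : R :=
  \sum_(0 <= j < N) L ^+ j *
    (\1_(strip T (eps T j)) u * `|area_defect T N x y u.1 u.2| `^ q).

Definition CE : R := C2 p * C1 T alpha p.
Definition C3 : R := C2 p * 4 `^ q * 4 * (CA alpha `^ (q - 1) * (CA alpha * C1 T alpha p)).

Lemma C2_ge0 : 0 <= C2 p.
Proof. by rewrite mulr_ge0 ?powR_ge0. Qed.

Lemma osc4_ge0 m x y u : 0 <= osc4 T p m x y u.
Proof. by rewrite /osc4 !addr_ge0// osc_ge0. Qed.

Lemma dyadic_energy_pointwise N x y u : continuous x -> continuous y ->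
  dyadic_energy N x y u <=
  \sum_(0 <= j < N) (C2 p * (L ^+ j * osc_power T p (4 * eps T j) x u) +
    \sum_(0 <= m < N.+1) (C2 p * 4 `^ q * (coef alpha p j m / eps T m)) *
       (\1_(strip T (eps T j)) u * osc4 T p m x y u)).
Proof.
move=> cx cy; rewrite /dyadic_energy big_nat [leRHS]big_nat.
apply: ler_sum => j /andP[_ jN].
have L0 : 0 <= L ^+ j by rewrite exprn_ge0// weight_ratio_ge0.
have e0 m := ltW (eps_gt0 T0 m).
have [uS|uS] := boolP (u \in strip T (eps T j)); last first.
  rewrite indicE (negbTE uS) mul0r mulr0 addr_ge0//.
    by rewrite (mulr_ge0 C2_ge0)// mulr_ge0 ?osc_power_ge0.
  apply: sumr_ge0 => m _; apply: mulr_ge0; last by rewrite mulr_ge0 ?osc4_ge0.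
  apply: mulr_ge0; first exact: (mulr_ge0 C2_ge0 (powR_ge0 _ _)).
  by apply: divr_ge0 => //; exact: coef_ge0.
rewrite indicE uS mul1r.
have [sI tI ts] := set_mem uS.
have := area_defect_powR T0 p2 a0 a2 cx cy tI sI ts jN.
move=> /(ler_wpM2l L0)/le_trans; apply.
have -> : osc_power T p (4 * eps T j) x u = `|x u.2 - x u.1| `^ p.
  rewrite /osc_power indicE mem_set ?mul1r//; split => //.
  by apply: (le_trans ts); rewrite ler_peMl// ler1n.
rewrite le_eqVlt; apply/orP; left; apply/eqP.
rewrite !mulrDr; congr (_ + _); first by rewrite mulrCA.
rewrite !mulr_sumr; apply: eq_bigr => m _; rewrite mul1r /coef -surjective_pairing.
move: (L ^+ j) (C2 p) (_ `^ (q - 1)) (kappa m j / _) (_ `^ q) (4 `^ q) => a b c d e f.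
move: (osc4 _ _ _ _ _ _) ((eps T m)^-1) => g h; ring.
Qed.

(** The bound does not depend on N, by exchanging the sums over the scale of the
    strip and the scale of the oscillation. *)
Lemma dyadic_energy_le N x y Sx Sy : continuous x -> continuous y ->
  (sobint T alpha p (incr_power p x) <= Sx%:E)%E ->
  (sobint T alpha p (incr_power p y) <= Sy%:E)%E ->
  (\int[mu \x mu]_u (dyadic_energy N x y u)%:E <= (CE * Sx + C3 * (Sx + Sy))%:E)%E.
Proof.
move=> cx cy xS yS.
have L0 j : 0 <= L ^+ j by rewrite exprn_ge0// weight_ratio_ge0.
have e0 m := ltW (eps_gt0 T0 m).
have c0 j m : 0 <= C2 p * 4 `^ q * (coef alpha p j m / eps T m).
  apply: mulr_ge0; first exact: (mulr_ge0 C2_ge0 (powR_ge0 _ _)).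
  by apply: divr_ge0 => //; exact: coef_ge0.
have mo m : measurable_fun setT (osc4 T p m x y).
  by apply: measurable_funD; apply: measurable_funD;
    [exact: (measurableT_comp (measurable_osc _ cx) measurable_fst)
    |exact: (measurableT_comp (measurable_osc _ cx) measurable_snd)
    |exact: (measurableT_comp (measurable_osc _ cy) measurable_fst)
    |exact: (measurableT_comp (measurable_osc _ cy) measurable_snd)].
have ms j m : measurable_fun setT
    (fun u => \1_(strip T (eps T j)) u * osc4 T p m x y u).
  exact: measurable_strip_fun.
have s0 j m u : 0 <= \1_(strip T (eps T j)) u * osc4 T p m x y u.
  by rewrite mulr_ge0// osc4_ge0.
have mx j : measurable_fun setT (fun u => L ^+ j * osc_power T p (4 * eps T j) x u).
  by apply: measurable_funM => //; exact: measurable_osc_power.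
pose V m := total_osc T p m x + total_osc T p m y.
apply: (@le_trans _ _ (\sum_(0 <= j < N) (C2 p * (L ^+ j * total_osc T p j x) +
    \sum_(0 <= m < N.+1) (C2 p * 4 `^ q * (coef alpha p j m / eps T m)) *
       (4 * eps T j * V m)))%:E).
  apply: (@integral_le_mono _ _ _ (mu \x mu)%E setT (dyadic_energy N x y)).
  - move=> u _; apply: sumr_ge0 => j _.
    by rewrite mulr_ge0// mulr_ge0 ?powR_ge0.
  - by move=> u _; exact: dyadic_energy_pointwise.
  apply: integral_le_sum => //.
  - move=> j; apply: measurable_funD; first exact: (measurable_funM (measurable_cst _) (mx j)).
    by apply: measurable_sum => m; exact: (measurable_funM (measurable_cst _) (ms j m)).
  - move=> j u _; rewrite addr_ge0//.
      by rewrite (mulr_ge0 C2_ge0)// mulr_ge0 ?osc_power_ge0.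
    by apply: sumr_ge0 => m _; exact: mulr_ge0.
  move=> j; apply: integral_le_add => //.
  - exact: (measurable_funM (measurable_cst _) (mx j)).
  - by apply: measurable_sum => m; exact: (measurable_funM (measurable_cst _) (ms j m)).
  - by move=> u _; rewrite (mulr_ge0 C2_ge0)// mulr_ge0 ?osc_power_ge0.
  - by move=> u _; apply: sumr_ge0 => m _; exact: mulr_ge0.
  - apply: integral_le_scale; [exact: measurableT|exact: mx|exact: C2_ge0| |].
      by move=> u _; rewrite mulr_ge0 ?osc_power_ge0.
    apply: integral_le_scale; [exact: measurableT| |exact: L0| |].
    + exact: measurable_osc_power.
    + by move=> u _; exact: osc_power_ge0.
    by rewrite (total_oscE p1 a0 j cx xS).
  - apply: integral_le_sum => //.
    + by move=> m; exact: (measurable_funM (measurable_cst _) (ms j m)).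
    + by move=> m u _; exact: mulr_ge0.
    move=> m; apply: integral_le_scale; [exact: measurableT|exact: ms|exact: c0| |].
      by move=> u _; exact: s0.
    exact: strip_osc4_le xS yS.
rewrite lee_fin big_split/=; apply: lerD.
  rewrite -mulr_sumr /CE -mulrA ler_wpM2l ?C2_ge0//.
  exact: sum_total_osc_le.
rewrite exchange_big/=.
have V0 m : 0 <= V m by rewrite addr_ge0// total_osc_ge0.
have CA0 := ltW (CA_gt0 a0 a2).
have cc : 0 <= C2 p * 4 `^ q * 4.
  by apply: mulr_ge0 => //; exact: (mulr_ge0 C2_ge0 (powR_ge0 _ _)).
rewrite /C3 -mulrA.
apply: (@le_trans _ _ (\sum_(0 <= m < N.+1) C2 p * 4 `^ q * 4 *
    (CA alpha `^ (q - 1) * (L ^+ m * V m * CA alpha)))).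
  apply: ler_sum => m _.
  apply: (@le_trans _ _ (\sum_(0 <= j < N) (C2 p * 4 `^ q * 4) *
     (CA alpha `^ (q - 1) * (L ^+ m * V m * geo_ratio alpha ^+ ((j - m) + (m - j)))))).
    apply: ler_sum => j _.
    have -> : C2 p * 4 `^ q * (coef alpha p j m / eps T m) * (4 * eps T j * V m) =
      C2 p * 4 `^ q * 4 * (coef alpha p j m * (eps T j / eps T m) * V m).
      move: (C2 p) (4 `^ q) (coef _ _ _ _) ((eps T m)^-1) (eps T j) (V m).
      by move=> a b c d e f; ring.
    rewrite ler_wpM2l//; apply: (le_trans (ler_wpM2r (V0 m) (coef_le T0 p2 a0 a2 j m))).
    rewrite addnC le_eqVlt; apply/orP; left; apply/eqP.
    move: (CA _ `^ _) (L ^+ m) (_ ^+ _) (V m) => a b c d; ring.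
  rewrite -!mulr_sumr ler_wpM2l// ler_wpM2l ?powR_ge0// ler_wpM2l ?mulr_ge0//.
  exact: (sum_geo_dist m N (geo_ratio_itv a0 a2)).
rewrite -!mulr_sumr ler_wpM2l// -[leRHS]mulrA ler_wpM2l ?powR_ge0//.
rewrite -mulr_suml mulrC -[leRHS]mulrA ler_wpM2l//.
under eq_bigr do rewrite mulrDr.
rewrite big_split/= mulrDr lerD//; exact: sum_total_osc_le.
Qed.

End DyadicEnergy.

(** * Limits of the paraproducts *)

Section Limits.
Context {R : realType}.
Implicit Types (f : nat -> R -> R) (T t s : R).

Lemma locally_lipschitz_continuous (g : R -> R) :
  (forall s, exists C d : R, 0 < d /\
     forall t, `|t - s| <= d -> `|g t - g s| <= C * `|t - s|) ->
  continuous g.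
Proof.
move=> gl s; have [C [d [d0 gC]]] := gl s; apply/cvgrPdist_le => e e0.
have C1 : 0 < `|C| + 1 by rewrite ltr_wpDl.
near=> v; rewrite distrC; apply: (le_trans (gC v _)).
  by near: v; apply/nbhs_ballP; exists d => // v /= /ltW; rewrite distrC.
apply: (@le_trans _ _ ((`|C| + 1) * `|v - s|)).
  by rewrite ler_wpM2r//; apply: (le_trans (ler_norm _)); rewrite lerDl.
rewrite mulrC -ler_pdivlMr//; near: v.
apply/nbhs_ballP; exists (e / (`|C| + 1)); first exact: divr_gt0.
by move=> v /= /ltW; rewrite distrC.
Unshelve. all: by end_near. Qed.

(** The nearest point of [0, T]. *)
Definition clamp T t : R := Num.max 0 (Num.min t T).

Lemma clamp_itv T t : 0 <= T -> 0 <= clamp T t <= T.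
Proof.
move=> T0; rewrite /clamp le_max lexx/= ge_max T0/=.
by rewrite ge_min lexx orbT.
Qed.

Lemma clamp_id T t : 0 <= t <= T -> clamp T t = t.
Proof. by move=> /andP[t0 tT]; rewrite /clamp min_l// max_r. Qed.

Lemma clamp_lip T t s : 0 <= T -> `|clamp T t - clamp T s| <= `|t - s|.
Proof.
move=> T0; have := ler_norm (t - s); have := ler_norm (s - t); rewrite (distrC s).
move: `|t - s| => d d1 d2; rewrite ler_norml /clamp.
by rewrite /Num.min /Num.max; repeat case: ifPn; rewrite -?leNgt => *; lra.
Qed.

Lemma clamp_continuous T : 0 <= T -> continuous (clamp T).
Proof.
move=> T0; apply: (@lipschitz_continuous _ _ 1) => u v.
by rewrite mul1r clamp_lip.
Qed.

(** The increments sum to a uniform bound, so the limit is uniform. *)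
Lemma geometric_limit f (A rho : R) : 0 <= A -> 0 < rho < 1 ->
  (forall N, continuous (f N)) ->
  (forall N t, `|f N.+1 t - f N t| <= A * rho ^+ N) ->
  exists g : R -> R, continuous g /\ forall t, f N t @[N --> \oo] --> g t.
Proof.
move=> A0 /andP[r0 r1] cf fA.
have r10 : 0 < 1 - rho by rewrite subr_gt0.
have key N n t : `|f (N + n)%N t - f N t| <= A / (1 - rho) * (rho ^+ N - rho ^+ (N + n)).
  elim: n => [|n IH]; first by rewrite addn0 !subrr normr0 mulr0.
  rewrite addnS -(subrKA (f (N + n)%N t)) addrC.
  apply: (le_trans (ler_normD _ _)); apply: (le_trans (lerD IH (fA _ _))).
  rewrite le_eqVlt; apply/orP; left; apply/eqP.
  by rewrite (exprS _ (N + n)); field; rewrite gt_eqF.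
have key2 N n t : (N <= n)%N -> `|f n t - f N t| <= A / (1 - rho) * rho ^+ N.
  move=> /subnKC <-; apply: (le_trans (key _ _ _)).
  by rewrite ler_wpM2l ?divr_ge0 ?(ltW r10)// lerBlDr lerDl exprn_ge0// ltW.
have rn : A / (1 - rho) * rho ^+ N @[N --> \oo] --> 0.
  rewrite -[0](mulr0 (A / (1 - rho))); apply: cvgMr; apply: cvg_expr.
  by rewrite ger0_norm// ltW.
have cv t : cvgn (fun N => f N t).
  apply/cauchy_cvgP/cauchy_ballP => e e0; near_simpl.
  have e2 : 0 < e / 2 by rewrite divr_gt0.
  have [M _ HM] : \forall N \near \oo, A / (1 - rho) * rho ^+ N < e / 2.
    by apply: cvgr_lt rn _ e2.
  near=> n m => /=; rewrite /ball/=.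
  have -> : f n t - f m t = (f n t - f M t) - (f m t - f M t) by ring.
  apply: (le_lt_trans (ler_normB _ _)); rewrite [ltRHS]splitr.
  apply: ltr_leD; last apply/ltW.
    apply: le_lt_trans (key2 M n t _) (HM M (leqnn _)).
    by near: n; exists M.
  apply: le_lt_trans (key2 M m t _) (HM M (leqnn _)).
  by near: m; exists M.
exists (fun t => limn (fun N => f N t)).
have bd N t : `|limn (fun N => f N t) - f N t| <= A / (1 - rho) * rho ^+ N.
  apply: (@closed_cvg _ _ \oo _ (fun n => `|f n t - f N t|) (fun z => z <= _)).
  - exact: closed_le.
  - by exists N => // n /= /key2.
  - apply: (@cvg_norm _ _ _ _ _ (fun n => f n t - f N t)).
    apply: cvgB; [exact: cv|exact: cvg_cst].
split => // s; apply/cvgrPdist_lt => e e0.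
have e3 : 0 < e / 3 by rewrite divr_gt0.
have [M _ HM] : \forall N \near \oo, A / (1 - rho) * rho ^+ N < e / 3.
  by apply: cvgr_lt rn _ e3.
have HMM := HM M (leqnn _).
near=> t.
have -> : limn (fun N => f N s) - limn (fun N => f N t) =
  (limn (fun N => f N s) - f M s) + (f M s - f M t) - (limn (fun N => f N t) - f M t) by ring.
have B : `|f M s - f M t| < e / 3.
  near: t; exact: (cvgr_dist_lt _ _ (cf M s)).
have := le_lt_trans (bd M s) HMM; have := le_lt_trans (bd M t) HMM.
have := ler_normB (limn (fun N => f N s) - f M s + (f M s - f M t))
  (limn (fun N => f N t) - f M t).
have := ler_normD (limn (fun N => f N s) - f M s) (f M s - f M t).
move: B; move: `|_| `|_| `|_| `|_| `|_| => a b c d h; lra.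
Unshelve. all: by end_near. Qed.

Lemma le_limn_einf (a : R) (an : nat -> R) (b : nat -> \bar R) :
  an @ \oo --> a -> (\forall n \near \oo, ((an n)%:E <= b n)%E) ->
  (a%:E <= limn_einf b)%E.
Proof.
move=> ana [M _ HM]; apply/lee_addgt0Pr => e e0.
have [K _ HK] : \forall n \near \oo, a - e < an n.
  by apply: cvgr_gt ana _ _; rewrite ltrBlDr ltrDl.
rewrite -leeBlDr//; apply: (@le_trans _ _ (einfs b (maxn M K))).
  apply: le_ereal_inf_tmp => _ [k /= kn <-].
  apply: le_trans (HM k _); last exact: leq_trans (leq_maxl _ _) kn.
  by rewrite -EFinB lee_fin ltW// HK//=; exact: leq_trans (leq_maxr _ _) kn.
rewrite limn_einf_lim; have /cvg_lim -> // := @cvg_einfs_sup _ b.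
by apply: ereal_sup_ubound; exists (maxn M K).
Qed.

Lemma integral_limn_einf_le d (U : measurableType d) (mu : {measure set U -> \bar R})
    (D : set U) (mD : measurable D) (F : nat -> U -> \bar R) (a : \bar R) :
  (forall n, measurable_fun D (F n)) -> (forall n u, D u -> (0 <= F n u)%E) ->
  (forall n, \int[mu]_(u in D) F n u <= a)%E ->
  (\int[mu]_(u in D) limn_einf (F^~ u) <= a)%E.
Proof.
move=> mF F0 Fa; apply: (le_trans (fatou mu mD mF F0)); rewrite limn_einf_lim.
have /cvg_lim -> // := @cvg_einfs_sup _ (fun N => (\int[mu]_(u in D) F N u)%E).
apply: ge_ereal_sup => _ [N _ <-]; apply: le_trans (Fa N).
by apply: ereal_inf_lbound; exists N => /=.
Qed.

Lemma powR_cvg (q : R) (f : nat -> R) (l : R) : 0 < l -> f @ \oo --> l ->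
  (fun N => f N `^ q) @ \oo --> l `^ q.
Proof.
move=> l0 fl; have c : {for l, continuous (fun z => z `^ q)}.
  apply: differentiable_continuous; apply/derivable1_diffP; apply: derivable_powR.
  by rewrite in_itv/= l0.
exact: (@cvg_comp _ _ _ f (fun z => z `^ q) _ _ _ fl c).
Qed.

End Limits.

Section SmoothingLimits.
Context {R : realType}.
Variables (T alpha p : R).
Hypotheses (T0 : 0 < T) (p2 : 2 <= p) (a0 : 0 < alpha) (ap : 1 / p < alpha).
Local Notation mu := (@lebesgue_measure R).
Local Notation I f := (\int[mu]_(u in `[0, T]) f u).
Implicit Types (x y : R -> R) (t s : R) (m N : nat).
Local Notation L := (weight_ratio alpha p).

Let p1 : 1 <= p. Proof. by move: p2; lra. Qed.
Let p0 : 0 < p. Proof. by move: p2; lra. Qed.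

Lemma dyadic_mean_clamp_continuous m x : continuous x ->
  continuous (fun t => dyadic_mean T m x (clamp T t)).
Proof.
move=> cx; have e0 := eps_gt0 T0 m; have T00 := ltW T0.
apply: locally_lipschitz_continuous => s.
exists (K0 * osc_size T p m x (clamp T s) / eps T m), (eps T m); split=> // t ts.
have tc := clamp_lip t s T00.
have := (dyadic_mean_slope T0 p1 cx (clamp_itv t T00) (clamp_itv s T00) (le_trans tc ts)).1.
move=> /le_trans; apply.
have -> : K0 * osc_size T p m x (clamp T s) / eps T m * `|t - s| =
  K0 * (`|t - s| / eps T m) * osc_size T p m x (clamp T s).
  move: (osc_size _ _ _ _ _) ((eps T m)^-1) K0 => a b c; ring.
rewrite ler_wpM2r ?osc_size_ge0//.
have K00 : (0 : R) <= K0 by apply: le_trans K0_ge36.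
by rewrite ler_wpM2l// ler_pM2r// invr_gt0.
Qed.

Lemma eps_cvg0 : eps T N @[N --> \oo] --> 0.
Proof.
rewrite -[0](mulr0 T); apply: cvgMr.
under eq_fun do rewrite -exprVn.
by apply: cvg_expr; rewrite ger0_norm// invf_lt1// ltr1n.
Qed.

Lemma dyadic_mean_cvg y t : continuous y -> 0 <= t <= T ->
  dyadic_mean T N y t @[N --> \oo] --> y t.
Proof.
move=> cy tI; apply/cvgrPdist_le => e e0.
have /cvgrPdist_le /(_ e e0) [d /= d0 yd] := cy t.
have d2 : 0 < d / 2 by rewrite divr_gt0.
near=> N.
have eN : eps T N < d / 2 by near: N; exact: (cvgr_lt _ eps_cvg0).
rewrite distrC /dyadic_mean; apply: (smooth_mean_le (eps_le T0 N) cy tI (ltW e0)).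
move=> u uI ut; rewrite distrC; apply: yd; rewrite /= distrC.
by apply: (le_lt_trans ut); rewrite mulrC -ltr_pdivlMr.
Unshelve. all: by end_near. Qed.

Lemma dyadic_mean_bounded m x t M : continuous x -> 0 <= t <= T -> 0 <= M ->
  (forall s, 0 <= s <= T -> `|x s| <= M) -> `|dyadic_mean T m x t| <= M.
Proof.
move=> cx tI M0 xM; rewrite -[dyadic_mean _ _ _ _]subr0.
apply: (smooth_mean_le (eps_le T0 m) cx tI M0) => u uI _.
by rewrite subr0; exact: xM.
Qed.

Definition rho : R := 2 `^ (p^-1 - alpha).

Lemma rho_itv : 0 < rho < 1.
Proof.
rewrite powR_gt0//= /rho -[ltRHS](powRr0 (2:R)).
rewrite /powR (negbTE (_ : (2:R) != 0))// ltr_expR ltr_pM2r ?ln_gt0 ?ltr1n//.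
by rewrite subr_lt0 -div1r.
Qed.

(** The rate is the one for which both halves of Young's inequality have the same
    size when the threshold is rho ^+ m. *)
Lemma rho_balance m :
  (rho ^+ m) `^ (1 - p) / (eps T m ^+ 2 * L ^+ m) = rho ^+ m / T ^+ 2.
Proof.
have r0 : 0 < rho by case/andP: rho_itv.
have L0 : 0 < L by exact: lt_trans (weight_ratio_gt1 p1 a0).
have -> : (rho ^+ m) `^ (1 - p) = (rho `^ (1 - p)) ^+ m.
  by rewrite -(powR_mulrn _ (ltW r0)) -(powR_mulrn _ (powR_ge0 _ _)) powRAC.
have E : rho `^ (1 - p) * 4 = rho * L.
  rewrite /rho /weight_ratio -powRrM -powRD; last by rewrite pnatr_eq0 implybT.
  have -> : (4 : R) = 2 `^ 2.
    by rewrite (@powR_mulrn _ 2 2)//; ring.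
  rewrite -powRD; last by rewrite pnatr_eq0 implybT.
  by congr (_ `^ _); field; rewrite gt_eqF.
have -> : eps T m ^+ 2 * L ^+ m = T ^+ 2 * (L / 4) ^+ m.
  rewrite /eps expr_div_n exprMn exprVn (_ : (4 : R) = 2 ^+ 2); last by ring.
  by rewrite -!exprM (mulnC m) ; field; rewrite expf_neq0.
have -> : rho `^ (1 - p) = rho * (L / 4) by rewrite mulrA -E mulfK.
have z0 : (L / 4) ^+ m != 0 by rewrite expf_neq0// gt_eqF// divr_gt0.
rewrite exprMn; move: z0; move: ((L / 4) ^+ m) (rho ^+ m) => z b z0.
by field; rewrite z0 gt_eqF.
Qed.

(** Averaging over the finer kernel bounds the increment at a point by an
    integral of the oscillation, hence by the seminorm. The rate rho is below 1
    because alpha > 1 / p. *)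
Lemma dyadic_mean_increment_le m y t S : continuous y -> 0 <= t <= T ->
  (sobint T alpha p (incr_power p y) <= S%:E)%E ->
  `|dyadic_mean T m.+1 y t - dyadic_mean T m y t| <= (128 + 8 * (C1 T alpha p * S) / T ^+ 2) * rho ^+ m.
Proof.
move=> cy tI yS; have e0 := eps_gt0 T0 m; have /andP[r0 _] := rho_itv.
set e := eps T m in e0 *; set lam := rho ^+ m.
have l0 : 0 < lam by exact: exprn_gt0.
have em := eps_le T0 m; have em1 := eps_le T0 m.+1.
have e1 : eps T m.+1 = e / 2 by exact: epsS.
set a := dyadic_mean T m y t.
rewrite {1}/dyadic_mean (smooth_subc em1 cy _ tI).
pose c1 := 64 * lam / e; pose c2 := 8 / e ^+ 2 * lam `^ (1 - p).
have c10 : 0 <= c1 by rewrite divr_ge0 ?mulr_ge0// ltW.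
have c20 : 0 <= c2 by rewrite mulr_ge0 ?powR_ge0// divr_ge0// sqr_ge0.
pose H u := c1 * \1_(`[t - e, t + e]%classic) u + c2 * osc T p (4 * e) y u.
have H0 u : 0 <= H u by rewrite addr_ge0// mulr_ge0// osc_ge0.
have cf : continuous (fun u => kern T (eps T m.+1) t u * (y u - a)).
  by apply: (kernM_continuous em1); exact: subc_continuous.
rewrite -lee_fin; apply: (le_trans (@Rintegral_le_integral _ T _ H cf H0 _)).
  move=> u uI; have [ut|ut] := leP `|u - t| e; last first.
    by rewrite (kern_eq0 em1) ?mul0r ?normr0// e1 mulrC divfK.
  rewrite normrM (ger0_norm (kern_ge0 em1 u tI)).
  rewrite /H indicE mem_set/=; last first.
    by rewrite in_itv/=; move: ut; rewrite ler_norml => /andP[? ?]; lra.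
  have tu : `|t - u| <= 2 * e by rewrite distrC; apply: (le_trans ut); rewrite ler_peMl ?(ltW e0)// ler1n.
  have := smooth_dist_le T0 em p1 cy (lexx (4 * e)) tI uI l0 tu.
  rewrite -/(dyadic_mean T m y t) -/a distrC => A.
  have := ler_pM (kern_ge0 em1 u tI) (normr_ge0 _) (kern_le em1 u tI) A.
  move=> /le_trans; apply; rewrite e1 mulr1 le_eqVlt; apply/orP; left; apply/eqP.
  rewrite /c1 /c2 -/e; move: (osc _ _ _ _ _) (lam `^ _) => b d; field.
  by rewrite gt_eqF.
have mo : measurable_fun setT (osc T p (4 * e) y) by exact: measurable_osc.
have -> : (128 + 8 * (C1 T alpha p * S) / T ^+ 2) * lam =
   c1 * (2 * e) + c2 * (C1 T alpha p * S / L ^+ m).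
  rewrite /c1 /c2.
  have -> : 8 / e ^+ 2 * lam `^ (1 - p) * (C1 T alpha p * S / L ^+ m) =
     8 * (C1 T alpha p * S) * (lam `^ (1 - p) / (e ^+ 2 * L ^+ m)).
    rewrite (invfM (e ^+ 2) (L ^+ m)); move: (C1 _ _ _) ((L ^+ m)^-1) (lam `^ _) ((e ^+ 2)^-1) => b d f g; ring.
  rewrite rho_balance -/lam; move: (C1 _ _ _) => b; field.
  by rewrite !gt_eqF.
apply: integral_le_add => //.
- by apply: measurable_funM => //; apply: measurable_indic; exact: measurable_itv.
- exact: measurable_funM.
- by move=> u _; rewrite mulr_ge0.
- by move=> u _; rewrite mulr_ge0// osc_ge0.
- by apply: integral_le_scale => //; rewrite integral_window// ltW.
- apply: integral_le_scale => //; first by move=> u _; exact: osc_ge0.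
  rewrite (integral_osc T0 p2 a0 m cy yS)//.
  have L1 := weight_ratio_gt1 p1 a0.
  rewrite lee_fin ler_pdivlMr ?exprn_gt0//; last exact: lt_trans L1.
  rewrite mulrC; apply: le_trans (sum_total_osc_le p1 a0 m.+1 cy yS).
  rewrite big_nat_recr//= lerDr; apply: sumr_ge0 => k _.
  by rewrite mulr_ge0 ?exprn_ge0 ?total_osc_ge0 ?weight_ratio_ge0.
Qed.

End SmoothingLimits.

Section AreaExists.
Context {R : realType}.
Variables (T alpha p : R).
Hypotheses (T0 : 0 < T) (p2 : 2 <= p) (a0 : 0 < alpha) (a2 : alpha < 1 / 2).
Hypothesis ap : 1 / p < alpha.
Local Notation mu := (@lebesgue_measure R).
Local Notation Q := (`[0%R, T]%classic `*` `[0%R, T]%classic : set (R * R)).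
Implicit Types (x y B : R -> R) (t s : R) (u : R * R) (m N : nat).
Local Notation L := (weight_ratio alpha p).
Local Notation w := (sob_weight alpha p).

Let p1 : 1 <= p. Proof. by move: p2; lra. Qed.
Let p0 : 0 < p. Proof. by move: p2; lra. Qed.
Let q := p / 2.
Let q0 : 0 < q. Proof. by rewrite /q; move: p2; lra. Qed.
Let r := alpha * p + 1.
Let r0 : 0 < r.
Proof. by rewrite ltr_wpDl// mulr_ge0// ltW. Qed.

Lemma squareP u : Q u <-> 0 <= u.1 <= T /\ 0 <= u.2 <= T.
Proof. by rewrite /= !in_itv. Qed.

Lemma square_dist u : Q u -> `|u.2 - u.1| <= T.
Proof.
by move=> /squareP[/andP[? ?] /andP[? ?]]; rewrite ler_norml; lra.
Qed.

Definition C4 : R := ((T / 2) `^ r)^-1.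

Lemma C4_ge0 : 0 <= C4.
Proof. by rewrite invr_ge0 powR_ge0. Qed.

(** The largest j whose strip contains u has eps j comparable to the distance. *)
Lemma weight_le_strip u : Q u -> u.1 != u.2 ->
  exists2 j, u \in strip T (eps T j) & w u <= C4 * L ^+ j.
Proof.
move=> Qu u12; have hT := square_dist Qu.
set h := `|u.2 - u.1| in hT *.
have h0 : 0 < h by rewrite normr_gt0 subr_eq0 eq_sym.
have ex : exists n, eps T n < h.
  have [M _ HM] : \forall N \near \oo, eps T N < h by exact: (cvgr_lt _ (eps_cvg0 T)).
  by exists M; exact: (HM M (leqnn M)).
case: (ex_minnP ex) => n nh nmin.
have n0 : (0 < n)%N.
  by case: n nh {nmin} => //; rewrite /eps expr0 divr1 ltNge hT.
exists n.-1.
  apply: mem_set; split; [by have [] := (squareP u).1 Qu|by have [] := (squareP u).1 Qu|].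
  rewrite leNgt; apply/negP => /nmin; rewrite -ltnS prednK// ltnn.
  by [].
have e2 : T / 2 <= h * 2 ^+ n.-1.
  move: nh; rewrite -(prednK n0) epsS /eps mulrAC ltr_pdivrMr ?exprn_gt0//.
  exact: ltW.
rewrite /sob_weight -/h -/r (weight_ratio_exp alpha p) -/r /C4.
rewrite -ler_pdivrMl ?invr_gt0 ?powR_gt0 ?divr_gt0// invrK.
rewrite ler_pdivrMr ?powR_gt0// -powRM ?exprn_ge0 ?(ltW h0)//.
by apply: ge0_ler_powR2; [exact: ltW|rewrite divr_ge0// ltW|rewrite [leRHS]mulrC].
Qed.

Lemma paraproduct_continuous N x y : continuous x -> continuous y ->
  continuous (fun t => paraproduct T N x y (clamp T t)).
Proof.
move=> cx cy; rewrite /paraproduct; elim: N => [|n IH].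
  by under eq_fun do rewrite big_nil; move=> ?; exact: cvg_cst.
under eq_fun do rewrite big_nat_recr//=.
have cX := @dyadic_mean_clamp_continuous _ _ _ T0 p2 n x cx.
have cY := @dyadic_mean_clamp_continuous _ _ _ T0 p2 n y cy.
have cY1 := @dyadic_mean_clamp_continuous _ _ _ T0 p2 n.+1 y cy.
move=> t; exact: (cvgD (IH t) (cvgM (cX t) (cvgB (cY1 t) (cY t)))).
Qed.

Lemma measurable_dyadic_energy N x y : continuous x -> continuous y ->
  measurable_fun setT (dyadic_energy T alpha p N x y).
Proof.
move=> cx cy.
pose f t := paraproduct T N x y (clamp T t).
pose g t := dyadic_mean T N y (clamp T t).
have cf : continuous f by exact: paraproduct_continuous.
have cg : continuous g by exact: dyadic_mean_clamp_continuous.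
pose G u := (f u.2 - f u.1) - x u.1 * (g u.2 - g u.1).
have mG : measurable_fun setT G.
  apply: measurable_funB; first exact: measurable_incr.
  apply: measurable_funM; last exact: measurable_incr.
  exact: (measurableT_comp (continuous_measurable_fun cx) measurable_fst).
rewrite (_ : dyadic_energy _ _ _ _ _ _ = fun u => \sum_(0 <= j < N) L ^+ j *
    (\1_(strip T (eps T j)) u * `|G u| `^ q)).
  apply: measurable_sum => j; apply: measurable_funM => //.
  apply: measurable_strip_fun; apply: (measurableT_comp (measurable_powR q)).
  exact: (measurableT_comp (@normr_measurable R setT)).
apply/funext => u; apply: eq_bigr => j _; rewrite indicE.
case: (boolP (u \in _)) => [/set_mem[u1 u2 _]|_]; last by rewrite !mul0r.
by rewrite /G /f /g !clamp_id// /area_defect.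
Qed.

Lemma dyadic_energy_ge0 N x y u : 0 <= dyadic_energy T alpha p N x y u.
Proof.
by apply: sumr_ge0 => j _; rewrite mulr_ge0 ?exprn_ge0 ?weight_ratio_ge0// mulr_ge0 ?powR_ge0.
Qed.

Definition area_incr x y B u : R := (B u.2 - B u.1) - x u.1 * (y u.2 - y u.1).

(** The uniform bound on the energies of the paraproducts passes to their limit
    by Fatou's lemma. *)
Lemma area_incr_energy x y B S : continuous x -> continuous y ->
  (forall N, (\int[mu \x mu]_u (dyadic_energy T alpha p N x y u)%:E <= S%:E)%E) ->
  (forall t, 0 <= t <= T -> paraproduct T N x y t @[N --> \oo] --> B t) ->
  (sobint T alpha p (fun u => (`|area_incr x y B u| `^ q)%R) <= (C4 * S)%:E)%E.
Proof.
move=> cx cy ES BP; have C40 := C4_ge0.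
pose F N u := (C4 * dyadic_energy T alpha p N x y u)%:E.
have F0 N u : (0 <= F N u)%E by rewrite lee_fin mulr_ge0 ?dyadic_energy_ge0.
have mF N : measurable_fun setT (F N).
  apply/measurable_EFinP; apply: measurable_funM => //.
  exact: measurable_dyadic_energy.
have FS N : (\int[mu \x mu]_u F N u <= (C4 * S)%:E)%E.
  apply: integral_le_scale => //; first exact: measurable_dyadic_energy.
  by move=> u _; exact: dyadic_energy_ge0.
have fat := @integral_limn_einf_le _ _ _ (mu \x mu)%E _ measurableT F _ mF (fun N u _ => F0 N u) FS.
apply: (@le_trans _ _ (\int[mu \x mu]_u limn_einf (F^~ u))%E); last exact: fat.
rewrite /sobint integral_mkcond; apply: ge0_le_integral_nonmeas => u _.
  rewrite patchE; case: ifPn => // _.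
  by rewrite lee_fin mulr_ge0 ?powR_ge0 ?sob_weight_ge0.
have lim0 : (0%:E <= limn_einf (F^~ u))%E.
  apply: (@le_limn_einf _ _ (fun=> 0)); first exact: cvg_cst.
  by apply: nearW => N; exact: F0.
rewrite patchE; case: ifPn => // /set_mem Qu.
have [u1 u2] := (squareP u).1 Qu.
have [u12|u12] := eqVneq u.1 u.2.
  rewrite /sob_weight u12 subrr normr0 powR0 ?gt_eqF// invr0 mulr0.
  exact: lim0.
have [A0|A0] := eqVneq (area_incr x y B u) 0.
  by rewrite A0 normr0 powR0 ?gt_eqF// mul0r.
have [j uj wj] := weight_le_strip Qu u12.
apply: (@le_limn_einf _ _ (fun N => `|area_defect T N x y u.1 u.2| `^ q * w u)).
  apply: cvgMl; apply: powR_cvg => //; first by rewrite normr_gt0.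
  apply: cvg_norm; rewrite /area_incr /area_defect.
  apply: cvgB; first by apply: cvgB; exact: BP.
  by apply: cvgMr; apply: cvgB; exact: dyadic_mean_cvg.
exists j.+1 => // N /= jN; rewrite lee_fin /dyadic_energy.
apply: (@le_trans _ _ (C4 * (L ^+ j * `|area_defect T N x y u.1 u.2| `^ q))).
  by rewrite mulrA mulrC ler_wpM2r ?powR_ge0.
rewrite ler_wpM2l// (@big_cat_nat _ _ _ j)//=; last exact: ltnW.
rewrite [X in _ + X]big_ltn//= indicE uj mul1r addrCA lerDl addr_ge0// sumr_ge0// => i _.
  by rewrite mulr_ge0 ?exprn_ge0 ?weight_ratio_ge0// mulr_ge0 ?powR_ge0.
by rewrite mulr_ge0 ?exprn_ge0 ?weight_ratio_ge0// mulr_ge0 ?powR_ge0.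
Qed.

(** The scalar form of the extension theorem. The iterated integral of x against
    y need not exist, but the paraproducts converge uniformly and their areas have
    the regularity that an iterated integral would have. *)
Theorem area_exists x y : continuous x -> continuous y ->
  (sobint T alpha p (incr_power p x) < +oo)%E ->
  (sobint T alpha p (incr_power p y) < +oo)%E ->
  exists B, continuous B /\
    (sobint T alpha p (fun u => (`|area_incr x y B u| `^ q)%R) < +oo)%E.
Proof.
move=> cx cy xoo yoo.
have fin z : (sobint T alpha p (incr_power p z) < +oo)%E ->
    (sobint T alpha p (incr_power p z) <=
     (fine (sobint T alpha p (incr_power p z)))%:E)%E.
  move=> zoo; rewrite fineK// ge0_fin_numE// integral_ge0// => u _.
  by rewrite lee_fin mulr_ge0 ?powR_ge0 ?sob_weight_ge0.
have xS := fin _ xoo; have yS := fin _ yoo.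
set Sx := fine _ in xS; set Sy := fine _ in yS.
have Sy0 : 0 <= Sy.
  by rewrite fine_ge0// integral_ge0// => u _; rewrite lee_fin mulr_ge0 ?powR_ge0 ?sob_weight_ge0.
have [M M0 xM] := continuous_bounded T0 cx.
have /andP[rho0 rho1] := rho_itv ap.
pose A := 128 + 8 * (C1 T alpha p * Sy) / T ^+ 2.
have A0 : 0 <= A.
  by rewrite addr_ge0// divr_ge0 ?sqr_ge0// mulr_ge0// mulr_ge0// C1_ge0.
pose f N t := paraproduct T N x y (clamp T t).
have T00 := ltW T0.
have cf N : continuous (f N) by exact: paraproduct_continuous.
have [||||B [cB fB]] := @geometric_limit _ f (M * A) (rho alpha p).
- exact: mulr_ge0.
- by rewrite rho0.
- exact: cf.
- move=> N t; have tI := clamp_itv t T00.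
  rewrite /f /paraproduct big_nat_recr//= addrAC subrr add0r normrM -mulrA.
  apply: ler_pM => //; first exact: (dyadic_mean_bounded T0 N cx tI M0 xM).
  exact: (dyadic_mean_increment_le T0 p2 a0 ap N cy tI yS).
exists B; split; first exact: cB.
apply: (@le_lt_trans _ _ (C4 * (CE T alpha p * Sx + C3 T alpha p * (Sx + Sy)))%:E);
  last exact: ltry.
apply: (area_incr_energy cx cy).
  by move=> N; exact: (dyadic_energy_le T0 p2 a0 a2 N cx cy xS yS).
by move=> t tI; have := fB t; rewrite /f (clamp_id tI).
Qed.

(** A bound for the mean over [0, T] plus the sum of the dyadic increments. *)
Definition sob_const : R :=
  2 / T * (T + 1) + (128 + 8 * C1 T alpha p / T ^+ 2) / (1 - rho alpha p).

Lemma sobolev_embedding y t : continuous y -> 0 <= t <= T ->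
  (\int[mu]_(s in `[0%R, T]) (`|y s| `^ p)%:E <= 1%:E)%E ->
  (sobint T alpha p (incr_power p y) <= 1%:E)%E ->
  `|y t| <= sob_const.
Proof.
move=> cy tI y1 s1; have /andP[rho0 rho1] := rho_itv ap.
have r10 : 0 < 1 - rho alpha p by rewrite subr_gt0.
have C10 := C1_ge0 T p1 a0.
set A := 128 + 8 * C1 T alpha p / T ^+ 2.
have A0 : 0 <= A by rewrite addr_ge0// divr_ge0 ?sqr_ge0// mulr_ge0.
have step m : `|dyadic_mean T m.+1 y t - dyadic_mean T m y t| <= A * rho alpha p ^+ m.
  by have := dyadic_mean_increment_le T0 p2 a0 ap m cy tI s1; rewrite mulr1.
have tele N : `|dyadic_mean T N y t - dyadic_mean T 0 y t| <= A / (1 - rho alpha p) * (1 - rho alpha p ^+ N).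
  elim: N => [|n IH]; first by rewrite expr0 !subrr normr0 mulr0.
  rewrite -(subrKA (dyadic_mean T n y t)) addrC.
  apply: (le_trans (ler_normD _ _)); apply: (le_trans (lerD IH (step n))).
  rewrite le_eqVlt; apply/orP; left; apply/eqP.
  by rewrite exprS; move: (rho _ _ ^+ n) => z; field; rewrite gt_eqF.
have mean : `|dyadic_mean T 0 y t| <= 2 / T * (T + 1).
  have TI : 0 < T <= T by rewrite T0 lexx.
  rewrite /dyadic_mean /eps expr0 divr1 -[smooth _ _ _ _]subr0 (smooth_subc TI cy 0 tI).
  have cf : continuous (fun s => kern T T t s * (y s - 0)).
    by apply: (kernM_continuous TI); exact: subc_continuous.
  have If := @continuous_integrable _ T _ cf.
  rewrite -lee_fin EFin_normr_Rintegral//.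
  apply: (le_trans (le_abse_integral _ _ _)) => //; first by case/integrableP: If.
  have my : measurable_fun `[0%R, T] (fun s => `|y s| `^ p).
    apply: measurable_funTS; apply: (measurableT_comp (measurable_powR p)).
    by apply: (measurableT_comp (@normr_measurable R setT)); exact: continuous_measurable_fun.
  apply: (@le_trans _ _ (\int[mu]_(s in `[0%R, T]) (2 / T * (1 + `|y s| `^ p))%:E)%E).
    apply: ge0_le_integral_nonmeas => u uI; first by [].
    rewrite /= lee_fin subr0 normrM; move: uI; rewrite /= in_itv/= => uI.
    apply: ler_pM => //.
      by rewrite ger0_norm ?(kern_ge0 TI)// (kern_le TI).
    by have := young_threshold p1 (normr_ge0 (y u)) ltr01; rewrite powR1 mul1r.
  have I1 : (\int[mu]_(s in `[0%R, T]) (1 + `|y s| `^ p)%:E <= (T + 1)%:E)%E.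
    apply: (@integral_le_add _ _ R mu `[0%R, T]%classic (measurable_itv _) (fun=> 1)
      (fun s => `|y s| `^ p) T 1 _ my) => //.
    by rewrite integral_cst//= lebesgue_measure_itv/= lte_fin T0 -EFinB -EFinM mul1r subr0.
  have m1 : measurable_fun `[0%R, T] (fun s => 1 + `|y s| `^ p) by exact: measurable_funD.
  apply: (@integral_le_scale _ _ R mu `[0%R, T]%classic (measurable_itv _)
      (fun s => 1 + `|y s| `^ p) (2 / T) (T + 1) m1 _ _ I1).
    by rewrite divr_ge0// ltW.
  by move=> s _; rewrite addr_ge0 ?powR_ge0.
have lim := @dyadic_mean_cvg _ _ T0 y t cy tI.
have bd N : `|dyadic_mean T N y t| <= sob_const.
  rewrite -[dyadic_mean T N y t](subrKC (dyadic_mean T 0 y t)).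
  apply: (le_trans (ler_normD _ _)); apply: lerD => //.
  apply: (le_trans (tele N)); rewrite ler_piMr ?divr_ge0 ?(ltW r10)//.
  by rewrite lerBlDr lerDl exprn_ge0// ltW.
apply: (@closed_cvg _ _ \oo _ (fun n => `|dyadic_mean T n y t|) (fun z => z <= sob_const)).
- exact: closed_le.
- exact: nearW.
- exact: cvg_norm.
Qed.

End AreaExists.

(** * Sobolev group-valued paths in coordinates *)

Section FiniteEnergy.
Context {R : realType}.
Variables (T alpha p : R).
Hypotheses (T0 : 0 < T) (p0 : 0 < p).
Local Notation mu := (@lebesgue_measure R).
Local Notation Q := (`[0%R, T]%classic `*` `[0%R, T]%classic : set (R * R)).
Local Notation w := (sob_weight alpha p).
Implicit Types (f g : R * R -> R) (x y B : R -> R).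

Definition finite_energy f : Prop :=
  [/\ measurable_fun setT f, forall u, 0 <= f u & (sobint T alpha p f < +oo)%E].

Lemma finite_energy_le f g : measurable_fun setT f -> (forall u, 0 <= f u) ->
  (forall u, Q u -> f u <= g u) -> finite_energy g -> finite_energy f.
Proof.
move=> mf f0 fg [mg g0 gS]; split=> //; apply: le_lt_trans gS.
apply: ge0_le_integral_nonmeas => u Qu.
  by rewrite lee_fin mulr_ge0 ?sob_weight_ge0.
by rewrite lee_fin ler_wpM2r ?sob_weight_ge0// fg.
Qed.

Lemma measurable_weighted f : measurable_fun setT f ->
  measurable_fun Q (fun u => (f u * w u)%:E).
Proof.
move=> mf; apply/measurable_EFinP; apply: measurable_funTS.
by apply: measurable_funM => //; exact: measurable_sob_weight.
Qed.

Lemma finite_energyD f g : finite_energy f -> finite_energy g ->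
  finite_energy (fun u => f u + g u).
Proof.
move=> [mf f0 fS] [mg g0 gS]; split.
- exact: measurable_funD.
- by move=> u; rewrite addr_ge0.
- rewrite /sobint; under eq_integral do rewrite mulrDl EFinD.
  rewrite ge0_integralD//.
  + exact: lte_add_pinfty.
  + exact: measurable_square.
  + by move=> u _; rewrite lee_fin mulr_ge0 ?sob_weight_ge0.
  + exact: measurable_weighted.
  + by move=> u _; rewrite lee_fin mulr_ge0 ?sob_weight_ge0.
  + exact: measurable_weighted.
Qed.

Lemma finite_energyZ c f : 0 <= c -> finite_energy f ->
  finite_energy (fun u => c * f u).
Proof.
move=> c0 [mf f0 fS]; split.
- exact: measurable_funM.
- by move=> u; rewrite mulr_ge0.
- rewrite /sobint; under eq_integral do rewrite -mulrA EFinM.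
  rewrite ge0_integralZl_EFin//.
  + by rewrite lte_mul_pinfty ?lee_fin.
  + exact: measurable_square.
  + by move=> u _; rewrite lee_fin mulr_ge0 ?sob_weight_ge0.
  + exact: measurable_weighted.
Qed.

Lemma finite_energy0 : finite_energy (fun=> 0).
Proof.
split=> //; rewrite /sobint; under eq_integral do rewrite mul0r.
by rewrite integral0.
Qed.

Lemma measurable_powR_comp f c : measurable_fun setT f ->
  measurable_fun setT (fun u => f u `^ c).
Proof. by move=> mf; exact: (measurableT_comp (measurable_powR c)). Qed.

Lemma finite_energy_powR_sum (I : Type) (s : seq I) (f : I -> R * R -> R) :
  (forall i, measurable_fun setT (f i)) -> (forall i u, 0 <= f i u) ->
  (forall i, finite_energy (fun u => f i u `^ p)) ->
  finite_energy (fun u => (\sum_(i <- s) f i u) `^ p).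
Proof.
move=> mf f0 fS; elim: s => [|i s IH].
  under eq_fun do rewrite big_nil powR0 ?gt_eqF//; exact: finite_energy0.
apply: finite_energy_le (finite_energyZ (powR_ge0 2 p) (finite_energyD (fS i) IH)).
- apply: measurable_powR_comp; under eq_fun do rewrite big_cons.
  by apply: measurable_funD => //; exact: measurable_sum.
- by move=> u; exact: powR_ge0.
- move=> u _; rewrite big_cons; apply: powR_add_le => //; first exact: ltW.
  by apply: sumr_ge0 => j _.
Qed.

End FiniteEnergy.

Section Coordinates.
Context {R : realType}.
Variables (T alpha p : R).
Hypotheses (T0 : 0 < T) (p0 : 0 < p).
Local Notation mu := (@lebesgue_measure R).
Local Notation Q := (`[0%R, T]%classic `*` `[0%R, T]%classic : set (R * R)).
Local Notation w := (sob_weight alpha p).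
Implicit Types (d : nat) (x y B : R -> R) (s t : R).

(** Freezing the path outside of [0, T] makes its coordinates continuous on the
    whole line. *)
Definition coord1 d (X : R -> tens2 R d) i t : R := (X (clamp T t)).1.2 0 i.
Definition coord2 d (X : R -> tens2 R d) i j t : R := (X (clamp T t)).2 i j.

Lemma measurable_area_incr x y B : continuous x -> continuous y -> continuous B ->
  measurable_fun setT (area_incr x y B).
Proof.
move=> cx cy cB; apply: measurable_funB; first exact: measurable_incr.
apply: measurable_funM; last exact: measurable_incr.
exact: (measurableT_comp (continuous_measurable_fun cx) measurable_fst).
Qed.

Lemma measurable_abs_powR (f : R * R -> R) c : measurable_fun setT f ->
  measurable_fun setT (fun u => `|f u| `^ c).
Proof.
move=> mf; apply: measurable_powR_comp.
exact: (measurableT_comp (@normr_measurable R setT)).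
Qed.

(** What the Sobolev condition on a group-valued path says about its coordinates:
    increments of the second level are areas, and their homogeneity 2 halves the
    exponent. *)
Definition coord_sobolev d (X : R -> tens2 R d) : Prop :=
  [/\ forall i, continuous (coord1 X i),
      forall i j, continuous (coord2 X i j),
      forall i, (sobint T alpha p (incr_power p (coord1 X i)) < +oo)%E &
      forall i j, (sobint T alpha p (fun u =>
        (`|area_incr (coord1 X i) (coord1 X j) (coord2 X i j) u| `^ (p / 2))%R) < +oo)%E].

Lemma increment_level1 d (g h : tens2 R d) i : g.1.1 = 1 -> h.1.1 = 1 ->
  (tmul (tinv g) h).1.2 0 i = h.1.2 0 i - g.1.2 0 i.
Proof. by move=> g1 h1; rewrite /tmul /tinv /= h1 !scale1r !mxE. Qed.

Lemma increment_level2 d (g h : tens2 R d) i j : g.1.1 = 1 -> h.1.1 = 1 ->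
  (tmul (tinv g) h).2 i j =
  h.2 i j - g.2 i j - g.1.2 0 i * (h.1.2 0 j - g.1.2 0 j).
Proof.
by move=> g1 h1; rewrite /tmul /tinv /= h1 !scale1r !mxE !big_ord1 !mxE; ring.
Qed.

Lemma G2_increment d (g h : tens2 R d) : G2 g -> G2 h -> G2 (tmul (tinv g) h).
Proof.
move=> /G2P[g1 gS] /G2P[h1 hS]; apply/G2P; split.
  by rewrite /tmul /= h1 mulr1.
move=> i j; rewrite !increment_level2// !increment_level1//.
have := gS i j; have := hS i j.
move: (h.2 i j) (h.2 j i) (g.2 i j) (g.2 j i) => a b c e E1 E2.
have -> : a = h.1.2 0 i * h.1.2 0 j - b by rewrite -E1 addrK.
have -> : c = g.1.2 0 i * g.1.2 0 j - e by rewrite -E2 addrK.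
ring.
Qed.

Lemma continuous_clamp (g : R -> R) :
  (forall s, 0 <= s <= T -> forall e, 0 < e ->
     \forall t \near s, 0 <= t <= T -> `|g t - g s| <= e) ->
  continuous (fun t => g (clamp T t)).
Proof.
move=> gc s; apply/cvgrPdist_le => e e0; have T00 := ltW T0.
have H := gc _ (clamp_itv s T00) e e0.
have HH : \forall t \near s, 0 <= clamp T t <= T ->
    `|g (clamp T t) - g (clamp T s)| <= e.
  exact: (@clamp_continuous _ T T00 s _ H).
near=> t; rewrite distrC; have : 0 <= clamp T t <= T by exact: clamp_itv.
by near: t.
Unshelve. all: by end_near.
Qed.

Lemma near_ereal_lt (f : R -> \bar R) (s e : R) :
  f @ within `[0, T] (nbhs s) --> 0%E -> 0 < e ->
  \forall t \near s, 0 <= t <= T -> (f t < e%:E)%E.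
Proof.
move=> f0 e0; have : nbhs (0%E : \bar R) [set z | (z < e%:E)%E].
  by apply: (@open_ereal_lt' R 0%E e%:E); rewrite lte_fin.
move=> /f0; rewrite /within /= !nbhs_simpl /=; apply: filterS => t Ht tI.
by apply: Ht; rewrite /= in_itv.
Qed.

(** The Carnot-Caratheodory norm dominates the coordinates of the first level and
    the square roots of those of the second. *)
Lemma WG2_coord_sobolev d (X : R -> tens2 R d) : WG2 T alpha p X -> coord_sobolev X.
Proof.
move=> [XG Xc XS].
have X1 t : 0 <= t <= T -> (X t).1.1 = 1.
  by move=> tI; have /G2P[] : G2 (X t) by apply: XG; rewrite in_itv.
have L1 s t i : 0 <= s <= T -> 0 <= t <= T ->
    (`|(X t).1.2 0 i - (X s).1.2 0 i|%:E <= dcc (X s) (X t))%E.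
  move=> sI tI; have := ccnorm_ge_level1 (tmul (tinv (X s)) (X t)) i.
  by rewrite increment_level1 ?X1.
have L2 s t i j : 0 <= s <= T -> 0 <= t <= T ->
    ((Num.sqrt `|(X t).2 i j - (X s).2 i j -
        (X s).1.2 0 i * ((X t).1.2 0 j - (X s).1.2 0 j)|)%:E <= dcc (X s) (X t))%E.
  move=> sI tI; have := ccnorm_ge_level2 (tmul (tinv (X s)) (X t)) i j.
  by rewrite increment_level2 ?X1.
have near1 s e : 0 <= s <= T -> 0 < e ->
    \forall t \near s, 0 <= t <= T -> (dcc (X s) (X t) < e%:E)%E.
  by move=> sI e0; apply: near_ereal_lt => //; apply: Xc; rewrite in_itv.
have c1 i : continuous (coord1 X i).
  apply: (continuous_clamp (g := fun t => (X t).1.2 0 i)) => s sI e e0.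
  have := near1 s e sI e0; apply: filterS => t Ht tI.
  by rewrite -lee_fin; apply: (le_trans (L1 _ _ i sI tI)); exact/ltW/Ht.
have c2 i j : continuous (coord2 X i j).
  apply: (continuous_clamp (g := fun t => (X t).2 i j)) => s sI e e0.
  pose M := `|(X s).1.2 0 i| + 1; have M0 : 0 < M by rewrite ltr_wpDl.
  pose e' := Num.min 1 (e / (M + 1)).
  have M1 : 0 < M + 1 by rewrite addr_gt0.
  have e'0 : 0 < e' by rewrite lt_min ltr01 divr_gt0.
  have := near1 s e' sI e'0; apply: filterS => t Ht tI.
  have A := le_lt_trans (L1 s t j sI tI) (Ht tI).
  have B := le_lt_trans (L2 s t i j sI tI) (Ht tI).
  rewrite !lte_fin in A B.
  have B2 : `|(X t).2 i j - (X s).2 i j -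
        (X s).1.2 0 i * ((X t).1.2 0 j - (X s).1.2 0 j)| <= e'.
    rewrite -[leLHS]sqr_sqrtr// expr2; apply: (@le_trans _ _ (e' * 1)).
      apply: ler_pM; rewrite ?sqrtr_ge0 ?(ltW B)//.
      by apply: (le_trans (ltW B)); rewrite /e' ge_min lexx.
    by rewrite mulr1.
  have -> : (X t).2 i j - (X s).2 i j = ((X t).2 i j - (X s).2 i j -
        (X s).1.2 0 i * ((X t).1.2 0 j - (X s).1.2 0 j)) +
        (X s).1.2 0 i * ((X t).1.2 0 j - (X s).1.2 0 j) by ring.
  apply: (le_trans (ler_normD _ _)).
  apply: (@le_trans _ _ (e' + M * e')).
    apply: lerD => //; rewrite normrM; apply: ler_pM => //; last exact: ltW.
    by rewrite /M lerDl.
  rewrite -{1}(mul1r e') -mulrDl mulrC addrC -ler_pdivlMr//.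
  by rewrite /e' ge_min lexx orbT.
have Qc u : Q u -> [/\ 0 <= u.1 <= T, 0 <= u.2 <= T, clamp T u.1 = u.1 & clamp T u.2 = u.2].
  by move=> /squareP[u1 u2]; rewrite !clamp_id.
split => //.
- move=> i; apply: le_lt_trans XS; apply: ge0_le_integral_nonmeas => u Qu.
    by rewrite lee_fin mulr_ge0 ?powR_ge0 ?sob_weight_ge0.
  rewrite EFinM; apply: lee_wpmul2r; first by rewrite lee_fin sob_weight_ge0.
  have [u1 u2 e1 e2] := Qc u Qu.
  rewrite /incr_power /coord1 e1 e2 -poweR_EFin; apply: gt0_ler_poweR; [exact: ltW| | |].
  + by rewrite in_itv/= lee_fin normr_ge0 leey.
  + by rewrite in_itv/= ccnorm_ge0 leey.
  + exact: L1.
- move=> i j; apply: le_lt_trans XS; apply: ge0_le_integral_nonmeas => u Qu.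
    by rewrite lee_fin mulr_ge0 ?powR_ge0 ?sob_weight_ge0.
  rewrite EFinM; apply: lee_wpmul2r; first by rewrite lee_fin sob_weight_ge0.
  have [u1 u2 e1 e2] := Qc u Qu.
  rewrite /area_incr /coord1 /coord2 e1 e2.
  have -> : forall a : R, `|a| `^ (p / 2) = (Num.sqrt `|a|) `^ p.
    by move=> a; rewrite -powR12_sqrt// -powRrM mulrC.
  rewrite -poweR_EFin; apply: gt0_ler_poweR; [exact: ltW| | |].
  + by rewrite in_itv/= lee_fin sqrtr_ge0 leey.
  + by rewrite in_itv/= ccnorm_ge0 leey.
  + exact: L2.
Qed.

End Coordinates.

Section CoordinatesConverse.
Context {R : realType}.
Variables (T alpha p : R).
Hypotheses (T0 : 0 < T) (p0 : 0 < p).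
Local Notation mu := (@lebesgue_measure R).
Local Notation Q := (`[0%R, T]%classic `*` `[0%R, T]%classic : set (R * R)).
Local Notation w := (sob_weight alpha p).
Local Notation FE := (finite_energy T alpha p).
Implicit Types (d : nat) (x y B : R -> R) (s t : R) (u : R * R).

Lemma finite_energy_incr x : continuous x ->
  (sobint T alpha p (incr_power p x) < +oo)%E -> FE (incr_power p x).
Proof.
move=> cx xS; split=> //; first exact: measurable_incr_power.
by move=> u; exact: powR_ge0.
Qed.

Lemma finite_energy_area x y B : continuous x -> continuous y -> continuous B ->
  (sobint T alpha p (fun u => (`|area_incr x y B u| `^ (p / 2))%R) < +oo)%E ->
  FE (fun u => `|area_incr x y B u| `^ (p / 2)).
Proof.
move=> cx cy cB xS; split=> //.
by apply: measurable_abs_powR; exact: measurable_area_incr.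
Qed.

Definition boxincr d (X : R -> tens2 R d) u : R :=
  \sum_i `|coord1 T X i u.2 - coord1 T X i u.1| +
  8 * \sum_i \sum_j
    Num.sqrt `|area_incr (coord1 T X i) (coord1 T X j) (coord2 T X i j) u|.

Lemma dcc_le_boxincr d (X : R -> tens2 R d) u :
  (forall t, 0 <= t <= T -> G2 (X t)) -> Q u ->
  (dcc (X u.1) (X u.2) <= (boxincr X u)%:E)%E.
Proof.
move=> XG /squareP[u1 u2]; have G1 := XG _ u1; have G2' := XG _ u2.
apply: (le_trans (ccnorm_le_boxnorm (G2_increment G1 G2'))).
have /G2P[e1 _] := G1; have /G2P[e2 _] := G2'.
rewrite lee_fin /boxnorm /boxincr /l1norm; apply: lerD.
  by apply: ler_sum => i _; rewrite increment_level1// /coord1 !clamp_id.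
rewrite ler_wpM2l//; apply: ler_sum => i _; apply: ler_sum => j _.
by rewrite increment_level2// /area_incr /coord1 /coord2 !clamp_id.
Qed.

Lemma boxincr_ge0 d (X : R -> tens2 R d) u : 0 <= boxincr X u.
Proof.
rewrite addr_ge0 ?sumr_ge0// mulr_ge0// sumr_ge0// => i _.
by rewrite sumr_ge0// => j _; exact: sqrtr_ge0.
Qed.

Lemma sqrt_powR (a : R) : 0 <= a -> Num.sqrt a `^ p = a `^ (p / 2).
Proof. by move=> a0; rewrite -powR12_sqrt// -powRrM mulrC. Qed.

Lemma measurable_sqrt_abs (f : R * R -> R) : measurable_fun setT f ->
  measurable_fun setT (fun u => Num.sqrt `|f u|).
Proof.
move=> mf; under eq_fun do rewrite -powR12_sqrt//.
exact: measurable_abs_powR.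
Qed.

Lemma finite_energy_boxincr d (X : R -> tens2 R d) : coord_sobolev T alpha p X ->
  FE (fun u => boxincr X u `^ p).
Proof.
move=> [c1 c2 S1 S2].
have ma i j : measurable_fun setT (fun u =>
    Num.sqrt `|area_incr (coord1 T X i) (coord1 T X j) (coord2 T X i j) u|).
  by apply: measurable_sqrt_abs; exact: measurable_area_incr.
have m1 i : measurable_fun setT (fun u : R * R => `|coord1 T X i u.2 - coord1 T X i u.1|).
  by apply: (measurableT_comp (@normr_measurable R setT)); exact: measurable_incr.
have F1 : FE (fun u => (\sum_i `|coord1 T X i u.2 - coord1 T X i u.1|) `^ p).
  apply: (finite_energy_powR_sum p0) => [i|i u|i]; [exact: m1|exact: normr_ge0|].
  exact: (finite_energy_incr (c1 i) (S1 i)).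
have F2 : FE (fun u => (\sum_i \sum_j
    Num.sqrt `|area_incr (coord1 T X i) (coord1 T X j) (coord2 T X i j) u|) `^ p).
  apply: (finite_energy_powR_sum p0) => [i|i u|i].
  - by apply: measurable_sum => j; exact: ma.
  - by apply: sumr_ge0 => j _; exact: sqrtr_ge0.
  apply: (finite_energy_powR_sum p0) => [j|j u|j]; [exact: ma|exact: sqrtr_ge0|].
  under eq_fun do rewrite (sqrt_powR (normr_ge0 _)).
  exact: (finite_energy_area (c1 i) (c1 j) (c2 i j) (S2 i j)).
have F3 := finite_energyZ (powR_ge0 8 p) F2.
apply: finite_energy_le (finite_energyZ (powR_ge0 2 p) (finite_energyD F1 F3)).
- apply: measurable_powR_comp; apply: measurable_funD; first exact: measurable_sum.
  apply: measurable_funM => //; apply: measurable_sum => i; exact: measurable_sum.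
- by move=> u; exact: powR_ge0.
- move=> u _; rewrite -powRM//; last first.
    by apply: sumr_ge0 => i _; apply: sumr_ge0 => j _; exact: sqrtr_ge0.
  apply: powR_add_le; [exact: ltW|exact: sumr_ge0|].
  by rewrite mulr_ge0// sumr_ge0// => i _; apply: sumr_ge0 => j _; exact: sqrtr_ge0.
Qed.

Lemma cvg_sum_fun (S : Type) (G : set_system S) {FG : Filter G}
    (I : Type) (r : seq I) (f : I -> S -> R) (l : I -> R) :
  (forall i, f i t @[t --> G] --> l i) ->
  \sum_(i <- r) f i t @[t --> G] --> \sum_(i <- r) l i.
Proof.
move=> fl; elim: r => [|i r IH].
  by under eq_fun do rewrite big_nil; rewrite big_nil; exact: cvg_cst.
under eq_fun do rewrite big_cons; rewrite big_cons.
exact: (cvgD (fl i) IH).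
Qed.

Lemma boxincr_cvg d (X : R -> tens2 R d) s : coord_sobolev T alpha p X ->
  boxincr X (s, t) @[t --> s] --> 0.
Proof.
move=> [c1 c2 _ _].
have E : boxincr X (s, s) = 0.
  rewrite /boxincr big1 ?add0r => [|i _]; last by rewrite subrr normr0.
  rewrite big1 ?mulr0// => i _; rewrite big1// => j _.
  by rewrite /area_incr !subrr mulr0 subrr normr0 sqrtr0.
rewrite -E /boxincr /=.
have A : \sum_i `|coord1 T X i t - coord1 T X i s| @[t --> s] -->
   \sum_i `|coord1 T X i s - coord1 T X i s|.
  apply: cvg_sum_fun => i; apply: cvg_norm; apply: cvgB; [exact: c1|exact: cvg_cst].
have B : \sum_i \sum_j Num.sqrt `|area_incr (coord1 T X i) (coord1 T X j)
      (coord2 T X i j) (s, t)| @[t --> s] -->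
   \sum_i \sum_j Num.sqrt `|area_incr (coord1 T X i) (coord1 T X j)
      (coord2 T X i j) (s, s)|.
  apply: cvg_sum_fun => i; apply: cvg_sum_fun => j.
  apply: (@cvg_comp _ _ _ _ Num.sqrt); last exact: sqrt_continuous.
  apply: cvg_norm.
  have k1 : (fun _ : R => coord2 T X i j s) t @[t --> s] --> coord2 T X i j s.
    exact: cvg_cst.
  have k2 : (fun _ : R => coord1 T X j s) t @[t --> s] --> coord1 T X j s.
    exact: cvg_cst.
  exact: (cvgB (cvgB (c2 i j s) k1)
    (cvgMr (cvgB (c1 j s) k2))).
exact: (cvgD A (cvgMr B)).
Qed.

(** Conversely the Carnot-Caratheodory distance is dominated by a sum of these
    coordinates. *)
Lemma coord_sobolev_WG2 d (X : R -> tens2 R d) :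
  (forall t, 0 <= t <= T -> G2 (X t)) -> coord_sobolev T alpha p X -> WG2 T alpha p X.
Proof.
move=> XG cX; split.
- by move=> t; rewrite in_itv; exact: XG.
- move=> s; rewrite in_itv/= => sI.
  apply: (@squeeze_cvge _ _ _ _ (fun=> 0%E) _ (fun t => (boxincr X (s, t))%:E)).
  + near=> t; rewrite ccnorm_ge0/=; apply: (@dcc_le_boxincr _ X (s, t)) => //.
    apply/squareP; split => //=.
    have : t \in `[0, T] by near: t; exact: withinT.
    by rewrite in_itv.
  + exact: cvg_cst.
  + apply: cvg_within_filter; apply: cvg_EFin; first exact: nearW.
    exact: boxincr_cvg.
- have [_ _ FX] := finite_energy_boxincr cX; apply: le_lt_trans FX.
  apply: ge0_le_integral_nonmeas => u Qu.
    by rewrite mule_ge0 ?poweR_ge0// lee_fin sob_weight_ge0.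
  rewrite EFinM; apply: lee_wpmul2r; first by rewrite lee_fin sob_weight_ge0.
  rewrite -poweR_EFin; apply: gt0_ler_poweR; [exact: ltW| | |].
  + by rewrite in_itv/= ccnorm_ge0 leey.
  + by rewrite in_itv/= lee_fin boxincr_ge0 leey.
  + exact: dcc_le_boxincr.
Unshelve. all: by end_near. Qed.

End CoordinatesConverse.

(** * Extension of two Sobolev rough paths *)

Section Extension.
Context {R : realType}.
Variables (T alpha p : R) (k l : nat).
Hypotheses (T0 : 0 < T) (p2 : 2 <= p) (a0 : 0 < alpha) (a2 : alpha < 1 / 2).
Hypothesis ap : 1 / p < alpha.
Local Notation mu := (@lebesgue_measure R).
Local Notation FE := (finite_energy T alpha p).
Variables (X : R -> tens2 R k) (Y : R -> tens2 R l).

Let p0 : 0 < p. Proof. by move: p2; lra. Qed.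

Lemma area_incr_swap (x y B : R -> R) u :
  area_incr y x (fun t => y t * x t - B t) u =
  (x u.2 - x u.1) * (y u.2 - y u.1) - area_incr x y B u.
Proof.
rewrite /area_incr.
move: (x u.1) (x u.2) (y u.1) (y u.2) (B u.1) (B u.2) => *; ring.
Qed.

(** Integration by parts carries the regularity of one mixed area over to the
    other. *)
Lemma finite_energy_area_swap (x y B : R -> R) :
  continuous x -> continuous y -> continuous B ->
  FE (incr_power p x) -> FE (incr_power p y) ->
  FE (fun u => `|area_incr x y B u| `^ (p / 2)) ->
  FE (fun u => `|area_incr y x (fun t => y t * x t - B t) u| `^ (p / 2)).
Proof.
move=> cx cy cB Fx Fy FB.
have cC : continuous (fun t => y t * x t - B t).
  move=> t; exact: (cvgB (cvgM (cy t) (cx t)) (cB t)).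
have q0 : 0 <= p / 2 by rewrite divr_ge0// ltW.
have sq (a : R) : 0 <= a -> (a ^+ 2) `^ (p / 2) = a `^ p.
  by move=> a0'; rewrite -powR_mulrn// -powRrM; congr (_ `^ _); field.
apply: (finite_energy_le _ _ _ (finite_energyZ (powR_ge0 2 (p / 2))
  (finite_energyD (finite_energyZ (powR_ge0 2 (p / 2)) (finite_energyD Fx Fy)) FB))).
- by apply: measurable_abs_powR; exact: measurable_area_incr.
- by move=> u; exact: powR_ge0.
move=> u _; rewrite area_incr_swap.
apply: (le_trans (ge0_ler_powR2 q0 (normr_ge0 _) (ler_normB _ _))).
apply: (le_trans (powR_add_le q0 (normr_ge0 _) (normr_ge0 _))).
rewrite ler_wpM2l ?powR_ge0// lerD2r normrM.
have A := mul_le_sqrs (normr_ge0 (x u.2 - x u.1)) (normr_ge0 (y u.2 - y u.1)).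
apply: (le_trans (ge0_ler_powR2 q0 _ A)); first by rewrite mulr_ge0.
apply: (le_trans (powR_add_le q0 (sqr_ge0 _) (sqr_ge0 _))).
by rewrite !sq.
Qed.

(** Only the mixed entries of the second level are missing. Those of one block
    are substitutes of iterated integrals, and membership in the group determines
    the entries of the transposed block from them. *)
Lemma extension_exists : WG2 T alpha p X -> WG2 T alpha p Y ->
  admissible T alpha p X Y !=set0.
Proof.
move=> WX WY; have T00 := ltW T0.
have [cX1 cX2 SX1 SX2] := WG2_coord_sobolev T0 p0 WX.
have [cY1 cY2 SY1 SY2] := WG2_coord_sobolev T0 p0 WY.
have /choice[B0 HB0] : forall ij : 'I_k * 'I_l, exists B, continuous B /\
    (sobint T alpha p (fun u =>
      (`|area_incr (coord1 T X ij.1) (coord1 T Y ij.2) B u| `^ (p / 2))%R) < +oo)%E.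
  by move=> ij; apply: (area_exists T0 p2 a0 a2 ap).
pose x i := coord1 T X i; pose y j := coord1 T Y j.
pose B i j t := B0 (i, j) (clamp T t).
have cB i j : continuous (B i j).
  move=> t; apply: (@continuous_comp _ _ _ (clamp T) (B0 (i, j))).
    exact: clamp_continuous.
  exact: (HB0 (i, j)).1.
have FB i j : FE (fun u => `|area_incr (x i) (y j) (B i j) u| `^ (p / 2)).
  have FB0 := finite_energy_area (cX1 i) (cY1 j) (HB0 (i, j)).1 (HB0 (i, j)).2.
  apply: (finite_energy_le _ _ _ FB0).
  - by apply: measurable_abs_powR; apply: measurable_area_incr; [exact: cX1|exact: cY1|exact: cB].
  - by move=> u; exact: powR_ge0.
  - by move=> u /squareP[u1 u2]; rewrite /area_incr /B !clamp_id.
pose Z t : tens2 R (k + l) := (1, row_mx (X (clamp T t)).1.2 (Y (clamp T t)).1.2,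
  block_mx (X (clamp T t)).2 (\matrix_(i, j) B i j t)
    (\matrix_(j, i) (y j t * x i t - B i j t)) (Y (clamp T t)).2).
have cc t : clamp T (clamp T t) = clamp T t by rewrite clamp_id// clamp_itv.
have Zl i : coord1 T Z (lshift l i) = x i.
  by apply/funext => t; rewrite /coord1 /Z /= row_mxEl cc.
have Zr i : coord1 T Z (rshift k i) = y i.
  by apply/funext => t; rewrite /coord1 /Z /= row_mxEr cc.
have Zll i j : coord2 T Z (lshift l i) (lshift l j) = coord2 T X i j.
  by apply/funext => t; rewrite /coord2 /Z /= block_mxEul cc.
have Zrr i j : coord2 T Z (rshift k i) (rshift k j) = coord2 T Y i j.
  by apply/funext => t; rewrite /coord2 /Z /= block_mxEdr cc.
have Zlr i j : coord2 T Z (lshift l i) (rshift k j) = B i j.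
  by apply/funext => t; rewrite /coord2 /Z /= block_mxEur mxE /B cc.
have Zrl i j : coord2 T Z (rshift k j) (lshift l i) = fun t => y j t * x i t - B i j t.
  apply/funext => t; rewrite /coord2 /Z /= block_mxEdl mxE /B cc.
  by rewrite /x /y /coord1 cc.
have XG t : 0 <= t <= T -> G2 (X t).
  by move=> tI; case: WX => + _ _; apply; rewrite in_itv.
have YG t : 0 <= t <= T -> G2 (Y t).
  by move=> tI; case: WY => + _ _; apply; rewrite in_itv.
exists Z; split; last 2 first.
- move=> t; rewrite in_itv/= => tI; have /G2P[X1 _] := XG t tI.
  rewrite /projl /Z /= row_mxKl block_mxKul clamp_id// -X1.
  by case: (X t) => -[].
- move=> t; rewrite in_itv/= => tI; have /G2P[Y1 _] := YG t tI.
  rewrite /projr /Z /= row_mxKr block_mxKdr clamp_id// -Y1.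
  by case: (Y t) => -[].
apply: (coord_sobolev_WG2 p0).
  move=> t tI; have cI := clamp_itv t T00.
  have /G2P[_ XS] := XG _ cI; have /G2P[_ YS] := YG _ cI.
  apply/G2P; split => // i j; rewrite /Z /=.
  case: (split_ordP i) => i' ->; case: (split_ordP j) => j' ->.
  - by rewrite !block_mxEul !row_mxEl.
  - by rewrite block_mxEur block_mxEdl row_mxEl row_mxEr !mxE addrC subrK mulrC.
  - by rewrite block_mxEur block_mxEdl row_mxEl row_mxEr !mxE subrK.
  - by rewrite !block_mxEdr !row_mxEr.
split.
- by move=> i; case: (split_ordP i) => i' ->; rewrite ?Zl ?Zr; [exact: cX1|exact: cY1].
- move=> i j; case: (split_ordP i) => i' ->; case: (split_ordP j) => j' ->.
  + by rewrite Zll; exact: cX2.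
  + by rewrite Zlr; exact: cB.
  + rewrite Zrl => t; exact: (cvgB (cvgM (cY1 i' t) (cX1 j' t)) (cB j' i' t)).
  + by rewrite Zrr; exact: cY2.
- by move=> i; case: (split_ordP i) => i' ->; rewrite ?Zl ?Zr; [exact: SX1|exact: SY1].
- move=> i j; case: (split_ordP i) => i' ->; case: (split_ordP j) => j' ->.
  + by rewrite Zll !Zl; exact: SX2.
  + by rewrite Zlr Zl Zr; have [_ _] := FB i' j'.
  + rewrite Zrl Zl Zr.
    have [_ _] := finite_energy_area_swap (cX1 j') (cY1 i') (cB j' i')
      (finite_energy_incr (cX1 j') (SX1 j')) (finite_energy_incr (cY1 i') (SY1 i')) (FB j' i').
    exact: id.
  + by rewrite Zrr !Zr; exact: SY2.
Qed.

End Extension.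

(** * A Clarkson inequality for weighted energies *)

Section QuadraticPowers.
Context {R : realType}.
Variables (K : finType) (q : R).
Hypothesis q1 : 1 <= q.
Implicit Types a b : K -> R.

Definition sumsq_pow a : R := (\sum_k a k ^+ 2) `^ q.

Lemma sumsq_ge0 a : 0 <= \sum_k a k ^+ 2.
Proof. by apply: sumr_ge0 => k _; exact: sqr_ge0. Qed.

Lemma sumsq_pow_ge0 a : 0 <= sumsq_pow a.
Proof. exact: powR_ge0. Qed.

Lemma sumsq_powZ c a : sumsq_pow (fun k => c * a k) = (c ^+ 2) `^ q * sumsq_pow a.
Proof.
rewrite /sumsq_pow -powRM ?sqr_ge0 ?sumsq_ge0// mulr_sumr; congr (_ `^ _).
by apply: eq_bigr => k _; rewrite exprMn.
Qed.

(** The parallelogram identity raised to the power q >= 1, which is superadditive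
    and convex. *)
Lemma sumsq_pow_clarkson a b :
  sumsq_pow (fun k => (a k + b k) / 2) + sumsq_pow (fun k => (a k - b k) / 2) <=
  2^-1 * (sumsq_pow a + sumsq_pow b).
Proof.
have A0 := sumsq_ge0 a; have B0 := sumsq_ge0 b.
have q0 : 0 <= q by exact: le_trans q1.
apply: (le_trans (powR_superadd q1 (sumsq_ge0 _) (sumsq_ge0 _))).
rewrite mulrC; apply: le_trans (powR_convex_half q1 A0 B0).
rewrite le_eqVlt; apply/orP; left; apply/eqP; congr (_ `^ _).
rewrite -!big_split mulr_suml; apply: eq_bigr => k _ /=.
by move: (a k) (b k) => x y; field.
Qed.

End QuadraticPowers.

Section Energy.
Context d (U : measurableType d) {R : realType} (mu : {measure set U -> \bar R}).
Variables (D : set U) (mD : measurable D) (K : finType) (q : R) (w : U -> R).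
Hypotheses (q1 : 1 <= q) (mw : measurable_fun D w) (w0 : forall u, 0 <= w u).
Implicit Types h : K -> U -> R.

Definition energy h : \bar R :=
  (\int[mu]_(u in D) (sumsq_pow q (h ^~ u) * w u)%:E)%E.

Lemma energy_ge0 h : (0 <= energy h)%E.
Proof. by apply: integral_ge0 => u _; rewrite lee_fin mulr_ge0 ?sumsq_pow_ge0. Qed.

Lemma measurable_sumsq_pow h : (forall k, measurable_fun D (h k)) ->
  measurable_fun D (fun u => sumsq_pow q (h ^~ u)).
Proof.
move=> mh; apply: (measurableT_comp (measurable_powR q)).
by apply: measurable_sum => k; exact: measurable_funX.
Qed.

Lemma measurable_energy h : (forall k, measurable_fun D (h k)) ->
  measurable_fun D (fun u => (sumsq_pow q (h ^~ u) * w u)%:E).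
Proof.
by move=> mh; apply/measurable_EFinP; apply: measurable_funM => //;
  exact: measurable_sumsq_pow.
Qed.

Lemma energyZ c h : (forall k, measurable_fun D (h k)) ->
  energy (fun k u => c * h k u) = (((c ^+ 2) `^ q)%:E * energy h)%E.
Proof.
move=> mh; rewrite /energy; under eq_integral do rewrite sumsq_powZ -mulrA EFinM.
rewrite ge0_integralZl_EFin ?powR_ge0//; last exact: measurable_energy.
by move=> u _; rewrite lee_fin mulr_ge0 ?sumsq_pow_ge0.
Qed.

Lemma energyD h1 h2 :
  (forall k, measurable_fun D (h1 k)) -> (forall k, measurable_fun D (h2 k)) ->
  (energy h1 + energy h2 = \int[mu]_(u in D)
     ((sumsq_pow q (h1 ^~ u) + sumsq_pow q (h2 ^~ u)) * w u)%:E)%E.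
Proof.
move=> /measurable_energy m1 /measurable_energy m2.
have n0 h u : D u -> (0 <= (sumsq_pow q (h ^~ u) * w u)%:E)%E.
  by move=> _; rewrite lee_fin mulr_ge0 ?sumsq_pow_ge0.
rewrite /energy -(ge0_integralD mu mD (n0 h1) m1 (n0 h2) m2).
by apply: eq_integral => u _; rewrite mulrDl EFinD.
Qed.

Lemma energy_clarkson h1 h2 :
  (forall k, measurable_fun D (h1 k)) -> (forall k, measurable_fun D (h2 k)) ->
  (energy (fun k u => ((h1 k u + h2 k u) / 2)%R) +
   energy (fun k u => ((h1 k u - h2 k u) / 2)%R) <=
   (2^-1)%:E * (energy h1 + energy h2))%E.
Proof.
move=> m1 m2.
have mp k : measurable_fun D (fun u => (h1 k u + h2 k u) / 2).
  by apply: measurable_funM; [exact: measurable_funD|exact: measurable_cst].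
have mm k : measurable_fun D (fun u => (h1 k u - h2 k u) / 2).
  by apply: measurable_funM; [exact: measurable_funB|exact: measurable_cst].
have E1 := energyD mp mm; have E2 := energyD m1 m2.
rewrite [X in (X <= _)%E]E1 [X in (_ * X)%E]E2 {E1 E2}.
rewrite -ge0_integralZl_EFin ?invr_ge0//; last 2 first.
- by move=> u _; rewrite lee_fin mulr_ge0 ?addr_ge0 ?sumsq_pow_ge0.
- apply/measurable_EFinP; apply: measurable_funM => //.
  by apply: measurable_funD; exact: measurable_sumsq_pow.
apply: ge0_le_integral_nonmeas => u Du.
  by rewrite lee_fin mulr_ge0 ?addr_ge0 ?sumsq_pow_ge0.
rewrite -EFinM lee_fin mulrA ler_wpM2r//; exact: sumsq_pow_clarkson.
Qed.

Lemma energy_limit (h : nat -> K -> U -> R) (g : K -> U -> R) a :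
  (forall n k, measurable_fun D (h n k)) ->
  (forall k u, D u -> h n k u @[n --> \oo] --> g k u) ->
  (forall n, energy (h n) <= a)%E -> (energy g <= a)%E.
Proof.
move=> mh hg ha; pose F n u := (sumsq_pow q (fun k => h n k u) * w u)%:E.
have F0 n u : D u -> (0 <= F n u)%E.
  by move=> _; rewrite lee_fin mulr_ge0 ?sumsq_pow_ge0.
have mF n : measurable_fun D (F n) by exact: measurable_energy.
apply: le_trans _ (@integral_limn_einf_le _ _ _ mu D mD F a mF F0 ha).
apply: ge0_le_integral_nonmeas => u Du.
  by rewrite lee_fin mulr_ge0 ?sumsq_pow_ge0.
(* Powers converge only at positive limits; at a zero limit the bound is trivial. *)
have [g0|g0] := eqVneq (\sum_k g k u ^+ 2) 0.
  rewrite /sumsq_pow g0 powR0 ?mul0r; last by rewrite gt_eqF// (lt_le_trans _ q1).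
  apply: (@le_limn_einf _ _ (fun=> 0)); [exact: cvg_cst|apply: nearW => n].
  exact: F0.
have gp : 0 < \sum_k g k u ^+ 2 by rewrite lt_neqAle eq_sym g0 sumsq_ge0.
have cF : (sumsq_pow q (fun k => h n k u) * w u) @[n --> \oo] --> sumsq_pow q (g ^~ u) * w u.
  apply: cvgMl; rewrite /sumsq_pow.
  apply: powR_cvg gp _.
  apply: cvg_sum_fun => k.
  under eq_fun do rewrite expr2; rewrite expr2.
  by apply: cvgM; exact: hg.
apply: (le_limn_einf cF); apply: nearW => n; exact: lexx.
Qed.

End Energy.

(** * Families of continuous functions of finite Sobolev energy *)

Section SobolevFamilies.
Context {R : realType}.
Variables (T alpha p : R) (K : finType).
Hypotheses (T0 : 0 < T) (p2 : 2 <= p) (a0 : 0 < alpha) (ap : 1 / p < alpha).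
Local Notation mu := (@lebesgue_measure R).
Local Notation I := (`[0%R, T]%classic : set R).
Local Notation Q := (`[0%R, T]%classic `*` `[0%R, T]%classic : set (R * R)).
Local Notation w := (sob_weight alpha p).
Local Notation q := (p / 2).
Implicit Types f g : K -> R -> R.

Let q1 : 1 <= q.
Proof. by rewrite ler_pdivlMr// mul1r. Qed.

Definition lp_energy f : \bar R := energy mu I q (fun=> 1) f.

Definition sobolev_energy f : \bar R :=
  energy (mu \x mu)%E Q q w (fun k u => f k u.2 - f k u.1).

(** A power of a norm equivalent to the Sobolev norm. It is preferred to that norm,
    which is a sum of two roots, because it satisfies Clarkson's inequality. *)
Definition Wenergy f : \bar R := (lp_energy f + sobolev_energy f)%E.

Let m1 : measurable_fun I (fun=> 1 : R).
Proof. exact: measurable_cst. Qed.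

Let w1 (t : R) : 0 <= 1 :> R.
Proof. exact: ler01. Qed.

Let mw : measurable_fun Q w.
Proof. by apply: measurable_funTS; exact: measurable_sob_weight. Qed.

Let w0 : forall u, 0 <= w u := @sob_weight_ge0 R alpha p.

Let mf f : (forall k, continuous (f k)) -> forall k, measurable_fun I (f k).
Proof. by move=> cf k; apply: measurable_funTS; exact: continuous_measurable_fun. Qed.

Let mD f : (forall k, continuous (f k)) ->
  forall k, measurable_fun Q (fun u => f k u.2 - f k u.1).
Proof. by move=> cf k; apply: measurable_funTS; exact: measurable_incr. Qed.

Let mI : measurable I.
Proof. exact: measurable_itv. Qed.

Let mQ : measurable Q := @measurable_square R T.

Lemma lp_energy_ge0 f : (0 <= lp_energy f)%E.
Proof. exact: energy_ge0. Qed.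

Lemma sobolev_energy_ge0 f : (0 <= sobolev_energy f)%E.
Proof. exact: (@energy_ge0 _ _ R (mu \x mu)%E Q K q w w0). Qed.

Lemma Wenergy_ge0 f : (0 <= Wenergy f)%E.
Proof. exact: (adde_ge0 (lp_energy_ge0 f) (sobolev_energy_ge0 f)). Qed.

Lemma lp_energy_le f : (lp_energy f <= Wenergy f)%E.
Proof. exact: (leeDl _ (sobolev_energy_ge0 f)). Qed.

Lemma sobolev_energy_le f : (sobolev_energy f <= Wenergy f)%E.
Proof. exact: (leeDr _ (lp_energy_ge0 f)). Qed.

Lemma WenergyZ c f : (forall k, continuous (f k)) ->
  Wenergy (fun k t => c * f k t) = (((c ^+ 2) `^ q)%:E * Wenergy f)%E.
Proof.
move=> cf; rewrite /Wenergy ge0_muleDr ?lp_energy_ge0 ?sobolev_energy_ge0//.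
congr (_ + _)%E.
  exact: (energyZ mu mI q m1 w1 c (mf cf)).
rewrite -(energyZ (mu \x mu)%E mQ q mw w0 c (mD cf)); congr energy.
by apply/funext => k; apply/funext => u; rewrite mulrBr.
Qed.

Let leeD_scaled (c : R) (a b a' b' A B A' B' : \bar R) :
  (0 <= A -> 0 <= B -> 0 <= A' -> 0 <= B' ->
   a + b <= c%:E * (A + B) -> a' + b' <= c%:E * (A' + B') ->
   (a + a') + (b + b') <= c%:E * ((A + A') + (B + B')))%E.
Proof.
move=> A0 B0 A'0 B'0 H H'; rewrite addeACA [X in (_ <= _ * X)%E]addeACA.
by rewrite ge0_muleDr ?adde_ge0//; exact: leeD.
Qed.

Lemma Wenergy_clarkson f g :
  (forall k, continuous (f k)) -> (forall k, continuous (g k)) ->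
  (Wenergy (fun k t => ((f k t + g k t) / 2)%R) +
   Wenergy (fun k t => ((f k t - g k t) / 2)%R) <=
   (2^-1)%:E * (Wenergy f + Wenergy g))%E.
Proof.
move=> cf cg.
have A := energy_clarkson mu mI q1 m1 w1 (mf cf) (mf cg).
have B := energy_clarkson (mu \x mu)%E mQ q1 mw w0 (mD cf) (mD cg).
have ED (h h' : K -> R * R -> R) : h = h' ->
    energy (mu \x mu)%E Q q w h = energy (mu \x mu)%E Q q w h' by move=> ->.
rewrite (ED (fun k u => ((f k u.2 - f k u.1 + (g k u.2 - g k u.1)) / 2)%R)
  (fun k u => ((f k u.2 + g k u.2) / 2 - (f k u.1 + g k u.1) / 2)%R)) in B; last first.
  by apply/funext => k; apply/funext => u; rewrite -mulrBl addrACA -opprD.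
rewrite (ED (fun k u => ((f k u.2 - f k u.1 - (g k u.2 - g k u.1)) / 2)%R)
  (fun k u => ((f k u.2 - g k u.2) / 2 - (f k u.1 - g k u.1) / 2)%R)) in B; last first.
  apply/funext => k; apply/funext => u; rewrite -mulrBl; congr (_ / _).
  by move: (f k u.2) (f k u.1) (g k u.2) (g k u.1) => x1 x2 x3 x4; ring.
exact: (leeD_scaled (lp_energy_ge0 f) (lp_energy_ge0 g)
  (sobolev_energy_ge0 f) (sobolev_energy_ge0 g) A B).
Qed.

Let half_sum_lty (x y : \bar R) :
  (x < +oo -> y < +oo -> (2^-1)%:E * (x + y) < +oo)%E.
Proof.
move=> xy yy; rewrite lte_mul_pinfty ?lee_fin ?invr_ge0//.
exact: lte_add_pinfty.
Qed.

Lemma Wenergy_mid_lty f g :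
  (forall k, continuous (f k)) -> (forall k, continuous (g k)) ->
  (Wenergy f < +oo -> Wenergy g < +oo ->
   Wenergy (fun k t => ((f k t + g k t) / 2)%R) < +oo)%E.
Proof.
move=> cf cg Nf Ng; apply: (le_lt_trans (leeDl _ (Wenergy_ge0 _))).
exact: (le_lt_trans (Wenergy_clarkson cf cg) (half_sum_lty Nf Ng)).
Qed.

(** The factor 2 comes from applying Fatou's lemma separately to the two parts of
    the energy. *)
Lemma Wenergy_limit (h : nat -> K -> R -> R) g (a : R) :
  (forall n k, continuous (h n k)) ->
  (forall k t, 0 <= t <= T -> h n k t @[n --> \oo] --> g k t) ->
  (forall n, Wenergy (h n) <= a%:E)%E -> (Wenergy g <= (2 * a)%:E)%E.
Proof.
move=> ch hg ha; have -> : 2 * a = a + a by ring.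
rewrite EFinD; apply: leeD.
- apply: (@energy_limit _ _ R mu I mI K q (fun=> 1) q1 m1 w1 h g a%:E).
  + by move=> n; exact: mf.
  + by move=> k t; rewrite /= in_itv; exact: hg.
  + by move=> n; exact: le_trans (lp_energy_le _) (ha n).
- apply: (@energy_limit _ _ R (mu \x mu)%E Q mQ K q w q1 mw w0
    (fun n k u => h n k u.2 - h n k u.1) (fun k u => g k u.2 - g k u.1) a%:E).
  + by move=> n; exact: mD.
  + move=> k u /squareP[u1 u2]; exact: (cvgB (hg _ _ u2) (hg _ _ u1)).
  + by move=> n; exact: le_trans (sobolev_energy_le _) (ha n).
Qed.

Lemma abs_powR_le_sumsq_pow (a : K -> R) k : `|a k| `^ p <= sumsq_pow q a.
Proof.
have p0 : 0 < p by exact: lt_le_trans p2.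
rewrite -(sqrtr_sqr (a k)) sqrt_powR ?sqr_ge0//.
apply: ge0_ler_powR2; [by rewrite divr_ge0// ltW|exact: sqr_ge0|].
by rewrite (bigD1 k)//= lerDl sumr_ge0// => i _; exact: sqr_ge0.
Qed.

Lemma Wenergy_embedding f e k t : (forall k, continuous (f k)) -> 0 < e ->
  (Wenergy f <= ((e ^+ 2) `^ q)%:E)%E -> 0 <= t <= T ->
  `|f k t| <= sob_const T alpha p * e.
Proof.
move=> cf e0 fe tI; pose g k t := e^-1 * f k t.
have g1 : (Wenergy g <= 1%:E)%E.
  rewrite WenergyZ//; apply: le_trans (lee_wpmul2l _ fe) _; first exact: powR_ge0.
  by rewrite -EFinM -powRM ?sqr_ge0// -exprMn mulVf ?gt_eqF// expr1n powR1.
have cg : continuous (g k).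
  by move=> s; apply: cvgMr; exact: cf.
have : `|g k t| <= sob_const T alpha p.
  apply: (sobolev_embedding T0 p2 a0 ap cg tI).
  - apply: le_trans (le_trans (lp_energy_le _) g1).
    apply: ge0_le_integral_nonmeas => s _; first by rewrite lee_fin powR_ge0.
    by rewrite lee_fin mulr1; exact: (abs_powR_le_sumsq_pow (g ^~ s)).
  - apply: le_trans (le_trans (sobolev_energy_le _) g1).
    apply: ge0_le_integral_nonmeas => u _.
      by rewrite lee_fin mulr_ge0 ?powR_ge0 ?w0.
    rewrite lee_fin ler_wpM2r ?w0//.
    exact: (abs_powR_le_sumsq_pow (fun k => g k u.2 - g k u.1)).
by rewrite /g normrM gtr0_norm ?invr_gt0// ler_pdivrMl// mulrC.
Qed.

(** Completeness: by the Sobolev embedding a fast Cauchy sequence converges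
    uniformly on [0, T], and Fatou's lemma bounds its distance to the limit. *)
Lemma Wenergy_complete (x : nat -> K -> R -> R) :
  (forall n k, continuous (x n k)) ->
  (forall n m, (n <= m)%N ->
     Wenergy (fun k t => (x n k t - x m k t)%R) <= ((((2^-1) ^+ n) ^+ 2) `^ q)%:E)%E ->
  exists f, [/\ forall k, continuous (f k),
    forall n, (Wenergy (fun k t => (x n k t - f k t)%R) <=
      (2 * (((2^-1) ^+ n) ^+ 2) `^ q)%:E)%E &
    forall M, (forall n, Wenergy (x n) <= M%:E)%E -> (Wenergy f <= (2 * M)%:E)%E].
Proof.
move=> cx xC; have T00 := ltW T0.
have h01 : 0 < (2^-1 : R) < 1 by rewrite invr_gt0 ltr0n invf_lt1 ?ltr1n.
have sc k n t : `|x n.+1 k (clamp T t) - x n k (clamp T t)| <=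
    sob_const T alpha p * (2^-1) ^+ n.
  rewrite distrC; have [h0 _] := andP h01.
  apply: (@Wenergy_embedding (fun k t => x n k t - x n.+1 k t)) => //.
  - by move=> i s; apply: cvgB; exact: cx.
  - exact: xC.
  - exact: clamp_itv.
have /choice[f Hf] : forall k, exists g : R -> R, continuous g /\
    forall t, 0 <= t <= T -> x n k t @[n --> \oo] --> g t.
  move=> k.
  have sc0 : 0 <= sob_const T alpha p.
    by have := le_trans (normr_ge0 _) (sc k 0%N 0); rewrite expr0 mulr1.
  have cxc n : continuous (fun t => x n k (clamp T t)).
    by move=> t; apply: continuous_comp; [exact: clamp_continuous|exact: cx].
  have [g [cg gl]] := geometric_limit sc0 h01 cxc (sc k).
  exists g; split => // t tI; have := gl t.
  by under eq_fun do rewrite clamp_id//.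
have cf k : continuous (f k) by have [] := Hf k.
have fl k t : 0 <= t <= T -> x n k t @[n --> \oo] --> f k t by have [_] := Hf k; apply.
exists f; split=> //.
- move=> n; apply: (Wenergy_limit (h := fun m k t => x n k t - x (n + m)%N k t)).
  + by move=> m k t; apply: cvgB; exact: cx.
  + move=> k t tI; apply: cvgB; first exact: cvg_cst.
    have := fl k t tI; rewrite -(cvg_shiftn n (fun m => x m k t)).
    by under eq_fun do rewrite addnC.
  + by move=> m; apply: xC; exact: leq_addr.
- by move=> M xM; exact: (Wenergy_limit (h := x)).
Qed.

End SobolevFamilies.

(** * Nested convex sets *)

Section NestedConvexSets.
Context {R : realType}.
Variables (T alpha p : R) (K : finType).
Hypotheses (T0 : 0 < T) (p2 : 2 <= p) (a0 : 0 < alpha) (ap : 1 / p < alpha).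
Local Notation N := (@Wenergy R T alpha p K).
Local Notation q := (p / 2).
Local Notation eta n := ((((2^-1) ^+ n) ^+ 2) `^ q).

Variables (C : nat -> set (K -> R -> R)) (M : R).
Hypothesis C_cont : forall n f, C n f -> forall k, continuous (f k).
Hypothesis C_nonempty : forall n, C n !=set0.
Hypothesis C_nested : forall n, C n.+1 `<=` C n.
Hypothesis C_mid : forall n f g, C n f -> C n g ->
  C n (fun k t => (f k t + g k t) / 2).
Hypothesis C_bound : forall f, C 0 f -> (N f <= M%:E)%E.

Let C_le m n : (m <= n)%N -> C n `<=` C m.
Proof.
elim: n => [|n IH]; first by rewrite leqn0 => /eqP ->.
rewrite leq_eqVlt => /orP[/eqP -> //|mn].
exact: subset_trans (@C_nested n) (IH mn).
Qed.

Let v f : R := fine (N f).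

Let vE n f : C n f -> N f = (v f)%:E.
Proof.
move=> /(C_le (leq0n n)) /C_bound fM; rewrite fineK// ge0_fin_numE ?Wenergy_ge0//.
exact: le_lt_trans fM (ltry _).
Qed.

(** D is the limit of the infima of the energy over the sets, which increase and
    are bounded. *)
Let minimal_energy : exists D : R,
  (forall e, 0 < e -> exists n, forall f, C n f -> D - e <= v f) /\
  (forall e n, 0 < e -> exists2 f, C n f & v f <= D + e).
Proof.
pose S := [set r : R | exists n, forall f, C n f -> r <= v f].
have S0 : S 0 by exists 0%N => f _; rewrite fine_ge0// Wenergy_ge0.
have SM : ubound S M.
  move=> r [n rn]; have [f Cf] := C_nonempty n; apply: (le_trans (rn _ Cf)).
  by rewrite -lee_fin -(vE Cf) C_bound//; exact: C_le (leq0n n) _ Cf.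
have supS : has_sup S by split; [exists 0|exists M].
exists (sup S); split.
- move=> e e0; have [r [n rn] rS] := sup_adherent e0 supS.
  by exists n => f Cf; exact: (le_trans (ltW rS) (rn f Cf)).
- move=> e n e0; apply: contrapT => nex.
  have Se : S (sup S + e).
    exists n => f Cf; apply/ltW; rewrite ltNge; apply/negP => vf.
    by apply: nex; exists f.
  have := ub_le_sup supS.2 Se; rewrite gerDl leNgt => /negP; exact.
Qed.

Let level_gap (a b m D e : R) (y : \bar R) :
  D - e <= m -> a <= D + e -> b <= D + e -> (0 <= y)%E ->
  (m%:E + y <= (2^-1)%:E * (a%:E + b%:E))%E -> (y <= (2 * e)%:E)%E.
Proof.
move=> mD aD bD; case: y => [r|_|]; last by [].
- by rewrite -!EFinD -!EFinM !lee_fin => r0 H; lra.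
- by rewrite -EFinD -EFinM addeC addye// leye_eq.
Qed.

(** Elements of nearly minimal energy form a Cauchy sequence: their midpoints
    belong to the sets as well, so that Clarkson's inequality leaves no room for
    their differences. *)
Lemma nested_convex_sets : exists (f : K -> R -> R) (x : nat -> K -> R -> R),
  [/\ forall k, continuous (f k), forall n, C n (x n), (N f <= (2 * M)%:E)%E &
      forall n, (N (fun k t => (x n k t - f k t)%R) <= (2 * eta n)%:E)%E].
Proof.
have [D [Dlow Dup]] := minimal_energy.
have q0 : 0 < q by rewrite divr_gt0// (lt_le_trans _ p2).
have c0 : 0 < (2 ^+ 2) `^ q :> R by rewrite powR_gt0// exprn_gt0.
(* With this margin Clarkson's inequality yields exactly eta n. *)
pose e n : R := eta n / (2 * (2 ^+ 2) `^ q).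
have e0 n : 0 < e n.
  by rewrite divr_gt0 ?mulr_gt0// powR_gt0// exprn_gt0// exprn_gt0// invr_gt0.
have e_anti m n : (n <= m)%N -> e m <= e n.
  move=> nm; rewrite ler_wpM2r ?invr_ge0 ?mulr_ge0 ?(ltW c0)//.
  apply: ge0_ler_powR2; [exact: ltW|exact: sqr_ge0|].
  rewrite lerXn2r ?nnegrE ?exprn_ge0 ?invr_ge0//.
  by rewrite ler_wiXn2l ?invr_ge0// invf_le1// ler1n.
have /choice[j Hj] : forall n, exists i, forall f, C i f -> D - e n <= v f.
  by move=> n; exact: Dlow.
(* A monotone choice of indices beyond the thresholds j n. *)
pose i n := (\sum_(m < n.+1) j m + n)%N.
have i_j n : (j n <= i n)%N by rewrite /i big_ord_recr/= -addnA addnCA leq_addr.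
have i_n n : (n <= i n)%N by rewrite leq_addl.
have i_mono m n : (m <= n)%N -> (i m <= i n)%N.
  elim: n => [|n IH]; first by rewrite leqn0 => /eqP ->.
  rewrite leq_eqVlt => /orP[/eqP -> //|/IH /leq_trans]; apply.
  by rewrite /i [in leqRHS]big_ord_recr/= -addnA leq_add2l addnS ltnW// ltnS leq_addl.
have /choice[x Hx] : forall n, exists f, C (i n) f /\ v f <= D + e n.
  by move=> n; have [f] := Dup (e n) (i n) (e0 n); exists f.
have Cx n : C (i n) (x n) by have [] := Hx n.
have cx n k : continuous (x n k) by exact: C_cont (Cx n) k.
have xC n m : (n <= m)%N ->
    (N (fun k t => (x n k t - x m k t)%R) <= (eta n)%:E)%E.
  move=> nm; have Cm : C (i n) (x m) by exact: C_le (i_mono _ _ nm) _ (Cx m).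
  have Cmid := C_mid (Cx n) Cm.
  have := Wenergy_clarkson T alpha p2 (cx n) (cx m).
  have low := Hj n _ (C_le (i_j n) Cmid).
  have [_ un] := Hx n; have [_ um] := Hx m; have em := e_anti _ _ nm.
  rewrite (vE Cmid) (vE (Cx n)) (vE (Cx m)).
  set g := fun k t => (x n k t - x m k t) / 2.
  have -> : (fun k t => x n k t - x m k t) = fun k t => 2 * g k t.
    by apply/funext => k; apply/funext => t; rewrite /g mulrC divfK.
  rewrite WenergyZ//; last first.
    move=> k t; apply: cvgMl; apply: cvgB; exact: cx.
  move=> H.
  have un' : v (x m) <= D + e n by apply: (le_trans um); rewrite lerD2l.
  have r1 := level_gap low un un' (Wenergy_ge0 T alpha p g) H.
  apply: (le_trans (lee_wpmul2l _ r1)); first by rewrite lee_fin (ltW c0).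
  rewrite -EFinM lee_fin le_eqVlt; apply/orP; left; apply/eqP; rewrite /e.
  move: c0; move: (_ `^ q) (eta n) => c b c0; field; exact: lt0r_neq0.
have [f [cf xf fM]] := Wenergy_complete T0 p2 a0 ap cx xC.
exists f, x; split => //.
- by move=> n; exact: C_le (i_n n) _ (Cx n).
- by apply: fM => n; apply: C_bound; exact: C_le (leq0n _) _ (Cx n).
Qed.

End NestedConvexSets.

(** * Tensor-valued functions in coordinates *)

Section TensorCoordinates.
Context {R : realType}.
Variables (T alpha p : R) (d : nat).
Hypotheses (T0 : 0 < T) (p2 : 2 <= p).
Local Notation mu := (@lebesgue_measure R).
Local Notation Q := (`[0%R, T]%classic `*` `[0%R, T]%classic : set (R * R)).
Local Notation K := ('I_d + 'I_d * 'I_d)%type.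
Local Notation N := (@Wenergy R T alpha p K).
Local Notation q := (p / 2).
Implicit Types (f g : K -> R -> R) (k : K).

Definition tcoord (v : tens2plus R d) k : R :=
  match k with inl i => v.1 0 i | inr ij => v.2 ij.1 ij.2 end.

Definition tensor_path f : R -> tens2plus R d :=
  fun t => (\row_i f (inl i) t, \matrix_(i, j) f (inr (i, j)) t).

Lemma tcoord_path f k t : tcoord (tensor_path f t) k = f k t.
Proof. by case: k => [i|[i j]]; rewrite /= mxE. Qed.

Lemma enorm2_powR (v : tens2plus R d) : enorm2 v `^ p = sumsq_pow q (tcoord v).
Proof.
have E : \sum_i v.1 0 i ^+ 2 + \sum_i \sum_j v.2 i j ^+ 2 = \sum_k tcoord v k ^+ 2.
  by rewrite big_sumType/= pair_bigA.
by rewrite /enorm2 E sqrt_powR ?sumsq_ge0.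
Qed.

Lemma combination_half f g :
  combination 2^-1 (tensor_path f) (tensor_path g) =
  tensor_path (fun k t => (f k t + g k t) / 2).
Proof.
have h : 1 - 2^-1 = 2^-1 :> R by field.
apply/funext => t; rewrite /combination h /tensor_path.
congr (_, _); [apply/rowP => i|apply/matrixP => i j]; rewrite !mxE;
  by rewrite mulrC [X in _ + X]mulrC -mulrDl.
Qed.

Lemma tensor_pathB f g :
  (fun t => tensor_path f t - tensor_path g t) =
  tensor_path (fun k t => f k t - g k t).
Proof.
apply/funext => t; rewrite /tensor_path.
by congr (_, _); [apply/rowP => i|apply/matrixP => i j]; rewrite !mxE.
Qed.

Lemma sob_norm_path f : sob_norm T alpha p (tensor_path f) =
  (lp_energy T p f `^ p^-1 + sobolev_energy T alpha p f `^ p^-1)%E.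
Proof.
have E1 : (\int[mu]_(t in `[0%R, T]) (enorm2 (tensor_path f t) `^ p)%:E =
    lp_energy T p f)%E.
  apply: eq_integral => t _; rewrite enorm2_powR mulr1; congr (_%:E).
  by congr sumsq_pow; apply/funext => k; rewrite tcoord_path.
have E2 : (\int[(mu \x mu)%E]_(u in Q)
      (enorm2 (tensor_path f u.2 - tensor_path f u.1) `^ p *
       sob_weight alpha p u)%:E = sobolev_energy T alpha p f)%E.
  apply: eq_integral => u _; rewrite enorm2_powR; congr (_ * _)%:E.
  by congr sumsq_pow; apply/funext => -[i|[i j]]; rewrite /= !mxE.
exact: (f_equal2 (fun a b => a `^ p^-1 + b `^ p^-1)%E E1 E2).
Qed.

Let p0 : 0 < p.
Proof. exact: lt_le_trans p2. Qed.

Let root_le (x : \bar R) (e : R) : 0 <= e ->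
  (0 <= x -> (x `^ p^-1 <= e%:E) <-> x <= (e `^ p)%:E)%E.
Proof.
move=> e0; case: x => [x|_|]; last by [].
  rewrite lee_fin => x0; rewrite poweR_EFin !lee_fin; split=> H.
    have := ge0_ler_powR2 (ltW p0) (powR_ge0 x p^-1) H.
    by rewrite -powRrM mulVf ?gt_eqF// powRr1.
  have := ge0_ler_powR2 (_ : 0 <= p^-1) x0 H; rewrite -powRrM mulfV ?gt_eqF// powRr1//.
  by apply; rewrite invr_ge0 ltW.
by rewrite poweRyr ?invr_eq0 ?gt_eqF// !leye_eq; split.
Qed.

(** The Sobolev norm adds the roots of two terms of the energy, whence the factor 2. *)
Lemma sob_norm_le f e : 0 <= e -> (N f <= (e `^ p)%:E)%E ->
  (sob_norm T alpha p (tensor_path f) <= (2 * e)%:E)%E.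
Proof.
move=> e0 H; have -> : 2 * e = e + e by ring.
rewrite sob_norm_path EFinD; apply: leeD.
  by apply/root_le => //; [exact: lp_energy_ge0|exact: le_trans (lp_energy_le _ _ _ _) H].
apply/root_le => //; first exact: sobolev_energy_ge0.
exact: le_trans (sobolev_energy_le _ _ _ _) H.
Qed.

Lemma Wenergy_le f e : 0 <= e -> (sob_norm T alpha p (tensor_path f) <= e%:E)%E ->
  (N f <= (2 * e `^ p)%:E)%E.
Proof.
move=> e0; rewrite sob_norm_path => H; have -> : 2 * e `^ p = e `^ p + e `^ p by ring.
rewrite EFinD; apply: leeD; apply/root_le => //.
- exact: lp_energy_ge0.
- by apply: le_trans H; rewrite leeDl// poweR_ge0.
- exact: sobolev_energy_ge0.
- by apply: le_trans H; rewrite leeDr// poweR_ge0.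
Qed.

Lemma tensor_path_W f : (forall k, continuous (f k)) -> (N f < +oo)%E ->
  Wtens2 T alpha p (tensor_path f).
Proof.
move=> cf fN; split.
- move=> i; apply: measurable_funTS; under eq_fun do rewrite /= mxE.
  exact: continuous_measurable_fun.
- move=> i j; apply: measurable_funTS; under eq_fun do rewrite /= mxE.
  exact: continuous_measurable_fun.
- have [r r0 rN] : exists2 r, 0 <= r & N f = r%:E.
    exists (fine (N f)); first by rewrite fine_ge0// Wenergy_ge0.
    by rewrite fineK// ge0_fin_numE// Wenergy_ge0.
  apply: (@le_lt_trans _ _ (2 * r `^ p^-1)%:E); last exact: ltry.
  apply: sob_norm_le; first exact: powR_ge0.
  by rewrite rN -powRrM mulVf ?gt_eqF// powRr1.
Qed.

End TensorCoordinates.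

Section FrozenCoordinates.
Context {R : realType}.
Variables (T alpha p : R) (d : nat).
Hypotheses (T0 : 0 < T) (p2 : 2 <= p).
Local Notation mu := (@lebesgue_measure R).
Local Notation Q := (`[0%R, T]%classic `*` `[0%R, T]%classic : set (R * R)).
Local Notation K := ('I_d + 'I_d * 'I_d)%type.
Local Notation N := (@Wenergy R T alpha p K).
Local Notation q := (p / 2).
Local Notation FE := (finite_energy T alpha p).

Definition frozen_coords (Z : R -> tens2 R d) (k : K) : R -> R :=
  match k with
  | inl i => coord1 T Z i
  | inr ij => coord2 T Z ij.1 ij.2
  end.

Let p0 : 0 < p.
Proof. exact: lt_le_trans p2. Qed.

Let q0 : 0 <= q.
Proof. by rewrite divr_ge0// ltW. Qed.

(** The second level of a group-valued path, read in the ambient linear space,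
    has an increment which is an area plus the product of a bounded function
    with an increment of the first level. *)
Lemma finite_energy_coord2 x y B : continuous x -> continuous y -> continuous B ->
  FE (incr_power p y) -> FE (fun u => `|area_incr x y B u| `^ q) ->
  FE (incr_power p B).
Proof.
move=> cx cy cB Fy FB.
have [Mx Mx0 xM] := continuous_bounded T0 cx.
have [My My0 yM] := continuous_bounded T0 cy.
have [MB MB0 BM] := continuous_bounded T0 cB.
pose Ma := MB + MB + Mx * (My + My).
have F1 := finite_energyZ (powR_ge0 Ma q) FB.
have F2 := finite_energyZ (powR_ge0 Mx p) Fy.
apply: finite_energy_le (finite_energyZ (powR_ge0 2 p) (finite_energyD F1 F2)).
- exact: measurable_incr_power.
- by move=> u; exact: powR_ge0.
move=> u /squareP[u1 u2].
have y_le : `|y u.2 - y u.1| <= My + My.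
  by apply: (le_trans (ler_normB _ _)); rewrite lerD ?yM.
have a_le : `|area_incr x y B u| <= Ma.
  apply: (le_trans (ler_normB _ _)); rewrite normrM; apply: lerD.
    by apply: (le_trans (ler_normB _ _)); rewrite lerD ?BM.
  by apply: ler_pM => //; exact: xM.
have E : B u.2 - B u.1 = area_incr x y B u + x u.1 * (y u.2 - y u.1).
  by rewrite /area_incr subrK.
apply: (@le_trans _ _ ((`|area_incr x y B u| + Mx * `|y u.2 - y u.1|) `^ p)).
  apply: ge0_ler_powR2; [exact: ltW|exact: normr_ge0|].
  rewrite E; apply: (le_trans (ler_normD _ _)); rewrite lerD2l normrM.
  by rewrite ler_wpM2r// xM.
apply: (le_trans (powR_add_le (ltW p0) (normr_ge0 _) (mulr_ge0 Mx0 (normr_ge0 _)))).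
rewrite ler_wpM2l ?powR_ge0//; apply: lerD; last by rewrite powRM.
have pE : q + q = p by field.
have -> : `|area_incr x y B u| `^ p =
    `|area_incr x y B u| `^ q * `|area_incr x y B u| `^ q.
  by rewrite -powRD pE // (gt_eqF p0).
by rewrite ler_wpM2r ?powR_ge0//; exact: ge0_ler_powR2.
Qed.

Lemma Wenergy_finite (f : K -> R -> R) : (forall k, continuous (f k)) ->
  (forall k, FE (incr_power p (f k))) -> (N f < +oo)%E.
Proof.
move=> cf fS.
have norm_le (a : K -> R) : sumsq_pow q a <= (\sum_k `|a k|) `^ p.
  have S0 : 0 <= \sum_k `|a k| by exact: sumr_ge0.
  rewrite -[X in _ <= X `^ _]ger0_norm// -sqrtr_sqr sqrt_powR ?sqr_ge0//.
  by apply: ge0_ler_powR2; [|exact: sumsq_ge0|exact: sum_sqr_le].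
apply: lte_add_pinfty.
- have /choice[M HM] : forall k, exists M : R,
      0 <= M /\ forall t, 0 <= t <= T -> `|f k t| <= M.
    by move=> k; have [M] := continuous_bounded T0 (cf k); exists M.
  apply: (@le_lt_trans _ _
    (\int[mu]_(t in `[0%R, T]) (cst ((\sum_k M k) `^ p)%:E) t)%E).
    apply: ge0_le_integral_nonmeas => t tI.
      by rewrite lee_fin mulr1 powR_ge0.
    rewrite /cst lee_fin mulr1; apply: (le_trans (norm_le _)).
    apply: ge0_ler_powR2; [exact: ltW|exact: sumr_ge0|].
    apply: ler_sum => k _; have [_] := HM k; apply.
    by move: tI; rewrite /= in_itv.
  rewrite integral_cst//= lebesgue_measure_itv/= lte_fin T0 oppr0 addr0.
  exact: ltry.
- have F : FE (fun u => (\sum_k `|f k u.2 - f k u.1|) `^ p).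
    apply: (finite_energy_powR_sum p0) => [k|k u|k].
    + apply: (measurableT_comp (@normr_measurable R setT)); exact: measurable_incr.
    + exact: normr_ge0.
    + exact: fS.
  have [_ _] := F; apply: le_lt_trans; apply: ge0_le_integral_nonmeas => u _.
    by rewrite lee_fin mulr_ge0 ?powR_ge0 ?sob_weight_ge0.
  by rewrite lee_fin ler_wpM2r ?sob_weight_ge0.
Qed.

Lemma frozen_coords_W (Z : R -> tens2 R d) : WG2 T alpha p Z ->
  (forall k, continuous (frozen_coords Z k)) /\ (N (frozen_coords Z) < +oo)%E.
Proof.
move=> /(WG2_coord_sobolev T0 p0)[c1 c2 S1 S2].
have cZ k : continuous (frozen_coords Z k) by case: k => [i|[i j]]; [exact: c1|exact: c2].
split; first exact: cZ.
apply: Wenergy_finite cZ _ => -[i|[i j]].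
  exact: finite_energy_incr (c1 i) (S1 i).
exact: finite_energy_coord2 (c1 i) (c1 j) (c2 i j)
  (finite_energy_incr (c1 j) (S1 j)) (finite_energy_area (c1 i) (c1 j) (c2 i j) (S2 i j)).
Qed.

Lemma frozen_coordsE (Z : R -> tens2 R d) t : 0 <= t <= T ->
  tensor_path (frozen_coords Z) t = drop_scalar Z t.
Proof.
move=> tI; rewrite /tensor_path /drop_scalar.
by congr (_, _); [apply/rowP => i|apply/matrixP => i j];
  rewrite mxE /= /coord1 /coord2 clamp_id.
Qed.

End FrozenCoordinates.

(** * Minimization *)

Section Minimization.
Context {R : realType}.
Variables (T alpha p : R) (d : nat).
Hypotheses (T0 : 0 < T) (p2 : 2 <= p) (a0 : 0 < alpha) (ap : 1 / p < alpha).
Local Notation mu := (@lebesgue_measure R).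
Local Notation K := ('I_d + 'I_d * 'I_d)%type.
Local Notation N := (@Wenergy R T alpha p K).
Local Notation W := (@Wtens2 R T alpha p d).
Implicit Types (f g : K -> R -> R) (Z : R -> tens2 R d).

Lemma Wtens2_congr (g h : R -> tens2plus R d) :
  (forall t, 0 <= t <= T -> g t = h t) -> W g -> W h.
Proof.
move=> gh [m1 m2 gS].
have ghI t : t \in `[0, T]%classic -> g t = h t.
  by rewrite inE /= in_itv; exact: gh.
split.
- move=> i; apply: eq_measurable_fun (m1 i) => t /ghI ->//.
- move=> i j; apply: eq_measurable_fun (m2 i j) => t /ghI ->//.
- suff -> : sob_norm T alpha p h = sob_norm T alpha p g by [].
  have E1 : (\int[mu]_(t in `[0%R, T]) (enorm2 (h t) `^ p)%:E =
      \int[mu]_(t in `[0%R, T]) (enorm2 (g t) `^ p)%:E)%E.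
    by apply: eq_integral => t /ghI ->.
  have E2 : (\int[(mu \x mu)%E]_(u in `[0%R, T] `*` `[0%R, T])
        (enorm2 (h u.2 - h u.1) `^ p * sob_weight alpha p u)%:E =
      \int[(mu \x mu)%E]_(u in `[0%R, T] `*` `[0%R, T])
        (enorm2 (g u.2 - g u.1) `^ p * sob_weight alpha p u)%:E)%E.
    by apply: eq_integral => u; rewrite inE => /squareP[u1 u2]; rewrite !gh.
  exact: (f_equal2 (fun a b => a `^ p^-1 + b `^ p^-1)%E E1 E2).
Qed.

Lemma pointwise_aeeq (g h : R -> tens2plus R d) :
  (forall t, 0 <= t <= T -> g t = h t) -> aeeq T g h.
Proof. by move=> gh; apply: aeW => t; rewrite in_itv; exact: gh. Qed.

Lemma drop_scalar_W Z : WG2 T alpha p Z -> W (drop_scalar Z).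
Proof.
move=> WZ; have [cZ NZ] := frozen_coords_W T0 p2 WZ.
apply: Wtens2_congr (tensor_path_W p2 cZ NZ) => t tI.
exact: frozen_coordsE.
Qed.

Lemma frozen_coords_aeeq Z : aeeq T (tensor_path (frozen_coords T Z)) (drop_scalar Z).
Proof. by apply: pointwise_aeeq => t; exact: frozen_coordsE. Qed.

(** A set of full measure in [0, T] is dense in [0, T]. *)
Lemma continuous_ae_eq (x y : R -> R) : continuous x -> continuous y ->
  {ae mu, forall t, t \in `[0, T] -> x t = y t} ->
  forall t, 0 <= t <= T -> x t = y t.
Proof.
move=> cx cy [B [mB B0 xyB]] t /andP[t0 tT]; apply: contrapT => /eqP xyt.
have cz : (fun s => x s - y s) s @[s --> t] --> x t - y t.
  by apply: cvgB; [exact: cx|exact: cy].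
have zt : x t - y t != 0 by rewrite subr_eq0.
have /nbhs_ballP[e /= e0 He] : \forall s \near t, x s - y s != 0.
  exact: (cvgr_neq0 (x t - y t) cz zt).
pose a := Num.max 0 (t - e / 2); pose b := Num.min T (t + e / 2).
have ab : a < b.
  rewrite /a /b gt_max !lt_min T0 /=; have e2 : 0 < e / 2 by rewrite divr_gt0.
  by apply/and3P; split; lra.
have sub : `[a, b] `<=` B.
  move=> s; rewrite /= in_itv/= /a /b le_min ge_max => /andP[/andP[s0 s1] /andP[sT s2]].
  apply: xyB => /= H; have := He s; rewrite /ball /= ltr_distlC.
  have st : t - e < s < t + e by apply/andP; split; lra.
  move=> /(_ st); rewrite H ?subrr ?eqxx// in_itv/= s0//.
have : (mu `[a, b]%classic <= 0)%E.
  by rewrite -B0; apply: le_measure; rewrite ?inE//; exact: measurable_itv.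
by rewrite lebesgue_measure_itv/= lte_fin ab -EFinB lee_fin subr_le0 leNgt ab.
Qed.

Section Functional.
Variables (A : set (R -> tens2 R d)) (F : (R -> tens2 R d) -> \bar R).
Variable Phi : (R -> tens2plus R d) -> \bar R.
Hypothesis A_W : A `<=` @WG2 R T alpha p d.
Hypothesis F_proper : proper_on A F.
Hypothesis Phi_W : functional_on_W T alpha p Phi.
Hypothesis Phi_ext : extends_by_infty T alpha p A F Phi.

Lemma Phi_frozen Z : A Z -> Phi (tensor_path (frozen_coords T Z)) = F Z.
Proof.
move=> AZ; have WZ := A_W AZ; have [cZ NZ] := frozen_coords_W T0 p2 WZ.
rewrite -(Phi_ext.1 _ AZ); apply: Phi_W.2; first exact: tensor_path_W.
  exact: drop_scalar_W.
exact: frozen_coords_aeeq.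
Qed.

(** A finite value forces admissibility, because the extension is infinite
    elsewhere. *)
Lemma finite_Phi_attained f : (forall k, continuous (f k)) -> (N f < +oo)%E ->
  (Phi (tensor_path f) < +oo)%E -> exists2 Z, A Z & F Z = Phi (tensor_path f).
Proof.
move=> cf Nf fin; have Wf := tensor_path_W p2 cf Nf; apply: contrapT => nZ.
suff E : Phi (tensor_path f) = +oo%E by rewrite E in fin.
apply: (Phi_ext.2 _ Wf) => Z AZ fZ; apply: nZ; exists Z; first exact: AZ.
rewrite -(Phi_ext.1 _ AZ).
exact: (esym (Phi_W.2 _ _ Wf (drop_scalar_W (A_W AZ)) fZ)).
Qed.

Lemma half_average (b x y : \bar R) : (x <= b -> y <= b ->
  (2^-1)%:E * x + (1 - 2^-1)%:E * y <= b)%E.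
Proof.
move=> xb yb; have -> : 1 - 2^-1 = 2^-1 :> R by field.
apply: (@le_trans _ _ ((2^-1)%:E * b + (2^-1)%:E * b)%E).
  by apply: leeD; apply: lee_wpmul2l => //; rewrite lee_fin invr_ge0.
rewrite -ge0_muleDl ?lee_fin ?invr_ge0// -EFinD.
by have -> : 2^-1 + 2^-1 = 1 :> R by [field]; rewrite mul1e.
Qed.

Let geometric_small (e : R) i : 0 < e -> exists2 n, (i <= n)%N & 4 * (2^-1) ^+ n < e.
Proof.
move=> e0; exists (maxn i (Num.bound (4 / e))); first exact: leq_maxl.
set n := maxn _ _; have n1 : 4 / e < 2 ^+ n.
  have /archi_boundP := divr_ge0 (ler0n R 4) (ltW e0).
  move=> /lt_le_trans; apply; rewrite -natrX ler_nat.
  by apply: (leq_trans (leq_maxr i _)); apply: ltnW; exact: ltn_expl.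
by rewrite exprVn ltr_pdivrMr ?exprn_gt0// mulrC -ltr_pdivrMr.
Qed.

(** The direct method. Sublevel sets along a minimizing sequence are nested,
    closed under midpoints and bounded; semicontinuity is applied along the
    strongly convergent sequence which they provide. *)
Lemma minimizer_exists : W_coercive T alpha p Phi -> W_convex T alpha p Phi ->
  W_lower_semicontinuous T alpha p Phi -> exists Z, minimizer_on A F Z.
Proof.
move=> Phi_coercive Phi_convex Phi_lsc.
have [F_gt [Z0 AZ0 FZ0]] := F_proper.
have /set0P FA0 : F @` A !=set0 by exists (F Z0), Z0.
have [u uA uinf] := ereal_inf_seq FA0.
pose b n := if n is m.+1 then u m else F Z0.
have bA n : exists2 Z, A Z & F Z = b n.
  by case: n => [|n]; [exists Z0|have [Z] := uA n; exists Z].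
pose C n : set (K -> R -> R) := [set f | [/\ forall k, continuous (f k),
  (N f < +oo)%E & forall i, (i <= n)%N -> (Phi (tensor_path f) <= b i)%E]].
have [M [M0 CM]] : exists M : R, 0 <= M /\ forall f, C 0%N f -> (N f <= M%:E)%E.
  have [M HM] := Phi_coercive (fine (F Z0)).
  exists (2 * `|M| `^ p); split; first by rewrite mulr_ge0 ?powR_ge0.
  move=> f [cf Nf fb]; apply: Wenergy_le => //.
  apply: (@le_trans _ _ M%:E); last by rewrite lee_fin ler_norm.
  by apply: HM; [exact: tensor_path_W|rewrite fineK//; exact: (fb 0%N)].
have C_nonempty n : C n !=set0.
  have [Z AZ Zb] : exists2 Z, A Z & forall i, (i <= n)%N -> (F Z <= b i)%E.
    elim: n => [|n [Z AZ Zb]].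
      by exists Z0 => // i; rewrite leqn0 => /eqP ->.
    have [Z' AZ' Z'b] := bA n.+1; have [ZZ'|Z'Z] := leP (F Z) (F Z').
      exists Z => // i; rewrite leq_eqVlt => /orP[/eqP ->|]; first by rewrite -Z'b.
      exact: Zb.
    exists Z' => // i; rewrite leq_eqVlt => /orP[/eqP ->|iN]; first by rewrite Z'b.
    exact: le_trans (ltW Z'Z) (Zb i iN).
  exists (frozen_coords T Z); have [cZ NZ] := frozen_coords_W T0 p2 (A_W AZ).
  by split => // i iN; rewrite Phi_frozen//; exact: Zb.
have C_nested n : C n.+1 `<=` C n.
  by move=> f [cf Nf fb]; split => // i iN; apply: fb; exact: leqW.
have C_mid n f g : C n f -> C n g -> C n (fun k t => (f k t + g k t) / 2).
  move=> [cf Nf fb] [cg Ng gb]; split.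
  - by move=> k t; apply: cvgMl; apply: cvgD; [exact: cf|exact: cg].
  - exact: Wenergy_mid_lty.
  - move=> i iN; rewrite -combination_half.
    have h01 : 0 < (2^-1 : R) < 1 by rewrite invr_gt0 ltr0n invf_lt1 ?ltr1n.
    apply: (le_trans (Phi_convex _ _ _ (tensor_path_W p2 cf Nf) (tensor_path_W p2 cg Ng) h01)).
    by apply: half_average; [exact: fb|exact: gb].
have C_cont n f : C n f -> forall k, continuous (f k) by case.
have [f [x [cf xC fM xf]]] :=
  nested_convex_sets T0 p2 a0 ap C_cont C_nonempty C_nested C_mid CM.
have Nf : (N f < +oo)%E by exact: le_lt_trans fM (ltry _).
have Wf := tensor_path_W p2 cf Nf.
have fb i : (Phi (tensor_path f) <= b i)%E.
  rewrite leNgt; apply/negP => bf.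
  have [Zi AZi Zib] := bA i.
  have /fineK bE : b i \is a fin_num.
    by rewrite fin_numE -{1}Zib F_gt//= -ltey (lt_le_trans bf) ?leey.
  rewrite -bE in bf; have [e e0 He] := Phi_lsc _ _ Wf bf.
  have [n iN ne] := geometric_small i e0.
  have [cx Nx xb] := xC n; have Wx := tensor_path_W p2 cx Nx.
  have h0 : 0 <= (2^-1 : R) ^+ n by rewrite exprn_ge0// invr_ge0.
  have h1 : 0 <= 2 * (2^-1 : R) ^+ n by exact: mulr_ge0.
  have xfn : (N (fun k t => (x n k t - f k t)%R) <= ((2 * (2^-1) ^+ n) `^ p)%:E)%E.
    apply: (le_trans (xf n)); rewrite lee_fin.
    rewrite -(sqrt_powR _ (sqr_ge0 _)) sqrtr_sqr (ger0_norm h0) powRM//.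
    rewrite ler_wpM2r ?powR_ge0// -[leLHS]powRr1//.
    by apply: ler_powR; [rewrite ler1n|apply: le_trans p2; rewrite ler1n].
  have := He _ Wx; rewrite tensor_pathB bE => lt_e.
  suff /lt_e : (sob_norm T alpha p (tensor_path (fun k t => x n k t - f k t)%R) < e%:E)%E.
    by rewrite ltNge (xb i iN).
  apply: (le_lt_trans (sob_norm_le p2 h1 xfn)).
  by rewrite lte_fin mulrA (_ : 2 * 2 = 4 :> R)//; ring.
have fin : (Phi (tensor_path f) < +oo)%E.
  by apply: (le_lt_trans (fb 0%N)); rewrite ltey_eq FZ0.
have [Z AZ FZ] := finite_Phi_attained cf Nf fin.
exists Z; split => // Z' AZ'; rewrite FZ.
apply: (@le_trans _ _ (ereal_inf (F @` A))); last first.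
  by apply: ereal_inf_lbound; exists Z'.
rewrite -(cvg_lim _ uinf)//; apply: lime_ge; first by apply/cvgP: uinf.
by apply: nearW => n; exact: (fb n.+1).
Qed.

(** The midpoint of two minimizers which differ on a set of positive measure would
    be admissible and have a smaller value. Equality almost everywhere is equality
    everywhere by continuity. *)
Lemma minimizer_unique Z1 Z2 : W_strictly_convex T alpha p Phi ->
  minimizer_on A F Z1 -> minimizer_on A F Z2 -> {in `[0, T], Z1 =1 Z2}.
Proof.
move=> Phi_strict [AZ1 min1] [AZ2 min2].
have [F_gt [Z0 AZ0 FZ0]] := F_proper.
have [c1 N1] := frozen_coords_W T0 p2 (A_W AZ1).
have [c2 N2] := frozen_coords_W T0 p2 (A_W AZ2).
have F1 : F Z1 \is a fin_num.
  rewrite fin_numE F_gt//= -ltey (le_lt_trans (min1 _ AZ0))//.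
  by rewrite ltey_eq FZ0.
have F12 : F Z2 = F Z1 by apply/eqP; rewrite eq_le min1// min2.
have [ae12|nae] := pselect (aeeq T (tensor_path (frozen_coords T Z1))
    (tensor_path (frozen_coords T Z2))).
  move=> t; rewrite in_itv/= => tI.
  have E k : frozen_coords T Z1 k t = frozen_coords T Z2 k t.
    apply: (continuous_ae_eq (c1 k) (c2 k)) => //.
    have [B [mB B0 sub]] := ae12; exists B; split=> // s xy_s; apply: sub => H.
    apply: xy_s => sI; have := congr1 (@tcoord R d ^~ k) (H sI).
    by rewrite !tcoord_path.
  have G Z : A Z -> (Z t).1.1 = 1.
    by move=> /A_W[+ _ _] => /(_ t); rewrite in_itv => /(_ tI)/G2P[].
  have := frozen_coordsE Z1 tI; have := frozen_coordsE Z2 tI.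
  have -> : tensor_path (frozen_coords T Z2) t = tensor_path (frozen_coords T Z1) t.
    by rewrite /tensor_path; congr (_, _);
      [apply/rowP => i|apply/matrixP => i j]; rewrite !mxE E.
  move=> ->; rewrite /drop_scalar; have := G _ AZ1; have := G _ AZ2.
  by case: (Z1 t) (Z2 t) => [[? ?] ?] [[? ?] ?] /= -> -> [-> ->].
exfalso.
have h01 : 0 < (2^-1 : R) < 1 by rewrite invr_gt0 ltr0n invf_lt1 ?ltr1n.
have := Phi_strict _ _ _ (tensor_path_W p2 c1 N1) (tensor_path_W p2 c2 N2) nae h01.
rewrite !Phi_frozen// F12 => /(_ F1 F1); rewrite combination_half.
set m := fun k t => _ => lt_m.
have cm k : continuous (m k).
  by move=> t; apply: cvgMl; apply: cvgD; [exact: c1|exact: c2].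
have Nm : (N m < +oo)%E by exact: (Wenergy_mid_lty p2 c1 c2 N1 N2).
have m_lt : (Phi (tensor_path m) < F Z1)%E.
  by apply: (lt_le_trans lt_m); exact: half_average.
have [Z AZ FZ] := finite_Phi_attained cm Nm (lt_le_trans m_lt (leey _)).
by have := min1 _ AZ; rewrite FZ leNgt m_lt.
Qed.

End Functional.
End Minimization.
Theorem proposition3p16 (R : realType) (T : R) (k l : nat) (alpha p : R)
    (X : R -> tens2 R k) (Y : R -> tens2 R l) :
  0 < T ->
  1 / 3 < alpha < 1 / 2 ->
  1 < p ->
  1 / p < alpha ->
  WG2 T alpha p X ->
  WG2 T alpha p Y ->
  admissible T alpha p X Y !=set0 /\
  forall (F : (R -> tens2 R (k + l)) -> \bar R)
         (Fbar : (R -> tens2plus R (k + l)) -> \bar R),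
    proper_on (admissible T alpha p X Y) F ->
    functional_on_W T alpha p Fbar ->
    extends_by_infty T alpha p (admissible T alpha p X Y) F Fbar ->
    W_coercive T alpha p Fbar ->
    W_convex T alpha p Fbar ->
    W_lower_semicontinuous T alpha p Fbar ->
    (exists Zstar, minimizer_on (admissible T alpha p X Y) F Zstar) /\
    (W_strictly_convex T alpha p Fbar ->
       forall Z1 Z2, minimizer_on (admissible T alpha p X Y) F Z1 ->
                     minimizer_on (admissible T alpha p X Y) F Z2 ->
         {in `[0, T], Z1 =1 Z2}).
Proof.
move=> T0 /andP[a3 a2] p1 ap WX WY.
have a0 : 0 < alpha by apply: lt_trans a3; rewrite divr_gt0.
have p2 : 2 <= p.
  have p0 : 0 < p by exact: lt_trans p1.
  have := lt_trans ap a2; rewrite ltr_pdivrMr// mulrAC ltr_pdivlMr// !mul1r.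
  exact: ltW.
have A_W : admissible T alpha p X Y `<=` @WG2 R T alpha p (k + l) by move=> Z [].
split; first exact: extension_exists.
move=> F Fbar F_proper Fbar_W Fbar_ext Fbar_coercive Fbar_convex Fbar_lsc; split.
  exact: (minimizer_exists T0 p2 a0 ap A_W F_proper Fbar_W Fbar_ext).
move=> Fbar_strict Z1 Z2 min1 min2.
exact: (minimizer_unique T0 p2 A_W F_proper Fbar_W Fbar_ext Fbar_strict min1 min2).
Qed.
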